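(* Let $0<a<1/2$ and $\sigma_n = n^{-a}$ for $n\ge 1$. Let $\{X_n\}_{n\ge 1}$ be a sequence of independent $\{0,1\}$-valued random variables on a probability space $\Omega$ with $\mathbb{E}X_n=\sigma_n$, and for $\omega\in\Omega$ let $a_n(\omega)$ be the smallest integer such that $X_1(\omega)+\dots+X_{a_n(\omega)}(\omega)=n$. Let $0<\epsilon<1$ be fixed and let $p:\mathbb{R}\to\mathbb{R}$ be a logarithmico-exponential function such that (1) $p(x+y+z)-p(x+y)-p(x+z)+p(x)=O(x^{\epsilon-1}yz)$ for all $x,y,z>0$; and (2) for every polynomial $q(x)$ that is a real constant multiple of a polynomial with rational coefficients, $\dfrac{|q(x)-p(x)|}{\log x}\to\infty$ as $x\to\infty$. Then for almost every $\omega\in\Omega$ the following holds: for every measure-preserving system $(X,\mu,T)$ and every $f\in L^1(X)$, the averages \[ \frac1N\sum_{n=1}^N e(p(n))\,T^{a_n(\omega)}f \] converge to $0$ pointwise $\mu$-almost everywhere as $N\to\infty$.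
   Context: Notation: $e(t):=e^{2\pi i t}$. A measure-preserving system $(X,\mu,T)$ consists of a probability space $(X,\mu)$ and a measure-preserving transformation $T:X\to X$; $T^nf:=f\circ T^n$. The notation $A=O(B)$ means $|A|\le CB$ with a constant $C$ independent of $x,y,z$. A logarithmico-exponential function is a real function which, for all sufficiently large $x$, is given by an expression obtained by finitely many combinations of real constants, the variable $x$, and the symbols $\exp$, $\log$, $\cdot$ and $+$ (with $\log$ applied only to eventually positive functions); for example $x^{1/2}=\exp(\tfrac12\log x)$ and $x^\pi/\log\log x$. The full-measure set of $\omega$ may depend on $p$ (and $a$) but not on $(X,\mu,T)$ or $f$. *)

(* Defs.v *)
From HB Require Import structures.
From mathcomp Require Import all_boot all_order all_algebra.
From mathcomp Require Import finmap complex.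
From mathcomp Require Import all_classical all_reals all_analysis.

Set Implicit Arguments.
Unset Strict Implicit.
Unset Printing Implicit Defensive.

Import Order.TTheory GRing.Theory Num.Theory.
Import numFieldNormedType.Exports.

Local Open Scope classical_set_scope.
Local Open Scope ring_scope.

Definition e {R : realType} (t : R) : R[i] :=
  (cos (2 * pi * t) +i* sin (2 * pi * t))%C.

Inductive LE_expr (R : Type) : Type :=
  | LE_const of R
  | LE_var
  | LE_exp of LE_expr R
  | LE_log of LE_expr R
  | LE_mul of LE_expr R & LE_expr R
  | LE_add of LE_expr R & LE_expr R.
Arguments LE_var {R}.

Fixpoint LE_eval {R : realType} (E : LE_expr R) (x : R) : R :=
  match E with
  | LE_const c => c
  | LE_var => x
  | LE_exp F => expR (LE_eval F x)
  | LE_log F => ln (LE_eval F x)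
  | LE_mul F G => LE_eval F x * LE_eval G x
  | LE_add F G => LE_eval F x + LE_eval G x
  end.

(* [ln] is a total function in the library, so the requirement that logarithms
   only be applied to eventually positive functions is imposed separately. *)
Fixpoint LE_wf {R : realType} (E : LE_expr R) : Prop :=
  match E with
  | LE_const _ | LE_var => True
  | LE_exp F => LE_wf F
  | LE_log F => LE_wf F /\ (\forall x \near +oo, 0 < LE_eval F x)
  | LE_mul F G | LE_add F G => LE_wf F /\ LE_wf G
  end.

Definition logarithmico_exponential {R : realType} (p : R -> R) : Prop :=
  exists E : LE_expr R, LE_wf E /\ (\forall x \near +oo, p x = LE_eval E x).

Definition independent_RVs {d} {Omega : measurableType d} {R : realType}
    (P : probability Omega R) (D : set nat) (X : nat -> {RV P >-> R}) : Prop :=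
  forall (J : {fset nat}) (B : nat -> set R),
    [set` J] `<=` D -> (forall i, measurable (B i)) ->
    P (\bigcap_(i in [set` J]) (X i @^-1` B i)) =
    (\prod_(i <- J) P (X i @^-1` B i))%E.

(* The default value 0 is only taken at points w for which no partial sum
   X 1 w + ... + X k w equals n. *)
Definition hitting_index {Omega : Type} {R : realType} (X : nat -> Omega -> R)
    (n : nat) (w : Omega) : nat :=
  xget 0%N [set k | \sum_(1 <= i < k.+1) X i w = n%:R /\
    forall m, \sum_(1 <= i < m.+1) X i w = n%:R -> (k <= m)%N].

Definition measure_preserving {d} {X : measurableType d} {R : realType}
    (mu : {measure set X -> \bar R}) (T : X -> X) : Prop :=
  measurable_fun setT T /\
  forall A, measurable A -> mu (T @^-1` A) = mu A.

Definition complex_L1 {d} {X : measurableType d} {R : realType}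
    (mu : {measure set X -> \bar R}) (f : X -> R[i]) : Prop :=
  mu.-integrable setT (fun x => (complex.Re (f x))%:E) /\
  mu.-integrable setT (fun x => (complex.Im (f x))%:E).

Definition random_average {R : realType} {X : Type} (p : R -> R) (b : nat -> nat)
    (T : X -> X) (f : X -> R[i]) (N : nat) (x : X) : R[i] :=
  N%:R^-1 * \sum_(1 <= n < N.+1) e (p n%:R) * f (iter (b n) T x).

(* Main.v *)
(* Splitting e(p(n)) and f into real and imaginary parts, let th be one of the
   sequences cos(2 pi p(n)), sin(2 pi p(n)), put S_k = X_1 + ... + X_k and
   sigma_k = k^(-a).  The averages along a_n become the twisted sums over k <= M of
   X_k th(S_k) f(T^k y), which have to be o(S_M) for almost every y.

   The means of th tend to 0.  The germ of p lies in a Hardy field, so p' has a limit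
   (finite or infinite).  If the limit is finite and not an integer, or infinite, this
   is an elementary telescoping argument, respectively van der Corput's inequality
   with shifts far apart and the second-difference bound (1); if it is an integer,
   (2) gives x |p'(x) - lim p'| -> oo and the Kusmin-Landau inequality applies.

   For almost every omega, Freedman's inequality and the Borel-Cantelli lemma give
   square-root cancellation (up to logarithms), on the windows (2^j, 2^(j+1)] and
   (i^B, (i+1)^B], for the counts of successes and for all autocorrelations of
   (X_k - sigma_k) th(S_(k-1) + 1), which is a martingale difference.  Since a < 1/2,
   these are small compared with the square of the expected number of successes.
   What remains is deterministic in omega, hence valid for all systems at once.

   Expanding squares, autocorrelation bounds on dyadic windows give a weak type (1,1)
   maximal inequality for the averages of |f| along the successes; polynomial windows
   give, by Borel-Cantelli in y, that the centered sums of a bounded f are o(S_M).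
   By the mean ergodic theorem f = h + (g - g o T) + f', with h small in L^1, g bounded,
   f' invariant.  The maximal inequality disposes of h, the mean of th of f'.  For the
   coboundary the centered part is o(S_M), and the compensator, whose weights
   sigma_k th(S_(k-1) + 1) rarely change, is handled by summation by parts. *)
Require Import Defs.
From mathcomp Require Import all_boot all_order all_algebra.
From mathcomp Require Import finmap complex.
From mathcomp Require Import all_classical all_reals all_analysis.
From mathcomp Require Import measurable_realfun.
From mathcomp Require Import ring lra zify.
Set Implicit Arguments.
Unset Strict Implicit.
Unset Printing Implicit Defensive.
Import Order.TTheory GRing.Theory Num.Theory.
Import numFieldNormedType.Exports.
Local Open Scope classical_set_scope.
Local Open Scope ring_scope.

(** * Hardy fields *)

(** The obstacle is the order of quantifiers: one full-measure set of omega must serve every system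
    and every f in L^1. Randomness is therefore used only to bound numbers attached to the weights
    alone, their counts and autocorrelations. Since T preserves mu, the mean square of a weighted
    sum over a window depends on the weights through such numbers.

    The exponent 1/2 arises as follows. On a window of length L with success probability about s, an
    autocorrelation has size s sqrt(L) up to logarithms; L of them must stay below the squared
    expected count (L s)^2, so s sqrt(L) has to grow.

    Two kinds of windows are needed. For unbounded f the truncation errors must sum to O(f / t) over
    all scales, which asks for geometric growth. But a dyadic window is as large as all that
    precedes it, so an incomplete one cannot be discarded; a polynomial window carries a vanishing
    share of the past successes.

    The twist th(S_k) involves trial k itself. Replacing S_k by S_(k-1) + 1, which equals it at a
    success, makes the weight predictable. *)

Section Hardy.
Variable R : realType.
Implicit Types (f g u : R -> R) (K : (R -> R) -> Prop).

Lemma lt_maxl (a b z : R) : Num.max a b < z -> a < z.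
Proof. by rewrite gt_max => /andP[]. Qed.

Lemma lt_maxr (a b z : R) : Num.max a b < z -> b < z.
Proof. by rewrite gt_max => /andP[]. Qed.

Definition ev (P : R -> Prop) := exists A : R, forall x, A < x -> P x.

Lemma evT (P : R -> Prop) : (forall x, P x) -> ev P.
Proof. by move=> h; exists 0. Qed.

Lemma ev_gt (A : R) : ev (fun x => A < x).
Proof. by exists A. Qed.

Lemma ev_imp (P Q : R -> Prop) : (forall x, P x -> Q x) -> ev P -> ev Q.
Proof. by move=> h [A hA]; exists A => x /hA /h. Qed.

Lemma ev_imp2 (P1 P2 Q : R -> Prop) :
  (forall x, P1 x -> P2 x -> Q x) -> ev P1 -> ev P2 -> ev Q.
Proof.
move=> h [A hA] [B hB]; exists (Num.max A B) => x.
by rewrite gt_max => /andP[/hA ? /hB ?]; exact: h.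
Qed.

Lemma evI (P Q : R -> Prop) : ev P -> ev Q -> ev (fun x => P x /\ Q x).
Proof. exact: ev_imp2. Qed.

Lemma evP (P : R -> Prop) : ev P <-> (\forall x \near +oo, P x).
Proof.
split=> [[A hA]|]; first by exists A; split => //; exact: num_real.
by move=> [A [_ hA]]; exists A.
Qed.

Lemma ev_ex (P : R -> Prop) : ev P -> exists x, P x.
Proof. by move=> [A hA]; exists (A + 1); apply: hA; rewrite ltrDl. Qed.

Lemma is_derive_ext f g (A x d : R) : (forall y, A < y -> f y = g y) -> A < x ->
  is_derive x 1 f d -> is_derive x 1 g d.
Proof.
move=> fg Ax; apply: near_eq_is_derive.
by near=> y; apply: fg; near: y; exact: lt_nbhsr.
Unshelve. all: by end_near. Qed.

Definition derev f g := ev (fun x => is_derive x 1 f (g x)).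

Lemma derev_ext f f1 g : ev (fun x => f x = f1 x) -> derev f g -> derev f1 g.
Proof.
move=> [A hA] [B hB]; exists (Num.max A B) => x.
rewrite gt_max => /andP[Ax /hB]; exact: is_derive_ext Ax.
Qed.

Lemma derev_extr f g g1 : ev (fun x => g x = g1 x) -> derev f g -> derev f g1.
Proof. by apply: ev_imp2 => x <-. Qed.

Lemma derev_cst (c : R) : derev (fun=> c) (fun=> 0).
Proof. by apply: evT => x; exact: is_derive_cst. Qed.

Lemma derev_id : derev id (fun=> 1).
Proof. by apply: evT => x; exact: is_derive_id. Qed.

Lemma derevD f g df dg : derev f df -> derev g dg ->
  derev (fun x => f x + g x) (fun x => df x + dg x).
Proof. by apply: ev_imp2 => x; exact: is_deriveD. Qed.

Lemma derevM f g df dg : derev f df -> derev g dg ->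
  derev (fun x => f x * g x) (fun x => df x * g x + f x * dg x).
Proof.
apply: ev_imp2 => x h1 h2; have h3 := is_deriveM h1 h2.
rewrite [X in is_derive _ _ _ X](_ : _ = f x *: dg x + g x *: df x) //.
by rewrite /GRing.scale /= addrC [g x * _]mulrC.
Qed.

Lemma derevV f df : ev (fun x => f x != 0) -> derev f df ->
  derev (fun x => (f x)^-1) (fun x => - (df x * (f x)^-1 ^+ 2)).
Proof.
apply: ev_imp2 => x h1 h2; have h3 := is_deriveV h1 h2.
rewrite [X in is_derive _ _ _ X](_ : _ = - f x ^- 2 *: df x) //.
by rewrite /GRing.scale /= -exprVn mulNr mulrC.
Qed.

Lemma derev_ln f df : ev (fun x => 0 < f x) -> derev f df ->
  derev (fun x => ln (f x)) (fun x => df x * (f x)^-1).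
Proof.
apply: ev_imp2 => x h1 h2.
by rewrite mulrC; exact: (@is_derive1_comp _ (@ln R) f x _ _ (is_derive1_ln h1) h2).
Qed.

Lemma derev_exp f df : derev f df ->
  derev (fun x => expR (f x)) (fun x => df x * expR (f x)).
Proof.
apply: ev_imp => x h2.
by rewrite mulrC; exact: (@is_derive1_comp _ expR f x _ _ (is_derive_expR _) h2).
Qed.

Lemma is_derive_MVT f df (A : R) : (forall x, A < x -> is_derive x 1 f (df x)) ->
  forall x y, A < x -> x < y -> exists2 c, x < c < y & f y - f x = df c * (y - x).
Proof.
move=> h x y Ax xy.
have [|c|c cxy E] := @MVT R f df x y xy.
- by move=> z; rewrite in_itv /= => /andP[xz _]; apply: h; exact: lt_trans xz.
- apply: derivable_within_continuous => z; rewrite in_itv /= => /andP[xz _].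
  have hz : A < z by exact: lt_le_trans xz.
  by have [] := h z hz.
- by exists c => //; move: cxy; rewrite in_itv.
Qed.

Definition evsign f :=
  ev (fun x => f x = 0) \/ ev (fun x => 0 < f x) \/ ev (fun x => f x < 0).

Lemma evsignN f : evsign (fun x => - f x) -> evsign f.
Proof.
case=> [h|[h|h]]; [left|right; right|right; left]; apply: ev_imp h => x.
- by move/eqP; rewrite oppr_eq0 => /eqP.
- by rewrite oppr_gt0.
- by rewrite oppr_lt0.
Qed.

Lemma evsign_ext f g : ev (fun x => f x = g x) -> evsign f -> evsign g.
Proof.
move=> e [h|[h|h]]; [left|right; left|right; right];
  by apply: ev_imp2 e h => x ->.
Qed.

Lemma evsignM f g : evsign f -> evsign g -> evsign (fun x => f x * g x).
Proof.
case=> [h|[h|h]].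
- by move=> _; left; apply: ev_imp h => x ->; rewrite mul0r.
- case=> [k|[k|k]]; [left|right; left|right; right];
    apply: ev_imp2 h k => x hx kx; first by rewrite kx mulr0.
  + exact: mulr_gt0.
  + by rewrite pmulr_rlt0.
- case=> [k|[k|k]]; [left|right; right|right; left];
    apply: ev_imp2 h k => x hx kx; first by rewrite kx mulr0.
  + by rewrite nmulr_rlt0.
  + by rewrite nmulr_rgt0.
Qed.

(** A strictly increasing function changes sign at most once: as soon as it is nonnegative it stays
    positive, and otherwise it is negative throughout. *)
Lemma evsign_der_gt0 f df : derev f df -> ev (fun x => 0 < df x) -> evsign f.
Proof.
move=> [A hA] [B hB].
pose M := Num.max A B.
have inc x y : M < x -> x < y -> f x < f y.
  move=> Mx xy; have [c /andP[xc cy] E] := @is_derive_MVT f df M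
    (fun z Mz => hA z (lt_maxl Mz)) x y Mx xy.
  rewrite -subr_gt0 E mulr_gt0 ?subr_gt0 //; apply: hB.
  exact: lt_maxr (lt_trans Mx xc).
have [[x Mx fx]|nx] := pselect (exists2 x, M < x & 0 <= f x).
  right; left; exists x => y xy; exact: le_lt_trans (inc _ _ Mx xy).
right; right; exists M => x Mx; rewrite ltNge; apply/negP => fx.
by apply: nx; exists x.
Qed.

Lemma evsign_der f df : derev f df -> evsign df -> evsign f.
Proof.
move=> fdf [|[|]].
- move=> [B hB]; case: fdf => A hA.
  pose M := Num.max A B.
  have cst x y : M < x -> x < y -> f y = f x.
    move=> Mx xy; have [c /andP[xc cy] E] := @is_derive_MVT f df M
      (fun z Mz => hA z (lt_maxl Mz)) x y Mx xy.
    apply/eqP; rewrite -subr_eq0 E hB ?mul0r//.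
    exact: lt_maxr (lt_trans Mx xc).
  have M1 : M < M + 1 by rewrite ltrDl.
  have [f0|f0|f0] := ltgtP (f (M + 1)) 0.
  + by right; right; exists (M + 1) => x h; rewrite (cst _ _ M1 h).
  + by right; left; exists (M + 1) => x h; rewrite (cst _ _ M1 h).
  + by left; exists (M + 1) => x h; rewrite (cst _ _ M1 h).
- exact: evsign_der_gt0.
- move=> h; apply: evsignN; apply: (@evsign_der_gt0 _ (fun x => - df x)).
    by apply: ev_imp fdf => x; exact: is_deriveN.
  by apply: ev_imp h => x; rewrite oppr_gt0.
Qed.

(** Hardy fields as predicates on functions; [hf_ext] makes them predicates on germs at infinity. As
    [0^-1 = 0], closure under inverses is harmless for the zero germ, and [hf_sign] makes every
    other germ eventually invertible. *)
Record hardy K : Prop := Hardy {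
  hf_ext : forall f g, K f -> ev (fun x => f x = g x) -> K g;
  hf_cst : forall c : R, K (fun=> c);
  hfD : forall f g, K f -> K g -> K (fun x => f x + g x);
  hfM : forall f g, K f -> K g -> K (fun x => f x * g x);
  hfV : forall f, K f -> K (fun x => (f x)^-1);
  hf_sign : forall f, K f -> evsign f;
  hf_der : forall f, K f -> exists2 g, K g & derev f g }.

Lemma hfN K f : hardy K -> K f -> K (fun x => - f x).
Proof.
move=> hK Kf; apply: (hf_ext hK (hfM hK (hf_cst hK (-1)) Kf)).
by apply: evT => x; rewrite mulN1r.
Qed.

Lemma hfB K f g : hardy K -> K f -> K g -> K (fun x => f x - g x).
Proof. by move=> hK Kf Kg; exact: (hfD hK Kf (hfN hK Kg)). Qed.

Definition ev_cst f := exists c : R, ev (fun x => f x = c).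

Lemma hardy_cst : hardy ev_cst.
Proof.
split.
- by move=> f g [c fc] fg; exists c; apply: ev_imp2 fc fg => x ->.
- by move=> c; exists c; apply: evT.
- move=> f g [c fc] [d gd]; exists (c + d).
  by apply: ev_imp2 fc gd => x -> ->.
- move=> f g [c fc] [d gd]; exists (c * d).
  by apply: ev_imp2 fc gd => x -> ->.
- by move=> f [c fc]; exists c^-1; apply: ev_imp fc => x ->.
- move=> f [c fc]; have [c0|c0|c0] := ltgtP c 0.
  + by right; right; apply: ev_imp fc => x ->.
  + by right; left; apply: ev_imp fc => x ->.
  + by left; apply: ev_imp fc => x ->.
- move=> f [c fc]; exists (fun=> 0); first by exists 0; apply: evT.
  apply: (derev_ext _ (derev_cst c)).
  by apply: ev_imp fc => x ->.
Qed.

(** * Adjoining a logarithm or an exponential to a Hardy field *)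

Section Extension.
Variables (K : (R -> R) -> Prop) (hK : hardy K) (u : R -> R).

(** Germs of polynomials in [u] over [K] of formal degree at most [n], peeled from the leading term;
    the leading coefficient may be zero. *)
Fixpoint hpoly n f : Prop := if n is n'.+1 then
  exists c g, [/\ K c, hpoly n' g & ev (fun x => f x = g x + c x * u x ^+ n)]
  else K f.

Lemma hpoly_ext n f g : ev (fun x => f x = g x) -> hpoly n f -> hpoly n g.
Proof.
case: n => [|n] /= e; first by move=> h; exact: (hf_ext hK h).
move=> [c [k [Kc hk h]]]; exists c, k; split => //.
by apply: ev_imp2 e h => x ->.
Qed.

Lemma hpolyS n f : hpoly n f -> hpoly n.+1 f.
Proof.
move=> hf; exists (fun=> 0), f; split => //; first exact: hf_cst.
by apply: evT => x; rewrite mul0r addr0.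
Qed.

Lemma hpoly_le m n f : (m <= n)%N -> hpoly m f -> hpoly n f.
Proof.
move=> /subnK <-; elim: (n - m)%N => //= k IH /IH; exact: hpolyS.
Qed.

Lemma hpolyD n f g : hpoly n f -> hpoly n g -> hpoly n (fun x => f x + g x).
Proof.
elim: n f g => [|n IH] f g /=; first exact: hfD.
move=> [c [k [Kc hk h]]] [c' [k' [Kc' hk' h']]].
exists (fun x => c x + c' x), (fun x => k x + k' x); split.
- exact: hfD.
- exact: IH.
- by apply: ev_imp2 h h' => x -> ->; ring.
Qed.

Lemma hpolyZ n c f : K c -> hpoly n f -> hpoly n (fun x => c x * f x).
Proof.
move=> Kc; elim: n f => [|n IH] f /=; first exact: hfM.
move=> [c' [k' [Kc' hk' h']]].
exists (fun x => c x * c' x), (fun x => c x * k' x); split.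
- exact: hfM.
- exact: IH.
- by apply: ev_imp h' => x ->; ring.
Qed.

Lemma hpolyX n k f : hpoly n f -> hpoly (n + k) (fun x => f x * u x ^+ k).
Proof.
case: k => [|k] hf.
  by rewrite addn0; apply: hpoly_ext hf; apply: evT => x; rewrite mulr1.
elim: n f hf => [|n IH] f /=.
  move=> Kf; exists f, (fun=> 0); split => //.
    by apply: (@hpoly_le 0%N) => //=; exact: hf_cst.
  by apply: evT => x; rewrite add0r.
move=> [c [g [Kc hg e]]].
exists c, (fun x => g x * u x ^+ k.+1); split => //.
  exact: IH.
by apply: ev_imp e => x ->; rewrite -addSn exprD mulrDl mulrA.
Qed.

Lemma hpolyM m n f g : hpoly m f -> hpoly n g ->
  hpoly (m + n) (fun x => f x * g x).
Proof.
elim: m f => [|m IH] f; first by rewrite add0n; exact: hpolyZ.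
move=> [c [k [Kc hk e]]] hg.
apply: (@hpoly_ext _ (fun x => k x * g x + (c x * g x) * u x ^+ m.+1)).
  by apply: ev_imp e => x ->; ring.
apply: hpolyD; first by rewrite addSn; apply: hpolyS; exact: IH.
by rewrite addnC; apply: hpolyX; exact: hpolyZ.
Qed.

(** For an exponential the term to isolate is the constant one: [u] is eventually positive and can
    be factored out of all the others. *)
Lemma hpoly_low n f : hpoly n.+1 f ->
  exists c g, [/\ K c, hpoly n g & ev (fun x => f x = c x + u x * g x)].
Proof.
elim: n f => [|n IH] f.
  move=> [c [g [Kc hg e]]]; exists g, c; split => //.
  by apply: ev_imp e => x ->; rewrite expr1 mulrC.
move=> [c [g [Kc hg e]]]; have [c0 [g0 [Kc0 hg0 e0]]] := IH _ hg.
exists c0, (fun x => g0 x + c x * u x ^+ n.+1); split => //.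
  by exists c, g0; split => //; exact: evT.
by apply: ev_imp2 e e0 => x -> ->; rewrite [u x ^+ n.+2]exprS; ring.
Qed.

Definition hsign := forall n f, hpoly n f -> evsign f.
Definition hder := forall n f, hpoly n f -> exists2 g, hpoly n g & derev f g.

Definition adjoin f := exists m n P Q, [/\ hpoly m P, hpoly n Q,
  ev (fun x => Q x != 0) & ev (fun x => f x = P x / Q x)].

Lemma adjoin_sub f : K f -> adjoin f.
Proof.
move=> Kf; exists 0%N, 0%N, f, (fun=> 1); split => //; first exact: hf_cst.
  by apply: evT => x; rewrite oner_neq0.
by apply: evT => x; rewrite divr1.
Qed.

Lemma adjoin_gen : adjoin u.
Proof.
exists 1%N, 0%N, u, (fun=> 1); split => /=.
- exists (fun=> 1), (fun=> 0); split; [exact: hf_cst|exact: hf_cst|].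
  by apply: evT => x; rewrite add0r mul1r expr1.
- exact: hf_cst.
- by apply: evT => x; rewrite oner_neq0.
- by apply: evT => x; rewrite divr1.
Qed.

Lemma hpoly_neq0 n Q : hsign -> hpoly n Q ->
  ev (fun x => Q x = 0) \/ ev (fun x => Q x != 0).
Proof.
move=> hs /hs [h|[h|h]]; [by left|right|right]; apply: ev_imp h => x.
  by move=> /lt0r_neq0.
by move=> /ltr0_neq0.
Qed.

(** Everything about K(u) reduces to polynomials: [P / Q] has the sign of [P Q], the quotient rule
    stays among fractions, and the eventual sign of [P] decides whether it can become a
    denominator. *)
Lemma hardy_adjoin : hsign -> hder -> hardy adjoin.
Proof.
move=> hs hd; split.
- move=> f g [m [n [P [Q [hP hQ Q0 e]]]]] fg; exists m, n, P, Q; split => //.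
  by apply: ev_imp2 fg e => x ->.
- by move=> c; apply: adjoin_sub; exact: hf_cst.
- move=> f1 f2 [m [n [P [Q [hP hQ Q0 e]]]]] [m' [n' [P' [Q' [hP' hQ' Q0' e']]]]].
  exists ((m + n') + (n + m'))%N, (n + n')%N.
  exists (fun x => P x * Q' x + Q x * P' x), (fun x => Q x * Q' x); split.
  + apply: hpolyD; [apply: (@hpoly_le (m + n'))|apply: (@hpoly_le (n + m'))];
      rewrite ?leq_addr ?leq_addl//; exact: hpolyM.
  + exact: hpolyM.
  + by apply: ev_imp2 Q0 Q0' => x a b; rewrite mulf_neq0.
  + apply: ev_imp2 (ev_imp2 (fun x => @conj _ _) e e') (ev_imp2 (fun x => @conj _ _) Q0 Q0').
    by move=> x [-> ->] [a b]; field; rewrite a b.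
- move=> f1 f2 [m [n [P [Q [hP hQ Q0 e]]]]] [m' [n' [P' [Q' [hP' hQ' Q0' e']]]]].
  exists (m + m')%N, (n + n')%N.
  exists (fun x => P x * P' x), (fun x => Q x * Q' x); split.
  + exact: hpolyM.
  + exact: hpolyM.
  + by apply: ev_imp2 Q0 Q0' => x a b; rewrite mulf_neq0.
  + by apply: ev_imp2 e e' => x -> ->; rewrite invfM mulrACA.
- move=> f [m [n [P [Q [hP hQ Q0 e]]]]].
  have [P0|P0] := hpoly_neq0 hs hP.
    exists 0%N, 0%N, (fun=> 0), (fun=> 1); split; [exact: hf_cst|exact: hf_cst| |].
      by apply: evT => x; rewrite oner_neq0.
    by apply: ev_imp2 e P0 => x -> ->; rewrite !mul0r invr0.
  exists n, m, Q, P; split => //.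
  by apply: ev_imp e => x ->; rewrite invf_div.
- move=> f [m [n [P [Q [hP hQ Q0 e]]]]].
  apply: (@evsign_ext (fun x => P x * (Q x * (Q x)^-1 ^+ 2))).
    apply: ev_imp2 e Q0 => x -> a; field; exact: a.
  apply: evsignM; first exact: hs hP.
  apply: evsignM; first exact: hs hQ.
  right; left; apply: ev_imp Q0 => x a.
  by rewrite exprn_even_gt0 //= invr_eq0.
- move=> f [m [n [P [Q [hP hQ Q0 e]]]]].
  have [P' hP' dP] := hd _ _ hP; have [Q' hQ' dQ] := hd _ _ hQ.
  exists (fun x => P' x * (Q x)^-1 + P x * (- (Q' x * (Q x)^-1 ^+ 2))).
    exists (m + n)%N, (n + n)%N, (fun x => P' x * Q x + -1 * (P x * Q' x)).
    exists (fun x => Q x * Q x); split.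
    + apply: hpolyD; first exact: hpolyM.
      by apply: (@hpolyZ _ (fun=> -1)); [exact: hf_cst|exact: hpolyM].
    + exact: hpolyM.
    + by apply: ev_imp Q0 => x a; rewrite mulf_neq0.
    + by apply: ev_imp Q0 => x a; field; exact: a.
  apply: (derev_ext (f := fun x => P x * (Q x)^-1)).
    by apply: ev_imp e => x ->.
  by apply: derevM => //; exact: derevV.
Qed.

Lemma derev_pow f df n : derev f df ->
  derev (fun x => f x ^+ n) (fun x => n%:R * df x * f x ^+ n.-1).
Proof.
move=> d; elim: n => [|n IH].
  apply: (derev_extr (g := fun=> 0)); last exact: derev_cst.
  by apply: evT => x; rewrite !mul0r.
apply: (derev_ext (f := fun x => f x * f x ^+ n)).
  by apply: evT => x; rewrite exprS.
apply: derev_extr (derevM d IH); apply: evT => x /=.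
case: n {IH} => [|n] /=; first by rewrite !expr0; ring.
by rewrite exprS -[in RHS]natr1; ring.
Qed.

Lemma hder_gen du : derev u du ->
  (forall n, hpoly n (fun x => n%:R * du x * u x ^+ n.-1)) -> hder.
Proof.
move=> d h; elim=> [|n IH] f /=; first exact: hf_der.
move=> [c [g [Kc hg e]]].
have [g' hg' dg] := IH _ hg; have [c' Kc' dc] := hf_der hK Kc.
exists (fun x => g' x + (c' x * u x ^+ n.+1 + c x * (n.+1%:R * du x * u x ^+ n))).
  apply: (@hpolyD n.+1); first exact: hpolyS.
  apply: (@hpolyD n.+1); last by apply: hpolyZ => //; exact: (h n.+1).
  exact: (@hpolyX 0%N n.+1).
apply: (derev_ext (f := fun x => g x + c x * u x ^+ n.+1)).
  by apply: ev_imp e => x ->.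
by apply: derevD => //; apply: derevM => //; exact: (derev_pow n.+1 d).
Qed.

Lemma hsign_of_lower :
  (forall n c g, K c -> ev (fun x => c x != 0) -> hpoly n g ->
    (forall f, hpoly n f -> evsign f) ->
    (evsign (fun x => g x + c x * u x ^+ n.+1))) -> hsign.
Proof.
move=> H; elim=> [|n IH] f /=; first exact: hf_sign.
move=> [c [g [Kc hg e]]].
have [c0|c0] : ev (fun x => c x = 0) \/ ev (fun x => c x != 0).
  have [h|[h|h]] := hf_sign hK Kc; [by left|right|right]; apply: ev_imp h => x.
    by move=> /lt0r_neq0.
  by move=> /ltr0_neq0.
  apply: IH; apply: hpoly_ext hg.
  by apply: ev_imp2 e c0 => x -> ->; rewrite mul0r addr0.
apply: (evsign_ext _ (H n c g Kc c0 hg IH)).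
by apply: ev_imp e => x ->.
Qed.

(** Induction on the degree. After division by the leading coefficient, differentiation lowers the
    degree, because [u ^ n] has derivative [n u' u ^ (n-1)] with [u'] in [K]. The sign of the
    derivative is known by induction, and [evsign_der] lifts it. The case [u = id] is included. *)
Lemma hardy_log du : derev u du -> K du -> hardy adjoin.
Proof.
move=> d Kdu.
have hd : hder.
  apply: (hder_gen d) => -[|n].
    by apply: (@hpoly_ext _ (fun=> 0)); [apply: evT => x; rewrite !mul0r|exact: hf_cst].
  apply: hpolyS; apply: (@hpolyX 0%N n (fun x => n.+1%:R * du x)).
  by apply: (hfM hK) => //; exact: hf_cst.
apply: hardy_adjoin => //; apply: hsign_of_lower => n c g Kc c0 hg IH.
pose h x := (c x)^-1 * g x + u x ^+ n.+1.
apply: (@evsign_ext (fun x => c x * h x)).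
  by apply: ev_imp c0 => x cx; rewrite /h mulrDr mulrA mulfV// mul1r.
apply: evsignM; first exact: hf_sign Kc.
have [k hk dk] := hd _ _ (hpolyZ (hfV hK Kc) hg).
apply: (@evsign_der _ (fun x => k x + n.+1%:R * du x * u x ^+ n)).
  by apply: derevD => //; exact: (derev_pow n.+1 d).
apply: IH; apply: hpolyD => //.
apply: (@hpolyX 0%N n (fun x => n.+1%:R * du x)).
by apply: (hfM hK) => //; exact: hf_cst.
Qed.

(** Here differentiation keeps the degree, so the polynomial is normalised to constant term 1, as
    [1 + u k]. Its derivative is the positive [u] times a polynomial of lower degree. *)
Lemma hardy_exp a : K a -> ev (fun x => 0 < u x) ->
  derev u (fun x => a x * u x) -> hardy adjoin.
Proof.
move=> Ka u0 d.
have hd : hder.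
  apply: (hder_gen d) => -[|n].
    by apply: (@hpoly_ext _ (fun=> 0)); [apply: evT => x; rewrite !mul0r|exact: hf_cst].
  apply: (@hpoly_ext _ (fun x => (n.+1%:R * a x) * u x ^+ n.+1)).
    by apply: evT => x; rewrite exprS /=; ring.
  apply: (@hpolyX 0%N n.+1 (fun x => n.+1%:R * a x)).
  by apply: (hfM hK) => //; exact: hf_cst.
apply: hardy_adjoin => //.
suff H n : forall f, hpoly n f -> evsign f by move=> n f; exact: H.
elim: n => [|n IH] f; first exact: hf_sign.
move=> /hpoly_low [c [g [Kc hg e]]].
have [c0|c0] : ev (fun x => c x = 0) \/ ev (fun x => c x != 0).
  have [h|[h|h]] := hf_sign hK Kc; [by left|right|right]; apply: ev_imp h => x.
    by move=> /lt0r_neq0.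
  by move=> /ltr0_neq0.
  apply: (@evsign_ext (fun x => u x * g x)).
    by apply: ev_imp2 e c0 => x -> ->; rewrite add0r.
  by apply: evsignM; [right; left|exact: IH].
pose k x := (c x)^-1 * g x.
apply: (@evsign_ext (fun x => c x * (1 + u x * k x))).
  apply: ev_imp2 e c0 => x -> cx; rewrite /k; field; exact: cx.
apply: evsignM; first exact: hf_sign Kc.
have hk : hpoly n k by apply: hpolyZ => //; exact: hfV.
have [k' hk' dk] := hd _ _ hk.
apply: (@evsign_der _ (fun x => 0 + (a x * u x * k x + u x * k' x))).
  by apply: derevD; [exact: derev_cst|exact: derevM].
apply: (@evsign_ext (fun x => u x * (a x * k x + k' x))).
  by apply: evT => x; ring.
apply: evsignM; first by right; left.
by apply: IH; apply: hpolyD => //; exact: hpolyZ.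
Qed.

End Extension.

(** The base field is universally quantified so that, for a product or a sum, the field of [G] can
    be built over the field of [F]. *)
Lemma LE_hardy (E : LE_expr R) : LE_wf E -> forall K, hardy K -> K id ->
  exists K', [/\ hardy K', (forall f, K f -> K' f) & K' (LE_eval E)].
Proof.
elim: E => [c||F IH|F IH|F IHF G IHG|F IHF G IHG] /=.
- by move=> _ K hK Kid; exists K; split => //; exact: hf_cst.
- by move=> _ K hK Kid; exists K.
- move=> /IH{IH}IH K hK Kid; have [K' [hK' KK' K'F]] := IH K hK Kid.
  have [dF KdF d] := hf_der hK' K'F.
  exists (adjoin K' (fun x => expR (LE_eval F x))); split.
  + apply: (hardy_exp hK' KdF); last exact: derev_exp.
    by apply: evT => x; exact: expR_gt0.
  + by move=> f /KK'; exact: adjoin_sub.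
  + exact: adjoin_gen.
- move=> [/IH{IH}IH /evP F0] K hK Kid; have [K' [hK' KK' K'F]] := IH K hK Kid.
  have [dF KdF d] := hf_der hK' K'F.
  exists (adjoin K' (fun x => ln (LE_eval F x))); split.
  + apply: (hardy_log hK' (derev_ln F0 d)).
    by apply: (hfM hK') => //; exact: hfV.
  + by move=> f /KK'; exact: adjoin_sub.
  + exact: adjoin_gen.
- move=> [/IHF{IHF}IHF /IHG{IHG}IHG] K hK Kid.
  have [K1 [hK1 KK1 K1F]] := IHF K hK Kid.
  have [K2 [hK2 KK2 K2G]] := IHG K1 hK1 (KK1 _ Kid).
  exists K2; split => //; first by move=> f /KK1 /KK2.
  by apply: (hfM hK2) => //; exact: KK2.
- move=> [/IHF{IHF}IHF /IHG{IHG}IHG] K hK Kid.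
  have [K1 [hK1 KK1 K1F]] := IHF K hK Kid.
  have [K2 [hK2 KK2 K2G]] := IHG K1 hK1 (KK1 _ Kid).
  exists K2; split => //; first by move=> f /KK1 /KK2.
  by apply: (hfD hK2) => //; exact: KK2.
Qed.

Lemma logarithmico_exponential_hardy (p : R -> R) :
  logarithmico_exponential p -> exists K, [/\ hardy K, K id, K (@ln R) & K p].
Proof.
move=> [E [wf /evP e]].
have h1 := hardy_log hardy_cst derev_id (hf_cst hardy_cst 1).
have [K [hK sub KE]] := LE_hardy wf h1 (adjoin_gen hardy_cst id).
have Kid : K id by apply: sub; exact: (adjoin_gen hardy_cst).
have dl : derev (fun x : R => ln x) (fun x => 1 * x^-1).
  exact: (@derev_ln id (fun=> 1) (ev_gt 0) derev_id).
have Kdl : K (fun x => 1 * x^-1).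
  by apply: (hfM hK); [exact: hf_cst|exact: (hfV hK Kid)].
(* [ln] is adjoined on top of whatever the expression contains, for the later comparison with
   [1 / (x ln(x)^2)]. *)
exists (adjoin K (fun x : R => ln x)); split.
- exact: (hardy_log hK dl).
- exact: adjoin_sub.
- exact: adjoin_gen.
- apply: adjoin_sub => //; apply: (hf_ext hK KE).
  by apply: ev_imp e => x ->.
Qed.

End Hardy.

(** * Behaviour of the phase *)

Section PhaseCases.
Variable R : realType.
Implicit Types (f g : R -> R).

Lemma derevB f g df dg : derev f df -> derev g dg ->
  derev (fun x => f x - g x) (fun x => df x - dg x).
Proof. by apply: ev_imp2 => x; exact: is_deriveB. Qed.

Lemma is_derive_shift f (x h d : R) : is_derive (x + h) 1 f d ->
  is_derive x 1 (fun y => f (y + h)) d.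
Proof.
move=> hf; have hs : is_derive x 1 (fun y : R => y + h) 1.
  have h1 := is_deriveD (is_derive_id x (1 : R)) (is_derive_cst h x (1 : R)).
  by apply: is_derive_eq h1 _; exact: addr0.
by have := @is_derive1_comp _ f (fun y : R => y + h) x _ _ hf hs; rewrite mulr1.
Qed.

Lemma derevZ (c : R) f df : derev f df -> derev (fun x => c * f x) (fun x => c * df x).
Proof.
by move=> d; apply: derev_extr (derevM (derev_cst c) d); apply: evT => x; ring.
Qed.

Lemma derev_nonincr f df : derev f df -> ev (fun x => df x <= 0) ->
  exists A, forall x y, A < x -> x <= y -> f y <= f x.
Proof.
move=> [A hA] [B hB]; exists (Num.max A B) => x y Mx.
rewrite le_eqVlt => /predU1P[->//|xy].
have [c /andP[xc cy] E] := @is_derive_MVT _ f df (Num.max A B)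
      (fun z Mz => hA z (lt_maxl Mz)) x y Mx xy.
rewrite -subr_le0 E mulr_le0_ge0 ?subr_ge0 ?(ltW xy)//.
by apply: hB; exact: lt_maxr (lt_trans Mx xc).
Qed.

Lemma derev_nondecr f df : derev f df -> ev (fun x => 0 <= df x) ->
  exists A, forall x y, A < x -> x <= y -> f x <= f y.
Proof.
move=> d h; have [|A hA] := derev_nonincr (derevZ (-1) d).
  by apply: ev_imp h => x; rewrite mulN1r oppr_le0.
by exists A => x y Ax xy; have := hA x y Ax xy; rewrite !mulN1r lerN2.
Qed.

Lemma hf_dicho K f (c : R) : hardy K -> K f -> ev (fun x => c <= f x) \/ ev (fun x => f x < c).
Proof.
move=> hK Kf; have [h|[h|h]] := hf_sign hK (hfB hK Kf (hf_cst hK c)).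
- by left; apply: ev_imp h => x /eqP; rewrite subr_eq0 => /eqP ->.
- by left; apply: ev_imp h => x; rewrite subr_gt0 => /ltW.
- by right; apply: ev_imp h => x; rewrite subr_lt0.
Qed.

Lemma ev_False (P Q : R -> Prop) : ev P -> ev Q -> (forall x, P x -> Q x -> False) -> False.
Proof. by move=> p q h; have [] := ev_ex (ev_imp2 h p q). Qed.

(** Every real constant is eventually on one side of [f]; a finite limit is the supremum of the
    constants below. *)
Lemma hf_lim K f : hardy K -> K f ->
  [\/ exists L : R, forall eta, 0 < eta -> ev (fun x => `|f x - L| <= eta),
      forall c, ev (fun x => c <= f x) | forall c, ev (fun x => f x <= c)].
Proof.
move=> hK Kf; pose S := [set c : R | ev (fun x => c <= f x)].
have [allS|] := pselect (forall c, S c); first by constructor 2.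
move=> /existsNP[b Sb].
have Sdown c c' : S c -> c' <= c -> S c'.
  by move=> h cc; apply: ev_imp h => x; exact: le_trans.
have Sub c : S c -> c <= b.
  by move=> Sc; rewrite leNgt; apply/negP => /ltW bc; exact/Sb/(Sdown _ _ Sc).
have [[c Sc]|nS] := pselect (exists c, S c); last first.
  constructor 3 => c; have [h|h] := hf_dicho c hK Kf.
    by exfalso; apply: nS; exists c.
  by apply: ev_imp h => x /ltW.
constructor 1; exists (sup S) => eta eta0.
have hS : has_sup S by split; [exists c|exists b => x /Sub].
have [c1 Sc1 hc1] := sup_adherent eta0 hS.
have [h|h] := hf_dicho (sup S + eta) hK Kf.
  have := @ub_le_sup _ S (proj2 hS) (sup S + eta) h.
  by rewrite gerDl leNgt eta0.
apply: ev_imp2 Sc1 h => x h1 h2.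
rewrite ler_distl; apply/andP; split; last exact: ltW.
by apply: ltW; exact: lt_le_trans h1.
Qed.

Definition noninteger_slope (u : nat -> R) := exists2 L : R,
  (forall z : int, L != z%:~R) &
  (forall eta, 0 < eta -> exists N, forall n, (N <= n)%N ->
     `|u n.+1 - u n - L| <= eta).

(** What remains of a phase whose slope tends to an integer once that integer is subtracted. The
    last clause keeps the increments well above [1 / n], the resolution of a sum of length [n]. *)
Definition slow_phase (v : nat -> R) := exists n0, [/\
  forall n, (n0 <= n)%N -> 0 < v n.+1 - v n,
  forall n, (n0 <= n)%N -> v n.+2 - v n.+1 <= v n.+1 - v n,
  forall eta, 0 < eta -> exists N, forall n, (N <= n)%N -> v n.+1 - v n <= eta &
  forall c, exists N, forall n, (N <= n)%N -> c <= n%:R * (v n.+1 - v n)].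

Definition sdiff (v : nat -> R) h n := v (n + h).+1 - v (n + h)%N - (v n.+1 - v n).

(** Tailored to the shifted phases [v (n + h) - v n], whose increments are [sdiff v h n]: the three
    clauses supply the hypotheses of the Kusmin-Landau inequality. *)
Definition curved_phase (eps : R) (v : nat -> R) := exists n0 (C : R), [/\ 0 < C,
  forall n h, (n0 <= n)%N -> (0 < h)%N ->
    h%:R / ((n + h).+1%:R * ln (n + h).+1%:R ^+ 2) <= sdiff v h n,
  forall n h, (n0 <= n)%N -> (0 < h)%N -> sdiff v h n <= C * n%:R `^ (eps - 1) * h%:R &
  forall n h, (n0 <= n)%N -> (0 < h)%N -> sdiff v h n.+1 <= sdiff v h n].

Definition issign (s : R) := s = 1 \/ s = -1.

Lemma issign_norm (s : R) : issign s -> `|s| = 1.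
Proof. by case=> ->; rewrite ?normrN normr1. Qed.

(** * Classification of phases by the limit of the slope *)

Section HardyPhase.
Variables (K : (R -> R) -> Prop) (hK : hardy K) (Kid : K id) (Kln : K (@ln R)).
Variables (p dp ddp d3p : R -> R).
Hypotheses (Kp : K p) (Kdp : K dp) (Kddp : K ddp) (Kd3p : K d3p).
Hypotheses (d1 : derev p dp) (d2 : derev dp ddp) (d3 : derev ddp d3p).
Hypothesis p2 : forall (c A : R), ev (fun x => A * ln x <= `|c * x - p x|).

Lemma nat_ev (P : R -> Prop) : ev P -> exists N : nat, forall x, N%:R <= x -> P x.
Proof.
move=> [A hA]; exists (Num.truncn `|A|).+1 => x hx; apply: hA.
apply: le_lt_trans (ler_norm A) _; apply: lt_le_trans hx.
exact: truncnS_gt.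
Qed.

Lemma ln_gt1_ev : ev (fun x : R => 1 < ln x).
Proof.
exists (expR 1) => x hx; rewrite -[X in X < _](expRK 1) ltr_ln// posrE ?expR_gt0//.
exact: lt_trans (expR_gt0 _) hx.
Qed.

(** If [x |p' - L|] stayed below [c], integration would give [p - L x = O(log x)], against the
    growth hypothesis for the polynomial [L x]. *)
Lemma slope_finite (L s : R) : issign s ->
  ev (fun x => 0 <= s * (dp x - L)) ->
  forall c, ev (fun x => c <= x * (s * (dp x - L))).
Proof.
move=> hs h0 c.
have Kg : K (fun x => x * (s * (dp x - L))).
  apply: (hfM hK Kid); apply: (hfM hK (hf_cst hK s)).
  exact: (hfB hK Kdp (hf_cst hK L)).
have [//|h] := hf_dicho c hK Kg; exfalso.
pose r x := s * (p x - L * x).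
have dr : derev r (fun x => s * (dp x - L)).
  apply: derevZ; apply: derevB => //.
  by apply: derev_extr (derevZ L (@derev_id R)); apply: evT => x; rewrite mulr1.
have [A hA] := derev_nondecr dr h0.
have dl : derev (fun x : R => ln x) (fun x => 1 * x^-1).
  exact: (@derev_ln R id (fun=> 1) (ev_gt 0) (@derev_id R)).
have [B hB] : exists B, forall x y, B < x -> x <= y -> r y - c * ln y <= r x - c * ln x.
  apply: derev_nonincr (derevB dr (derevZ c dl)) _.
  apply: ev_imp2 h (ev_gt 0) => x hx x0.
  by rewrite mul1r subr_le0 -(ler_pM2l x0) [leRHS]mulrCA mulfV ?gt_eqF// mulr1 ltW.
pose M := Num.max A B + 1.
have hM : Num.max A B < M by rewrite ltrDl.
pose D := `|r M| + `|r M - c * ln M|.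
apply: (ev_False (p2 L (`|c| + D + 1))
  (evI (ev_gt M) ln_gt1_ev)) => x + [/ltW Mx lx].
have h1 := hA _ _ (lt_maxl hM) Mx.
have h2 := hB _ _ (lt_maxr hM) Mx.
have -> : `|L * x - p x| = `|r x|.
  by rewrite /r normrM (issign_norm hs) mul1r distrC.
have b1 : - D <= r x.
  apply: le_trans h1; rewrite lerNl /D; apply: le_trans (ler_norm _) _.
  by rewrite normrN lerDl.
have b2 : r x <= c * ln x + D.
  rewrite -lerBlDl; apply: le_trans h2 _; rewrite /D.
  by apply: le_trans (ler_norm _) _; rewrite lerDr.
have D0 : 0 <= D by rewrite addr_ge0.
have cl : c * ln x <= `|c| * ln x.
  by apply: ler_wpM2r; [lra|exact: ler_norm].
have c0 : 0 <= `|c| by [].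
have Dl : D <= D * ln x by rewrite ler_peMr// ltW.
have cl0 : 0 <= `|c| * ln x by rewrite mulr_ge0//; lra.
move=> hh; have : `|r x| <= (`|c| + D) * ln x.
  by rewrite ler_norml mulrDl; apply/andP; split; lra.
lra.
Qed.

Lemma nat_MVT f df (N : nat) : (forall x : R, N%:R <= x -> is_derive x 1 f (df x)) ->
  forall n : nat, (N < n)%N ->
    exists2 c : R, n%:R < c < n.+1%:R & f n.+1%:R - f n%:R = df c.
Proof.
move=> h n Nn.
have [||c hc ->] := @is_derive_MVT _ f df N%:R (fun x hx => h x (ltW hx)) n%:R n.+1%:R.
- by rewrite ltr_nat.
- by rewrite ltr_nat.
- by exists c => //; rewrite -natrB// subSnn mulr1.
Qed.

Lemma phase_finite (L : R) : (forall eta, 0 < eta -> ev (fun x => `|dp x - L| <= eta)) ->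
  noninteger_slope (fun n => p n%:R) \/
  exists (z : int) (s : R), issign s /\ slow_phase (fun n => s * (p n%:R - z%:~R * n%:R)).
Proof.
move=> hL; have [N1 hd1] := nat_ev d1.
have [[z zL]|nz] := pselect (exists z : int, L = z%:~R); last first.
  left; exists L; first by move=> z; apply/eqP => e; apply: nz; exists z.
  move=> eta /hL /nat_ev [N hN]; exists (N + N1).+1 => n hn.
  have [|c /andP[c1 _] ->] := @nat_MVT p dp N1 hd1 n.
    by apply: leq_trans hn; rewrite ltnS leq_addl.
  apply: hN; apply: le_trans (ltW c1); rewrite ler_nat.
  by apply: leq_trans (leqW _) hn; exact: leq_addr.
right; exists z.
have [s hs s0] : exists2 s, issign s & ev (fun x => 0 < s * (dp x - L)).
  have [h|[h|h]] := hf_sign hK (hfB hK Kdp (hf_cst hK L)).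
  - exfalso.
    have h0 : ev (fun x => 0 <= 1 * (dp x - L)) by apply: ev_imp h => x ->; rewrite mulr0.
    apply: (ev_False h (slope_finite (or_introl erefl) h0 1)) => x ->.
    by rewrite !mulr0 ler10.
  - by exists 1; [left|apply: ev_imp h => x; rewrite mul1r].
  - by exists (-1); [right|apply: ev_imp h => x; rewrite mulN1r oppr_gt0].
exists s; split => //.
have big := slope_finite hs (ev_imp (fun x => @ltW _ _ _ _) s0).
have dg : derev (fun x => s * (dp x - L)) (fun x => s * ddp x).
  apply: derevZ; apply: derev_extr (derevB d2 (derev_cst L)).
  by apply: evT => x; rewrite subr0.
(* A positive quantity that tends to 0 cannot be nondecreasing, which excludes a nonnegative
   derivative. *)
have [h|h] := hf_dicho 0 hK (hfM hK (hf_cst hK s) Kddp).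
  exfalso; have [A hA] := derev_nondecr dg h.
  have [B hB] := s0.
  pose M := Num.max A B + 1.
  have hM : Num.max A B < M by rewrite ltrDl.
  have gM := hB _ (lt_maxr hM).
  apply: (ev_False (hL (s * (dp M - L) / 2) _) (ev_gt M)); first by rewrite divr_gt0.
  move=> x h1 /ltW Mx; have := hA _ _ (lt_maxl hM) Mx.
  have := ler_norm (s * (dp x - L)); rewrite normrM (issign_norm hs) mul1r.
  lra.
have [A hA] := derev_nonincr dg (ev_imp (fun x => @ltW _ _ _ _) h).
have [N2 hN2] := nat_ev (evI s0 (ev_gt A)).
pose n0 := (N1 + N2).+1.
have key n : (n0 <= n)%N -> exists2 c : R, n%:R < c < n.+1%:R &
    s * (p n.+1%:R - z%:~R * n.+1%:R) - s * (p n%:R - z%:~R * n%:R) = s * (dp c - L).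
  move=> hn; have [|c hc E] := @nat_MVT p dp N1 hd1 n.
    by apply: leq_trans hn; rewrite ltnS leq_addr.
  exists c => //; rewrite -E zL -natr1; ring.
have big2 n (c : R) : (n0 <= n)%N -> n%:R < c -> N2%:R <= c.
  move=> hn hc; apply: le_trans (ltW hc); rewrite ler_nat; apply: leq_trans hn.
  by rewrite leqW// leq_addl.
exists n0; split.
- move=> n hn; have [c /andP[c1 c2] ->] := key n hn.
  by have [] := hN2 c (big2 _ _ hn c1).
- move=> n hn; have [c /andP[c1 c2] ->] := key n hn.
  have [c' /andP[c1' c2'] ->] := key n.+1 (leqW hn).
  apply: hA; first by have [] := hN2 c (big2 _ _ hn c1).
  by apply: ltW; exact: lt_trans c1'.
- move=> eta /hL /nat_ev [N hN]; exists (N + n0)%N => n hn.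
  have [|c /andP[c1 c2] ->] := key n; first by apply: leq_trans hn; exact: leq_addl.
  apply: le_trans (ler_norm _) _; rewrite normrM (issign_norm hs) mul1r; apply: hN.
  apply: le_trans (ltW c1); rewrite ler_nat; apply: leq_trans hn; exact: leq_addr.
- move=> c; have [N hN] := nat_ev (big (2 * `|c|)); exists (N + n0)%N => n hn.
  have n0n : (n0 <= n)%N by apply: leq_trans hn; exact: leq_addl.
  have [|x /andP[c1 c2] ->] := key n; first by [].
  have := hN x; rewrite (le_trans _ (ltW c1)); last first.
    by rewrite ler_nat; apply: leq_trans hn; exact: leq_addr.
  move=> /(_ isT) h1; have [h2 _] := hN2 x (big2 _ _ n0n c1).
  have n1 : 1 <= n%:R :> R by rewrite ler1n; apply: leq_trans n0n.
  have x2 : x <= 2 * n%:R by move: c2; rewrite -natr1; lra.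
  have := ler_wpM2r (ltW h2) x2; have := ler_norm c; lra.
Qed.

Variables (eps C : R).
Hypothesis heps : eps < 1.
Hypothesis p1 : forall x y z : R, 0 < x -> 0 < y -> 0 < z ->
    `|p (x + y + z) - p (x + y) - p (x + z) + p x|
      <= C * (x `^ (eps - 1) * y * z).

(** Hypothesis (1) at [x = n], [y = h], [z = 1]. *)
Lemma sdiff_bound (s : R) n h : issign s -> (0 < n)%N -> (0 < h)%N ->
  sdiff (fun n => s * p n%:R) h n <= `|C| * n%:R `^ (eps - 1) * h%:R.
Proof.
move=> hs n0 h0; rewrite /sdiff.
have := @p1 n%:R h%:R 1; rewrite !ltr0n n0 h0 ltr01 => /(_ isT isT isT).
rewrite mulr1 -natrD !natr1 => H.
apply: le_trans (ler_norm _) _.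
rewrite (_ : _ - _ = s * (p (n + h).+1%:R - p (n + h)%:R - p n.+1%:R + p n%:R)); last by ring.
rewrite normrM (issign_norm hs) mul1r; apply: le_trans H _.
rewrite -mulrA; apply: ler_wpM2r; last exact: ler_norm.
by rewrite mulr_ge0// powR_ge0.
Qed.

Lemma powR_small (e eta : R) : e < 0 -> 0 < eta -> ev (fun x => x `^ e <= eta).
Proof.
move=> e0 eta0; exists (Num.max 1 (expR (ln eta / e))) => x.
rewrite gt_max => /andP[x1 hx]; have x0 : 0 < x by lra.
rewrite /powR gt_eqF// -[leRHS](lnK) ?posrE// ler_expR.
rewrite (_ : ln eta = e * (ln eta / e)); last by rewrite mulrCA mulfV ?mulr1// lt_eqF.
apply: ler_wnM2l; first exact: ltW.
by rewrite -[leLHS]expRK ler_ln ?posrE ?expR_gt0// ltW.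
Qed.

Lemma phase_infinite (s : R) : issign s -> (forall c, ev (fun x => c <= s * dp x)) ->
  curved_phase eps (fun n => s * p n%:R).
Proof.
move=> hs hinf.
have dsp : derev (fun x => s * p x) (fun x => s * dp x) by exact: derevZ.
have dsp2 : derev (fun x => s * dp x) (fun x => s * ddp x) by exact: derevZ.
have dsp3 : derev (fun x => s * ddp x) (fun x => s * d3p x) by exact: derevZ.
(* [w] is minus the derivative of [1 / ln x], hence integrable at infinity; a slope whose derivative
   stayed below [w] would be bounded above. *)
pose w (x : R) := x^-1 * (ln x)^-1 ^+ 2.
have Kw : K w.
  apply: (hfM hK (hfV hK Kid)); apply: (hfM hK (hfV hK Kln)); exact: (hfV hK Kln).
have lower : ev (fun x => w x <= s * ddp x).
  have [h|h] := hf_dicho 0 hK (hfB hK (hfM hK (hf_cst hK s) Kddp) Kw).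
    by apply: ev_imp h => x; rewrite subr_ge0.
  exfalso.
  have dl : derev (fun x : R => ln x) (fun x => 1 * x^-1).
    exact: (@derev_ln R id (fun=> 1) (ev_gt 0) (@derev_id R)).
  have dil : derev (fun x : R => (ln x)^-1) (fun x => - (1 * x^-1 * (ln x)^-1 ^+ 2)).
    by apply: derevV => //; apply: ev_imp ln_gt1_ev => x hx; rewrite gt_eqF//; lra.
  have [|A hA] := derev_nonincr (derevD dsp2 dil).
    by apply: ev_imp h => x; rewrite /w mul1r => /ltW.
  apply: (ev_False (hinf (s * dp (A + 1) + (ln (A + 1))^-1 + 1))
    (evI (ev_gt (A + 1)) ln_gt1_ev)) => x h1 [h2 h3].
  have := hA (A + 1) x; rewrite ltrDl ltr01 (ltW h2) => /(_ isT isT).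
  have : 0 <= (ln x)^-1 by rewrite invr_ge0; lra.
  lra.
have [A3 hA3] := lower.
have [N1 hd1] := nat_ev d1.
have [N2 hd2] := nat_ev dsp2.
have [N3 hd3] := nat_ev (evI lower ln_gt1_ev).
have [N1' hd1'] := nat_ev dsp.
have [N4 hd4] := nat_ev dsp3.
(* [sdiff] as a second-order mean value *)
have key h n : (0 < h)%N -> (N1' + N2 < n)%N -> exists2 c : R, n%:R < c < n.+1%:R &
    sdiff (fun n => s * p n%:R) h n = s * dp (c + h%:R) - s * dp c.
  move=> h0 hn.
  have [||c hc E] := @nat_MVT (fun x => s * p (x + h%:R) - s * p x)
      (fun x => s * dp (x + h%:R) - s * dp x) N1' _ n.
  - move=> x hx; apply: is_deriveB; last exact: hd1'.
    by apply: (@is_derive_shift (fun x => s * p x)); apply: hd1'; apply: le_trans hx _; rewrite lerDl.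
  - by apply: leq_ltn_trans hn; exact: leq_addr.
  - exists c => //; rewrite -E /sdiff.
    by rewrite -!natrD addSn; ring.
have key2 h (c : R) : (0 < h)%N -> N2%:R < c -> exists2 c' : R, c < c' < c + h%:R &
    s * dp (c + h%:R) - s * dp c = h%:R * (s * ddp c').
  move=> h0 hc; have [||c' hc' ->] := @is_derive_MVT _ (fun x => s * dp x)
     (fun x => s * ddp x) N2%:R (fun x hx => hd2 x (ltW hx)) c (c + h%:R).
  - by [].
  - by rewrite ltrDl ltr0n.
  - by exists c' => //; ring.
(* Were the third derivative nonnegative, the second would stay above a positive constant, whereas
   by (1) the differences of increments at lag 1 decay like [n^(eps - 1)]. *)
have dec : ev (fun x => s * d3p x <= 0).
  have [h|h] := hf_dicho 0 hK (hfM hK (hf_cst hK s) Kd3p); last first.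
    by apply: ev_imp h => x /ltW.
  exfalso; have [A hA] := derev_nondecr dsp3 h.
  pose M := Num.max A N3%:R + 1.
  have hM : Num.max A N3%:R < M by rewrite ltrDl.
  have [wM lM] := hd3 _ (ltW (lt_maxr hM)).
  have M0 : 0 < M by apply: le_lt_trans (lt_maxr hM).
  have sM : 0 < s * ddp M.
    apply: lt_le_trans wM; rewrite mulr_gt0 ?invr_gt0// exprn_gt0// invr_gt0; lra.
  have C1 : 0 < `|C| + 1 by rewrite ltr_wpDl.
  have e1 : eps - 1 < 0 by rewrite subr_lt0.
  have q0 : 0 < s * ddp M / (`|C| + 1) / 2 by rewrite !divr_gt0.
  have [N5 hN5] := nat_ev (evI (powR_small e1 q0) (ev_gt M)).
  pose n := (N5 + N1' + N2).+1.
  have nN5 : N5%:R <= n%:R :> R by rewrite ler_nat /n -addnA leqW// leq_addr.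
  have [|c /andP[c1 c2] E] := @key 1%N n isT; first by rewrite /n -addnA ltnS leq_addl.
  have cN2 : N2%:R < c by apply: le_lt_trans c1; rewrite ler_nat /n leqW// leq_addl.
  have [c' /andP[c1' c2'] E'] := @key2 1%N c isT cN2.
  have := @sdiff_bound s n 1%N hs isT isT; rewrite E E' mulr1 mul1r.
  have [h1 h2] := hN5 _ nN5.
  have := hA M c' (lt_maxl hM) (ltW (lt_trans (lt_trans h2 c1) c1')).
  have : `|C| * n%:R `^ (eps - 1) <= (`|C| + 1) * (s * ddp M / (`|C| + 1) / 2).
    by apply: ler_pM => //; rewrite ?powR_ge0 ?lerDl.
  rewrite (_ : (`|C| + 1) * _ = s * ddp M / 2); first lra.
  by field; rewrite gt_eqF.
have [A hA] := derev_nonincr dsp3 dec.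
have [N5 hN5] := nat_ev (ev_gt A).
exists (N1' + N2 + N3 + N4 + N5).+1, (`|C| + 1); split.
- by rewrite ltr_wpDl.
- move=> n h hn h0.
  have [|c /andP[c1 c2] ->] := @key h n h0.
    by apply: leq_trans hn; rewrite ltnS -!addnA leq_add2l leq_addr.
  have nn (m : nat) : (m <= N1' + N2 + N3 + N4 + N5)%N -> m%:R < c.
    by move=> hm; apply: lt_trans c1; rewrite ltr_nat; exact: leq_ltn_trans hn.
  have [|c' /andP[c1' c2'] ->] := @key2 h c h0.
    by apply: nn; lia.
  have [|w' l'] := hd3 c'.
    by apply: ltW; apply: lt_trans c1'; apply: nn; lia.
  apply: ler_wpM2l => //; apply: le_trans w'.
  have c'0 : 0 < c' by apply: lt_trans c1'; exact: (nn 0%N).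
  have l'0 : 0 < ln c' by lra.
  have c'n : c' <= (n + h).+1%:R.
    by apply: ltW; apply: lt_trans c2' _; rewrite -addSn natrD ltrD2r.
  have N0 : 0 < (n + h).+1%:R :> R by rewrite ltr0n.
  have ll : ln c' <= ln (n + h).+1%:R by rewrite ler_ln ?posrE.
  have L0 : 0 < ln (n + h).+1%:R :> R by lra.
  rewrite /w exprVn -invfM lef_pV2 ?posrE ?mulr_gt0 ?exprn_gt0//.
  apply: ler_pM; rewrite ?(ltW c'0) ?exprn_ge0 ?(ltW l'0)//.
  by rewrite lerXn2r ?nnegrE ?(ltW l'0) ?(ltW L0).
- move=> n h hn h0; apply: le_trans (sdiff_bound hs _ h0) _; first exact: leq_trans hn.
  by apply: ler_wpM2r => //; apply: ler_wpM2r; [exact: powR_ge0|rewrite lerDl].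
- move=> n h hn h0.
  have hn' : (N1' + N2 < n)%N by apply: leq_trans hn; rewrite ltnS -!addnA leq_add2l leq_addr.
  have [c /andP[c1 c2] ->] := @key h n h0 hn'.
  have [c' /andP[c1' c2'] ->] := @key h n.+1 h0 (leqW hn').
  have nn (m : nat) : (m <= N1' + N2 + N3 + N4 + N5)%N -> m%:R < c.
    by move=> hm; apply: lt_trans c1; rewrite ltr_nat; exact: leq_ltn_trans hn.
  have cc' : c < c' by exact: lt_trans c1'.
  have [||d /andP[cd dc'] E] := @is_derive_MVT _ (fun x => s * dp (x + h%:R) - s * dp x)
    (fun x => s * ddp (x + h%:R) - s * ddp x) N2%:R _ c c' _ cc'.
  - move=> x hx; apply: is_deriveB; last exact/hd2/ltW.
    by apply: (@is_derive_shift (fun x => s * dp x)); apply: hd2; rewrite (le_trans (ltW hx))// lerDl.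
  - by apply: nn; lia.
  - rewrite -subr_le0 E mulr_le0_ge0 ?subr_ge0 ?(ltW cc')// subr_le0.
    apply: hA; last by rewrite lerDl.
    by apply: hN5; apply: ltW; apply: lt_trans cd; apply: nn; lia.
Qed.

End HardyPhase.

Lemma phase_cases (eps : R) (p : R -> R) : eps < 1 -> logarithmico_exponential p ->
  (exists C : R, forall x y z : R, 0 < x -> 0 < y -> 0 < z ->
    `|p (x + y + z) - p (x + y) - p (x + z) + p x| <= C * (x `^ (eps - 1) * y * z)) ->
  (forall (c : R) (q : {poly rat}),
    `|(c *: map_poly ratr q).[x] - p x| / ln x @[x --> +oo] --> +oo) ->
  [\/ noninteger_slope (fun n => p n%:R),
      exists (z : int) (s : R), issign s /\ slow_phase (fun n => s * (p n%:R - z%:~R * n%:R)) |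
      exists s : R, issign s /\ curved_phase eps (fun n => s * p n%:R)].
Proof.
move=> e1 /logarithmico_exponential_hardy[K [hK Kid Kln Kp]] [C p1] p2.
have [dp Kdp d1] := hf_der hK Kp.
have [ddp Kddp d2] := hf_der hK Kdp.
have [d3p Kd3p d3] := hf_der hK Kddp.
(* Hypothesis (2) for the real multiples of the polynomial [X]. *)
have p2' (c A : R) : ev (fun x => A * ln x <= `|c * x - p x|).
  have /cvgryPge/(_ A)/evP hA := p2 c 'X.
  apply: ev_imp2 hA ln_gt1_ev => x.
  rewrite map_polyX hornerZ hornerX => h l1.
  by rewrite -ler_pdivlMr//; lra.
have [[L hL]|h|h] := hf_lim hK Kdp.
- have [h|h] := phase_finite hK Kid Kdp Kddp d1 d2 p2' hL; first by constructor 1.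
  by constructor 2.
- constructor 3; exists 1; split; first by left.
  apply: (phase_infinite hK Kid Kln Kddp Kd3p d1 d2 d3 e1 p1); first by left.
  by move=> c; apply: ev_imp (h c) => x; rewrite mul1r.
- constructor 3; exists (-1); split; first by right.
  apply: (phase_infinite hK Kid Kln Kddp Kd3p d1 d2 d3 e1 p1); first by right.
  by move=> c; apply: ev_imp (h (- c)) => x; rewrite mulN1r lerNr.
Qed.

End PhaseCases.

(** * Exponential sums *)

Section ExponentialSums.
Variable R : realType.
Implicit Types (u v : nat -> R).

Definition mean0 (a : nat -> R) := forall eta : R, 0 < eta ->
  exists N0, forall N, (N0 <= N)%N -> `|\sum_(0 <= n < N) a n| <= eta * N%:R.

Lemma normr_sum_le (a : nat -> R) (c : R) A B : (forall n, (A <= n < B)%N -> `|a n| <= c) ->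
  `|\sum_(A <= n < B) a n| <= c * (B - A)%:R.
Proof.
move=> h; apply: le_trans (ler_norm_sum _ _ _) _.
apply: (@le_trans _ _ (\sum_(A <= n < B) c)); first by apply: ler_sum_nat => n /h.
by rewrite sumr_const_nat mulr_natr.
Qed.

Lemma mean0_tail (M : R) (a : nat -> R) A : (forall n, `|a n| <= M) ->
  (forall eta : R, 0 < eta -> exists N0, forall N, (N0 <= N)%N ->
     `|\sum_(A <= n < N) a n| <= eta * N%:R) -> mean0 a.
Proof.
move=> a1 h eta eta0; have [|N1 hN1] := h (eta / 2); first by rewrite divr_gt0.
have [N2 hN2] := nat_ev (ev_gt ((M * A%:R) / (eta / 2))).
exists (N1 + N2 + A)%N => N hN.
rewrite (big_cat_nat (n := A))//=; last by lia.
apply: le_trans (ler_normD _ _) _.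
rewrite [eta](splitr) mulrDl; apply: lerD; last by apply: hN1; lia.
apply: le_trans (normr_sum_le (c := M) _) _; first by move=> n _; exact: a1.
rewrite subn0 -ler_pdivrMl ?divr_gt0// mulrC; apply: ltW; apply: hN2.
by rewrite ler_nat; lia.
Qed.

Lemma mean0_cvg0 (M : R) (a : nat -> R) : (forall n, `|a n| <= M) ->
  (forall eta : R, 0 < eta -> exists N0, forall n, (N0 <= n)%N -> `|a n| <= eta) -> mean0 a.
Proof.
move=> a1 h eta eta0; have [N1 hN1] := h (eta / 2) ltac:(by rewrite divr_gt0).
have [N2 hN2] := nat_ev (ev_gt (M * N1%:R / (eta / 2))).
exists (N1 + N2)%N => N hN.
rewrite (big_cat_nat (n := N1))//=; last by lia.
apply: le_trans (ler_normD _ _) _; rewrite [eta]splitr mulrDl; apply: lerD.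
  apply: le_trans (normr_sum_le (c := M) _) _; first by move=> n _; exact: a1.
  rewrite subn0 -ler_pdivrMl ?divr_gt0// mulrC; apply: ltW; apply: hN2.
  by rewrite ler_nat; lia.
apply: le_trans (normr_sum_le (c := eta / 2) _) _; first by move=> n /andP[/hN1].
by apply: ler_wpM2l; [rewrite divr_ge0// ltW|rewrite ler_nat leq_subr].
Qed.

(** A form without denominators of [cos x + cos y = cot((y - x)/2) (sin y - sin x)], which turns
    cosine sums into weighted telescoping ones. *)
Lemma cos_sum_to_product (x y : R) :
  (cos x + cos y) * sin ((y - x) / 2) = cos ((y - x) / 2) * (sin y - sin x).
Proof.
pose m := (x + y) / 2; pose d := (y - x) / 2.
have -> : (y - x) / 2 = d by [].
have Ex : x = m - d by rewrite /m /d; field.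
have Ey : y = m + d by rewrite /m /d; field.
clearbody m d; rewrite Ex Ey; rewrite cosB sinB cosD sinD; ring.
Qed.

Lemma cos_ge_half_near0 : exists2 eta : R, 0 < eta <= 1 &
  forall x, 0 <= x <= eta -> 1 / 2 <= cos x.
Proof.
have /cvgrPdist_lt/(_ (1/2)) := @continuous_cos R 0.
rewrite divr_gt0// => /(_ isT) [e /= e0 he].
exists (Num.min 1 (e / 2)).
  by rewrite lt_min ltr01 divr_gt0//= ge_min lexx.
move=> x /andP[x0]; rewrite le_min => /andP[_ xe].
have : `|cos 0 - cos x| < 1 / 2.
  apply: he; rewrite /ball_ /= sub0r normrN ger0_norm//; lra.
rewrite cos0 ltr_distl; lra.
Qed.

Lemma sin_ge_half (x : R) : (forall y, 0 <= y <= x -> 1 / 2 <= cos y) -> 0 < x ->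
  x / 2 <= sin x.
Proof.
move=> h x0; have [|c] := @MVT R sin cos 0 x x0 (fun z _ => is_derive_sin z).
- by apply: derivable_within_continuous => z _; exact: derivable_sin.
- rewrite in_itv /= => /andP[c0 cx]; rewrite sin0 !subr0 => ->.
  have hc : 1 / 2 <= cos c by apply: h; rewrite (ltW c0) (ltW cx).
  nra.
Qed.

Lemma abel_monotone (t S : nat -> R) A B : (A < B)%N ->
  0 <= t A -> (forall n, (A <= n)%N -> (n.+1 < B)%N -> t n <= t n.+1) ->
  (forall n, `|S n| <= 1) ->
  `|\sum_(A <= n < B) t n * (S n.+1 - S n)| <= 2 * t B.-1.
Proof.
move=> AB tA tm S1.
(* The induction needs a sharper claim: with the boundary term subtracted, the error is at most the
   current weight, since the increments of [t] add up to it. *)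
suff H k : (A + k < B)%N ->
    0 <= t (A + k)%N /\
    `|\sum_(A <= n < (A + k).+1) t n * (S n.+1 - S n) - t (A + k)%N * S (A + k).+1|
       <= t (A + k)%N.
  have [|] := H (B.-1 - A)%N; first by lia.
  have -> : (A + (B.-1 - A) = B.-1)%N by lia.
  have -> : B.-1.+1 = B by lia.
  set s := \sum_(_ <= _ < _) _; move=> t0 h.
  have -> : s = (s - t B.-1 * S B) + t B.-1 * S B by ring.
  apply: le_trans (ler_normD _ _) _; rewrite mulr2n mulrDl mul1r.
  by apply: lerD => //; rewrite normrM ger0_norm// ler_piMr.
elim: k => [|k IH] hk.
  rewrite addn0 big_nat1; split => //.
  rewrite (_ : _ - _ = - (t A * S A)); last by ring.
  by rewrite normrN normrM (ger0_norm tA) ler_piMr.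
have [|t0 h] := IH; first by lia.
have tt : t (A + k)%N <= t (A + k.+1)%N by rewrite addnS; apply: tm; lia.
split; first exact: le_trans tt.
rewrite addnS big_nat_recr /=; last by lia.
move: tt h; rewrite addnS; set s := \sum_(_ <= _ < _) _; move=> tt h.
rewrite (_ : _ - _ = (s - t (A + k)%N * S (A + k).+1) +
   (t (A + k)%N - t (A + k).+1) * S (A + k).+1); last by ring.
apply: le_trans (ler_normD _ _) _.
rewrite -[leRHS](subrKC (t (A + k)%N)); apply: lerD => //.
by rewrite normrM distrC [X in X * _]ger0_norm ?subr_ge0// ler_piMr ?subr_ge0.
Qed.

(* The Kusmin-Landau inequality, in the form needed for small slopes: by the
   sum-to-product formula [cos_n + cos_(n+1) = cot (pi d_n) * (sin_(n+1) - sin_n)],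
   and [cot] is monotone, so Abel summation applies. *)
Lemma kusmin_landau : exists2 eta : R, 0 < eta & forall u A B (d : R), 0 < d ->
  (forall n, (A <= n < B)%N -> d <= u n.+1 - u n <= eta) ->
  (forall n, (A <= n)%N -> (n.+1 < B)%N -> u n.+2 - u n.+1 <= u n.+1 - u n) ->
  `|\sum_(A <= n < B) cos (2 * pi * u n)| <= d^-1 + 1.
Proof.
have [e /andP[e0 e1] he] := cos_ge_half_near0.
have pi0 : 0 < pi :> R := pi_gt0 R.
exists (e / pi) => [|u A B d d0 hd hm]; first by rewrite divr_gt0.
have [BA|AB] := leqP B A.
  by rewrite big_geq// normr0 addr_ge0// invr_ge0 ltW.
pose D n := pi * (u n.+1 - u n).
have hD n : (A <= n < B)%N -> 0 < D n <= e.
  move=> /hd /andP[h1 h2]; rewrite mulr_gt0//=; last exact: lt_le_trans h1.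
  by rewrite /D mulrC -ler_pdivlMr.
have sD n : (A <= n < B)%N -> D n / 2 <= sin (D n).
  move=> /hD /andP[h1 h2]; apply: sin_ge_half => // y /andP[y0 y1]; apply: he.
  by rewrite y0 (le_trans y1).
have cD n : (A <= n < B)%N -> 1 / 2 <= cos (D n).
  by move=> /hD /andP[h1 h2]; apply: he; rewrite ltW.
have s0 n : (A <= n < B)%N -> 0 < sin (D n).
  by move=> h; apply: lt_le_trans (sD _ h); have /andP[] := hD n h; lra.
pose t n := cos (D n) / sin (D n).
have tm n : (A <= n)%N -> (n.+1 < B)%N -> t n <= t n.+1.
  move=> An nB; have h1 : (A <= n < B)%N by lia.
  have h2 : (A <= n.+1 < B)%N by lia.
  have /andP[a1 a2] := hD _ h1; have /andP[b1 b2] := hD _ h2.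
  have DD : D n.+1 <= D n by apply: ler_wpM2l; [exact: ltW|exact: hm].
  have p2 := pihalf_ge1 R.
  apply: ler_pM.
  - by apply: le_trans (cD _ h1).
  - by rewrite invr_ge0 ltW// s0.
  - by rewrite leNgt ltr_cos ?in_itv /=; lra.
  - rewrite lef_pV2 ?posrE ?s0//.
    by rewrite leNgt ltr_sin ?in_itv /=; lra.
have E n : (A <= n < B)%N -> cos (2 * pi * u n) + cos (2 * pi * u n.+1) =
    t n * (sin (2 * pi * u n.+1) - sin (2 * pi * u n)).
  move=> h; have := cos_sum_to_product (2 * pi * u n) (2 * pi * u n.+1).
  rewrite (_ : (_ - _) / 2 = D n); last by rewrite /D; field.
  have nz : sin (D n) != 0 by rewrite gt_eqF// s0.
  move=> H; apply: (mulIf nz); rewrite H /t; field; exact: nz.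
have AA : (A <= A < B)%N by lia.
have tA : 0 <= t A.
  by rewrite divr_ge0 ?(ltW (s0 _ AA))//; apply: le_trans (cD _ AA).
have := @abel_monotone t (fun n => sin (2 * pi * u n)) A B AB tA tm (fun n => sin_max _).
rewrite -(eq_big_nat _ _ E) big_split /=.
set s := \sum_(A <= n < B) _.
have -> : \sum_(A <= n < B) cos (2 * pi * u n.+1) =
    s + cos (2 * pi * u B) - cos (2 * pi * u A).
  apply/eqP; rewrite -subr_eq0 opprB addrA; apply/eqP.
  have := @telescope_sumr _ A B (fun n => cos (2 * pi * u n)) (ltnW AB).
  rewrite sumrB -/s => H.
  set s' := \sum_(_ <= _ < _) _ in H *; lra.
(* The last weight is the largest: [cot D <= 1 / sin D <= 2 / D], and [D >= pi d >= 2 d]. *)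
have tB : t B.-1 <= d^-1.
  have hB : (A <= B.-1 < B)%N by lia.
  apply: (@le_trans _ _ (sin (D B.-1))^-1).
    by rewrite ler_piMl ?cos_le1// invr_ge0 ltW// s0.
  rewrite lef_pV2 ?posrE ?s0//; apply: le_trans (sD _ hB).
  have /andP[h _] := hd _ hB; have p2 := pi_ge2 R.
  by rewrite /D; nra.
have := cos_max (2 * pi * u B); have := cos_max (2 * pi * u A).
by rewrite !ler_norml => /andP[a1 a2] /andP[b1 b2] /andP[c1 c2]; apply/andP; split; lra.
Qed.

End ExponentialSums.

(** * Phases with a finite limiting slope *)

Section WeylMeans.
Variable R : realType.
Implicit Types (u v : nat -> R).

(** Subtracting the integer part moves the argument into (0, pi) and changes the sine at most in
    sign. *)
Lemma sin_pi_noninteger (L : R) : (forall z : int, L != z%:~R) -> sin (pi * L) != 0.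
Proof.
move=> hL; pose z := Num.floor L.
have zL : z%:~R < L by rewrite lt_neqAle floor_le_tmp andbT eq_sym; exact: hL.
have Lz : L < (z + 1)%:~R by exact: floorD1_gt.
have s0 : 0 < sin (pi * (L - z%:~R)).
  apply: sin_gt0_pi; move: Lz; rewrite intrD => Lz.
  have p0 := pi_gt0 R; apply/andP; split; nra.
have sin_nat k x : `|sin (x + pi *+ k)| = `|sin x| :> R.
  elim: k x => [|k IH] x; first by rewrite mulr0n addr0.
  by rewrite mulrSr addrA sinDpi normrN IH.
have E : `|sin (pi * L)| = `|sin (pi * (L - z%:~R))|.
  case: (intP z) => [|k|k].
  - by rewrite subr0.
  - rewrite -(sin_nat k.+1 (pi * (L - _))); congr (`|sin _|).
    by rewrite mulrBr -mulr_natr -pmulrn; ring.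
  - rewrite -(sin_nat k.+1 (pi * L)); congr (`|sin _|).
    by rewrite mulrBr mulrNz -mulr_natr -pmulrn; ring.
by rewrite -normr_gt0 E normr_gt0 gt_eqF.
Qed.

(** When the increments are close to [L], the sum-to-product formula makes
    [sin(pi L) (C n + C n.+1)] nearly equal to [cos(pi L)] times a telescoping difference, and
    [sin(pi L)] is not 0. *)
Lemma mean0_noninteger u : noninteger_slope u -> mean0 (fun n => cos (2 * pi * u n)).
Proof.
move=> [L hL hu]; have sL := sin_pi_noninteger hL.
pose C n := cos (2 * pi * u n); pose S n := sin (2 * pi * u n).
pose err n := sin (pi * L) * (C n + C n.+1) - cos (pi * L) * (S n.+1 - S n).
have bC n : `|C n| <= 1 by exact: cos_max.
have bS n : `|S n| <= 1 by exact: sin_max.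
have bCC n : `|C n + C n.+1| <= 2.
  by apply: le_trans (ler_normD _ _) _; rewrite -[leRHS]/(1 + 1 : R) lerD.
have bSS n : `|S n.+1 - S n| <= 2.
  by apply: le_trans (ler_normB _ _) _; rewrite -[leRHS]/(1 + 1 : R) lerD.
have m_err : mean0 err.
  apply: (@mean0_cvg0 R 4) => [n|eta eta0].
    apply: le_trans (ler_normB _ _) _; rewrite !normrM.
    have h1 := sin_max (pi * L); have h2 := cos_max (pi * L).
    by rewrite (_ : 4 = 1 * 2 + 1 * 2 :> R); [apply: lerD; apply: ler_pM|ring].
  have e4 : 0 < eta / 4 by rewrite divr_gt0.
  have /cvgrPdist_le/(_ _ e4) [r1 /= r10 h1] := @continuous_cos R (pi * L).
  have /cvgrPdist_le/(_ _ e4) [r2 /= r20 h2] := @continuous_sin R (pi * L).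
  have p0 := pi_gt0 R.
  have q0 : 0 < Num.min r1 r2 / pi / 2 by rewrite !divr_gt0// lt_min r10 r20.
  have [N hN] := hu _ q0; exists N => n /hN hn.
  have hd : `|pi * L - pi * (u n.+1 - u n)| < Num.min r1 r2.
    rewrite -mulrBr normrM gtr0_norm// mulrC -ltr_pdivlMr// distrC.
    apply: le_lt_trans hn _; rewrite ltr_pdivrMr// ltr_pMr ?ltr1n//.
    by rewrite divr_gt0// lt_min r10 r20.
  move: (hd); rewrite lt_min => /andP[d1 d2].
  have := cos_sum_to_product (2 * pi * u n) (2 * pi * u n.+1).
  rewrite (_ : (_ - _) / 2 = pi * (u n.+1 - u n)); last by field.
  rewrite -/(C n) -/(C n.+1) -/(S n) -/(S n.+1) => E.
  have -> : err n = (sin (pi * L) - sin (pi * (u n.+1 - u n))) * (C n + C n.+1) -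
      (cos (pi * L) - cos (pi * (u n.+1 - u n))) * (S n.+1 - S n).
    rewrite /err; move: E; set x := sin (pi * (u n.+1 - u n)).
    set y := cos (pi * (u n.+1 - u n)) => E.
    by rewrite !mulrBl [x * _]mulrC E; ring.
  apply: le_trans (ler_normB _ _) _; rewrite !normrM.
  rewrite (_ : eta = eta / 4 * 2 + eta / 4 * 2); last by field.
  apply: lerD; apply: ler_pM => //; [exact: h2|exact: h1].
move=> eta eta0; pose s := `|sin (pi * L)|.
have s0 : 0 < s by rewrite normr_gt0.
have [N1 hN1] := m_err (eta * s) ltac:(by rewrite mulr_gt0).
have [N2 hN2] := nat_ev (ev_gt (4 / (eta * s))).
exists (N1 + N2)%N => N hN.
have tS : \sum_(0 <= n < N) (S n.+1 - S n) = S N - S 0%N by rewrite telescope_sumr.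
have tC : \sum_(0 <= n < N) (C n.+1 - C n) = C N - C 0%N by rewrite telescope_sumr.
have E : sin (pi * L) * (\sum_(0 <= n < N) C n) * 2 = \sum_(0 <= n < N) err n +
    (cos (pi * L) * (S N - S 0%N) - sin (pi * L) * (C N - C 0%N)).
  rewrite -tS -tC /err sumrB -!mulr_sumr !sumrB big_split /=.
  by ring.
have h1 := hN1 N ltac:(lia).
have h2 : 4 <= eta * s * N%:R.
  rewrite -ler_pdivrMl ?mulr_gt0// mulrC; apply/ltW/hN2; rewrite ler_nat; lia.
have h3 : `|cos (pi * L) * (S N - S 0%N) - sin (pi * L) * (C N - C 0%N)| <= 4.
  apply: le_trans (ler_normB _ _) _; rewrite !normrM.
  have k1 := sin_max (pi * L); have k2 := cos_max (pi * L).
  have k3 : `|S N - S 0%N| <= 2.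
    by apply: le_trans (ler_normB _ _) _; rewrite -[leRHS]/(1 + 1 : R) lerD.
  have k4 : `|C N - C 0%N| <= 2.
    by apply: le_trans (ler_normB _ _) _; rewrite -[leRHS]/(1 + 1 : R) lerD.
  by rewrite (_ : 4 = 1 * 2 + 1 * 2 :> R); [apply: lerD; apply: ler_pM|ring].
have : s * `|\sum_(0 <= n < N) C n| * 2 <= eta * s * N%:R + eta * s * N%:R.
  rewrite -[in X in _ * X](@gtr0_norm _ (2 : R))// -!normrM E.
  by apply: le_trans (ler_normD _ _) _; apply: lerD => //; exact: le_trans h3 h2.
by move=> hh; rewrite -(ler_pM2l s0); lra.
Qed.

(** The Kusmin-Landau bound is the inverse of the last and smallest increment, which is [o(N)]
    because [N] times that increment tends to infinity. *)
Lemma mean0_slow v : slow_phase v -> mean0 (fun n => cos (2 * pi * v n)).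
Proof.
move=> [n0 [h1 h2 h3 h4]]; have [eta0 eta0_gt0 KL] := kusmin_landau R.
have [N1 hN1] := h3 _ eta0_gt0.
apply: (@mean0_tail R 1 _ (n0 + N1)) => [n|eta eta_gt0]; first exact: cos_max.
have [N2 hN2] := h4 (2 / eta).
have [N3 hN3] := nat_ev (ev_gt (2 / eta)).
exists (n0 + N1 + N2 + N3).+1 => -[//|N] hN.
have hd := hN2 N ltac:(lia); have dN := h1 N ltac:(lia).
have mono k : (n0 + N1 + k <= N)%N -> v N.+1 - v N <= v (N - k).+1 - v (N - k)%N.
  elim: k => [|k IH] hk; first by rewrite subn0.
  apply: le_trans (IH _) _; first lia.
  by rewrite (_ : (N - k)%N = (N - k.+1).+1); [apply: h2; lia|lia].
apply: le_trans (KL v (n0 + N1)%N N.+1 (v N.+1 - v N) dN _ _) _.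
- move=> n /andP[n1 n2]; apply/andP; split; last by apply: hN1; lia.
  by rewrite [in leRHS](_ : n = (N - (N - n))%N); [apply: mono; lia|lia].
- by move=> n n1 n2; apply: h2; lia.
- have a1 : (v N.+1 - v N)^-1 <= eta / 2 * N%:R.
    rewrite -[leLHS]mul1r ler_pdivrMr// -[leRHS]mulrA -ler_pdivrMl ?divr_gt0//.
    by rewrite mulr1 invf_div; apply: le_trans hd _.
  have a2 : 1 <= eta / 2 * N.+1%:R.
    rewrite -ler_pdivrMl ?divr_gt0// mulr1 invf_div; apply/ltW/hN3.
    by rewrite ler_nat; lia.
  have a3 : eta / 2 * N%:R <= eta / 2 * N.+1%:R.
    by apply: ler_wpM2l; [rewrite divr_ge0// ltW|rewrite ler_nat].
  lra.
Qed.

End WeylMeans.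

(** * Phases with an infinite limiting slope *)

Section VanDerCorput.
Variable R : realType.
Implicit Types (u v : nat -> R).

Lemma sqr_sum_le (x : nat -> R) A B :
  (\sum_(A <= n < B) x n) ^+ 2 <= (B - A)%:R * \sum_(A <= n < B) x n ^+ 2.
Proof.
have [BA|AB] := leqP B A.
  by rewrite !big_geq// expr0n mulr0.
rewrite -(subnKC (ltnW AB)) addKn; elim: (B - A)%N => [|m IH].
  by rewrite addn0 !big_geq// expr0n mulr0.
case: m IH => [|m] IH; first by rewrite addn1 !big_nat1 mul1r.
rewrite addnS !big_nat_recr ?leq_addr//=.
move: IH; set s := \sum_(_ <= _ < _) _; set q := \sum_(_ <= _ < _) _; set y := x _.
move=> IH.
have m0 : 0 < m.+1%:R :> R by rewrite ltr0n.
have : 0 <= (s - m.+1%:R * y) ^+ 2 by exact: sqr_ge0.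
move=> h; rewrite -(ler_pM2l m0) -[m.+2%:R]natr1; nra.
Qed.

Lemma sum_shift_le (a : nat -> R) A B h : (A <= B)%N -> (forall n, `|a n| <= 1) ->
  `|\sum_(A <= n < B) a n - \sum_(A <= n < B) a (n + h)%N| <= 2 * h%:R.
Proof.
move=> AB a1; elim: h => [|h IH].
  rewrite [X in _ - X](eq_bigr a); first by rewrite subrr normr0 mulr0.
  by move=> n _; rewrite addn0.
set s := \sum_(A <= n < B) a n in IH *; set t := \sum_(_ <= _ < _) _ in IH *.
set t' := \sum_(_ <= _ < _) _.
have E : t' - t = a (B + h)%N - a (A + h)%N.
  rewrite -(telescope_sumr (fun n => a (n + h)%N) AB) sumrB.
  by congr (_ - _); apply: eq_bigr => n _; rewrite addnS.
have -> : s - t' = (s - t) - (t' - t) by ring.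
apply: le_trans (ler_normB _ _) _; rewrite -[h.+1%:R]natr1 mulrDr mulr1 lerD//.
by rewrite E; apply: le_trans (ler_normB _ _) _; rewrite -[leRHS]/(1 + 1 : R) lerD.
Qed.

(* Van der Corput's inequality with the [J] shifts [0, K, ..., (J-1) K]: since
   distinct shifts are [K] apart, it suffices to bound correlations at lags at
   least [K]. *)
Lemma van_der_corput v A B J K (Y : R) : (A <= B)%N -> (0 < J)%N -> 0 <= Y ->
  (forall i j, (j < i < J)%N ->
    `|\sum_(A <= n < B) cos (2 * pi * (v (n + i * K)%N - v (n + j * K)%N))| <= Y) ->
  exists2 D : R, D ^+ 2 <= (B - A)%:R * (J%:R * (B - A)%:R + J%:R ^+ 2 * Y) &
    J%:R * `|\sum_(A <= n < B) cos (2 * pi * v n)| <= 2 * (J%:R ^+ 2 * K%:R) + `|D|.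
Proof.
move=> AB J0 Y0 hY.
pose C n := cos (2 * pi * v n); pose S n := sin (2 * pi * v n).
pose D := \sum_(A <= n < B) \sum_(0 <= j < J) C (n + j * K)%N.
exists D.
  apply: le_trans (sqr_sum_le _ _ _) _; apply: ler_wpM2l => //.
  (* Adding the squared sine sums completes a squared modulus, whose expansion contains only cosines
     of phase differences. *)
  apply: (@le_trans _ _ (\sum_(A <= n < B) ((\sum_(0 <= j < J) C (n + j * K)%N) ^+ 2 +
      (\sum_(0 <= j < J) S (n + j * K)%N) ^+ 2))).
    by apply: ler_sum => n _; rewrite lerDl sqr_ge0.
  rewrite (eq_bigr (fun n => \sum_(0 <= i < J) \sum_(0 <= j < J)
    cos (2 * pi * (v (n + i * K)%N - v (n + j * K)%N)))); last first.
    move=> n _; rewrite !expr2 !big_distrlr /= -big_split /=; apply: eq_bigr => i _.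
    by rewrite -big_split /=; apply: eq_bigr => j _; rewrite mulrBr cosB.
  rewrite exchange_big /=.
  apply: (@le_trans _ _ (\sum_(0 <= i < J) ((B - A)%:R + J%:R * Y))); last first.
    rewrite sumr_const_nat subn0 -[leLHS]mulr_natl mulrDr expr2 mulrA.
    by rewrite -!mulrA.
  apply: ler_sum_nat => i /andP[_ iJ]; rewrite exchange_big /=.
  apply: (@le_trans _ _ (\sum_(0 <= j < J) ((if i == j then (B - A)%:R else 0) + Y))).
    apply: ler_sum_nat => j /andP[_ jJ].
    have [->|ij] := eqVneq i j.
      rewrite (eq_bigr (fun=> 1)); last by move=> n _; rewrite subrr mulr0 cos0.
      by rewrite sumr_const_nat lerDl.
    rewrite add0r; apply: le_trans (ler_norm _) _.
    have [lij|lji] := ltnP i j; last by apply: hY; lia.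
    rewrite (eq_bigr (fun n => cos (2 * pi * (v (n + j * K)%N - v (n + i * K)%N)))).
      by apply: hY; lia.
    by move=> n _; rewrite -cosN -mulrN opprB.
  rewrite big_split /= sumr_const_nat subn0 -[X in _ + X]mulr_natl lerD2r.
  rewrite -big_mkcond /= -big_filter.
  rewrite (_ : [seq _ <- _ | _] = [:: i]) ?big_seq1//.
  rewrite (eq_filter (a2 := pred1 i)); last by move=> j; rewrite /= eq_sym.
  by rewrite filter_pred1_uniq ?iota_uniq// mem_index_iota.
have E : J%:R * \sum_(A <= n < B) C n - D = \sum_(0 <= j < J)
    (\sum_(A <= n < B) C n - \sum_(A <= n < B) C (n + j * K)%N).
  rewrite sumrB sumr_const_nat subn0 mulr_natl; congr (_ - _).
  by rewrite /D exchange_big.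
rewrite -[in leLHS](ger0_norm (_ : 0 <= J%:R))// -normrM.
rewrite -[X in `|X|](subrK D); apply: le_trans (ler_normD _ _) _; rewrite lerD2r E.
apply: le_trans (normr_sum_le (c := 2 * (J%:R * K%:R)) _) _.
  move=> j /andP[_ jJ]; apply: le_trans (sum_shift_le _ AB _) _ => [n|]; first exact: cos_max.
  by rewrite natrM; apply: ler_wpM2l => //; apply: ler_wpM2r => //; rewrite ler_nat ltnW.
by rewrite subn0 expr2; lra.
Qed.

Lemma powRDp (x r s : R) : 0 < x -> x `^ (r + s) = x `^ r * x `^ s.
Proof. by move=> x0; rewrite powRD// (gt_eqF x0) implybT. Qed.

Lemma ln_le_powR (s x : R) : 0 < s -> 0 < x -> ln x <= s^-1 * x `^ s.
Proof.
move=> s0 x0; rewrite -ler_pdivrMl ?invr_gt0// invrK -ln_powR.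
by apply: ltW; apply: ln_sublinear; exact: powR_gt0.
Qed.

(** Van der Corput's inequality with a fixed number [J] of shifts at spacing [K]. Up to constants,
    the increments of the shifted phases lie between [K / (x ln(x)^2)] and [A^(eps - 1) J K], so the
    Kusmin-Landau inequality bounds the correlations by [x ln(x)^2 / K = o(x)]. *)
Lemma mean0_curved eps v : 0 < eps < 1 -> curved_phase eps v ->
  mean0 (fun n => cos (2 * pi * v n)).
Proof.
move=> /andP[eps0 eps1] [n0 [C [C0 hlow hup hmono]]] e e0.
have [eta eta0 KL] := kusmin_landau R.
(* The spacing [x^g] grows, and still [3/4 (eps - 1) + g = (eps - 1) / 4 < 0] keeps the increments
   of the shifted phases small. *)
pose g : R := (1 - eps) / 2.
have g0 : 0 < g by rewrite divr_gt0// subr_gt0.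
(* [J e^2 > 32] makes the diagonal term [J x^2] at most half of the admissible [(J x e / 4)^2]. *)
have [J hJ] := nat_ev (ev_gt (32 / e ^+ 2)).
have J32 := hJ _ (lexx _).
have JR0 : 0 < J%:R :> R by apply: lt_trans J32; rewrite divr_gt0// exprn_gt0.
have J0 : (0 < J)%N by rewrite -(ltr0n R).
(* thresholds for [x = N]: the window starts at [A ~ x^(3/4)] and [K ~ x^g] *)
have c1 : ev (fun x : R => x `^ (3 / 4 * (eps - 1) + g) <= eta / (C * J%:R)).
  by apply: powR_small; [rewrite /g; lra|rewrite divr_gt0// mulr_gt0].
have c2 : ev (fun x : R => x `^ (- (1 / 4)) <= e / 8).
  by apply: powR_small; [lra|rewrite divr_gt0].
have c3 : ev (fun x : R => x `^ (g - 1) <= Num.min (e / (8 * J%:R)) (1 / (2 * J%:R))).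
  apply: powR_small; first by rewrite /g; lra.
  by rewrite lt_min !divr_gt0// mulr_gt0.
(* Collects the constants of [ln(2x) <= (g/4)^-1 (2x)^(g/4)], squared, and of [K >= x^g / 2]. *)
pose q : R := 2 * (2 * ((g / 4)^-1 * 2 `^ (g / 4)) ^+ 2) * 2.
have w0 : 0 < (g / 4)^-1 * 2 `^ (g / 4) by rewrite mulr_gt0 ?powR_gt0// invr_gt0 divr_gt0.
have q0 : 0 < q by do 3! (apply: mulr_gt0 => //); exact: exprn_gt0.
have c4 : ev (fun x : R => x `^ (- (g / 2)) <= e ^+ 2 / 64 / q).
  by apply: powR_small; [lra|rewrite !divr_gt0// exprn_gt0].
have c5 : ev (fun x : R => n0%:R < x `^ (3 / 4)).
  have := @powR_small R (- (3 / 4)) (n0.+1%:R^-1) ltac:(lra) ltac:(by rewrite invr_gt0).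
  move=> h; apply: ev_imp2 h (ev_gt 0) => x h x0; move: h.
  rewrite powRN lef_pV2 ?posrE ?powR_gt0// => h; apply: lt_le_trans h.
  by rewrite ltr_nat.
have c6 : ev (fun x : R => 2 <= x `^ g).
  have := @powR_small R (- g) (2^-1) ltac:(lra) ltac:(by rewrite invr_gt0).
  move=> h; apply: ev_imp2 h (ev_gt 0) => x h x0; move: h.
  by rewrite powRN lef_pV2 ?posrE ?powR_gt0.
have /nat_ev[N0 hN0] := evI
  (evI c1 (evI c2 c3))
  (evI c4 (evI c5 (evI c6
   (evI (ev_gt (8 / e)) (evI (ev_gt (64 / e ^+ 2)) (ev_gt 4)))))).
exists N0 => N hN; set x : R := N%:R.
have [[k1 [k2 k3]] [k4 [k5 [k6 [k7 [k8 k9]]]]]] := hN0 x ltac:(by rewrite ler_nat).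
clear hN0 hN c1 c2 c3 c4 c5 c6 hJ.
have x0 : 0 < x by lra.
move: k3; rewrite le_min => /andP[k3 k3'].
have [A [hA hA']] : exists A : nat, x `^ (3 / 4) < A%:R /\ A%:R <= x `^ (3 / 4) + 1.
  exists (Num.truncn (x `^ (3 / 4))).+1; split; first exact: truncnS_gt.
  by rewrite -[X in X <= _]natr1 lerD2r truncn_le ?powR_ge0.
have [K [hK hK']] : exists K : nat, K%:R <= x `^ g /\ x `^ g / 2 <= K%:R.
  exists (Num.truncn (x `^ g)); split; first by rewrite truncn_le ?powR_ge0.
  have : x `^ g < (Num.truncn (x `^ g)).+1%:R by exact: truncnS_gt.
  by rewrite -natr1; lra.
have K0 : (0 < K)%N by rewrite -(ltr0n R); lra.
have KR0 : 0 < K%:R :> R by rewrite ltr0n.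
have x34 : x `^ (3 / 4) <= e / 8 * x.
  rewrite (_ : 3 / 4 = - (1 / 4) + 1 :> R); last by field.
  by rewrite (powRDp _ _ x0) (powRr1 (ltW x0)) ler_pM2r.
have e8 : 1 <= e / 8 * x.
  by rewrite -ler_pdivrMl ?divr_gt0// mulr1 invf_div ltW.
have xg : x `^ g = x `^ (g - 1) * x.
  by rewrite -[X in _ * X](powRr1 (ltW x0)) -(powRDp _ _ x0) subrK.
have JK1 : J%:R * K%:R <= e / 8 * x.
  apply: (@le_trans _ _ (J%:R * (x `^ (g - 1) * x))).
    by rewrite -xg ler_pM2l.
  rewrite mulrA ler_pM2r//; apply: le_trans (ler_wpM2l (ltW JR0) k3) _.
  by rewrite (_ : J%:R * (e / (8 * J%:R)) = e / 8)//; field; rewrite gt_eqF.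
have JK2 : J%:R * K%:R <= x / 2.
  apply: (@le_trans _ _ (J%:R * (x `^ (g - 1) * x))).
    by rewrite -xg ler_pM2l.
  rewrite mulrA [leRHS]mulrC ler_pM2r//; apply: le_trans (ler_wpM2l (ltW JR0) k3') _.
  by rewrite (_ : J%:R * (1 / (2 * J%:R)) = 2^-1)//; field; rewrite gt_eqF.
have n0A : (n0 <= A)%N by rewrite -(ler_nat R); lra.
have A0 : (0 < A)%N by rewrite -(ltr_nat R) (le_lt_trans _ hA)// powR_ge0.
have [AN|NA] := leqP A N; last first.
  apply: le_trans (normr_sum_le (c := 1) _) _; first by move=> n _; exact: cos_max.
  rewrite mul1r subn0 -/x; apply: (@le_trans _ _ A%:R); first by rewrite ler_nat ltnW.
  have : A%:R <= e / 8 * x + e / 8 * x by lra.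
  move/le_trans; apply; nra.
pose X := 2 * x * ln (2 * x) ^+ 2.
have ll0 : 0 < ln (2 * x) by apply: ln_gt0; lra.
have X0 : 0 < X by rewrite !mulr_gt0// exprn_gt0.
have lags i j : (j < i < J)%N ->
    `|\sum_(A <= n < N) cos (2 * pi * (v (n + i * K)%N - v (n + j * K)%N))| <= X / K%:R + 1.
  move=> ij; pose u n := v (n + i * K)%N - v (n + j * K)%N.
  have uE n : u n.+1 - u n = sdiff v ((i - j) * K) (n + j * K).
    rewrite /u /sdiff !addSn (_ : n + j * K + (i - j) * K = n + i * K)%N; first by ring.
    by rewrite -addnA -mulnDl subnKC//; clear -ij; lia.
  have ijK : (0 < (i - j) * K)%N by rewrite muln_gt0 K0 andbT; clear -ij; lia.
  have := KL u A N (K%:R / X); rewrite invf_div; apply; first by rewrite divr_gt0.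
    move=> n /andP[An nN]; rewrite uE.
    have iJ : (i * K <= J * K)%N by rewrite leq_mul2r; clear -ij; lia.
    have JKN : ((n + j * K + (i - j) * K).+1)%:R <= 2 * x.
      rewrite -addnA -mulnDl subnKC; last by clear -ij; lia.
      apply: (@le_trans _ _ (N + J * K)%:R).
        by rewrite ler_nat -addSn leq_add.
      by rewrite natrD natrM -/x; lra.
    have n1 : (1 : R) < ((n + j * K + (i - j) * K).+1)%:R by rewrite ltr1n ltnS (leq_trans ijK)// leq_addl.
    apply/andP; split.
      apply: le_trans (hlow _ _ _ ijK); last by rewrite (leq_trans n0A)// (leq_trans An)// leq_addr.
      have lz0 := ln_gt0 n1.
      apply: ler_pM => //; first by rewrite invr_ge0 ltW.
        by rewrite ler_nat leq_pmull//; clear -ij; lia.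
      move: n1 JKN lz0; set Z : R := (n + j * K + (i - j) * K).+1%:R => n1 JKN lz0.
      have Z0 : 0 < Z := lt_trans ltr01 n1.
      rewrite lef_pV2 ?posrE//; last by rewrite mulr_gt0// exprn_gt0.
      apply: ler_pM; rewrite ?(ltW Z0) ?exprn_ge0 ?(ltW lz0)//.
      rewrite lerXn2r ?nnegrE ?(ltW ll0) ?(ltW lz0)// ler_ln ?posrE//.
      exact: lt_le_trans JKN.
    apply: le_trans (hup _ _ _ ijK) _; first by rewrite (leq_trans n0A)// (leq_trans An)// leq_addr.
    have i1 : ((i - j) * K)%:R <= J%:R * x `^ g.
      rewrite natrM; apply: ler_pM => //; rewrite ler_nat; clear -ij; lia.
    have M0 : (0 < n + j * K)%N by rewrite (leq_trans A0)// (leq_trans An)// leq_addr.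
    have i2 : (n + j * K)%:R `^ (eps - 1) <= x `^ (3 / 4 * (eps - 1)).
      rewrite powRrM -[eps - 1]opprB !powRN lef_pV2 ?posrE ?(powR_gt0 _ (powR_gt0 _ x0)) ?powR_gt0 ?ltr0n//.
      apply: ge0_ler_powR; rewrite ?nnegrE ?powR_ge0//; first by rewrite subr_ge0 ltW.
      by apply: le_trans (ltW hA) _; rewrite ler_nat (leq_trans An)// leq_addr.
    apply: (@le_trans _ _ (C * x `^ (3 / 4 * (eps - 1)) * (J%:R * x `^ g))).
      apply: ler_pM => //; first by rewrite mulr_ge0 ?powR_ge0// ltW.
      by rewrite ler_pM2l.
    move: k1; rewrite (powRDp _ _ x0) ler_pdivlMr ?mulr_gt0//; lra.
  move=> n An nN; rewrite !uE addSn; apply: hmono => //.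
  by rewrite (leq_trans n0A)// (leq_trans An)// leq_addr.
have XK0 : 0 <= X / K%:R + 1 by rewrite addr_ge0// divr_ge0// ltW.
have [D hD hS] := van_der_corput AN J0 XK0 lags.
have XK : X / K%:R + 1 <= e ^+ 2 / 32 * x.
  have l1 : ln (2 * x) ^+ 2 <= ((g / 4)^-1 * 2 `^ (g / 4)) ^+ 2 * x `^ (g / 2).
    have -> : x `^ (g / 2) = (x `^ (g / 4)) ^+ 2.
      by rewrite -powR_mulrn ?powR_ge0// -powRrM; congr (_ `^ _); field.
    rewrite -exprMn lerXn2r ?nnegrE ?(ltW ll0)//.
      by rewrite !mulr_ge0 ?powR_ge0// invr_ge0 divr_ge0// ltW.
    rewrite -mulrA -powRM ?(ltW x0)//; apply: ln_le_powR; first by rewrite divr_gt0.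
    by rewrite mulr_gt0.
  have e64 : 1 <= e ^+ 2 / 64 * x.
    by rewrite -ler_pdivrMl ?divr_gt0 ?exprn_gt0// mulr1 invf_div ltW.
  have K2 : K%:R^-1 <= 2 * x `^ (- g).
    rewrite powRN -[2](invrK (2 : R)) -invfM lef_pV2 ?posrE ?mulr_gt0 ?powR_gt0//; lra.
  have XK1 : X / K%:R <= q * x `^ (- (g / 2)) * x.
    apply: (@le_trans _ _ ((2 * x * (((g / 4)^-1 * 2 `^ (g / 4)) ^+ 2 * x `^ (g / 2))) *
       (2 * x `^ (- g)))).
      apply: ler_pM => //; rewrite ?invr_ge0 ?(ltW X0)//.
      by apply: ler_wpM2l => //; lra.
    rewrite (_ : - (g / 2) = g / 2 + - g); last by field.
    rewrite (powRDp _ _ x0) /q.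
    have : 0 <= (g / 4)^-1 * 2 `^ (g / 4) by rewrite !mulr_ge0 ?powR_ge0// invr_ge0 divr_ge0// ltW.
    set w := _^-1 * _ => w1.
    have : 0 <= x * (w ^+ 2 * x `^ (g / 2)) * x `^ (- g).
      apply: mulr_ge0; last exact: powR_ge0.
      by apply: mulr_ge0; [exact: ltW|rewrite mulr_ge0 ?powR_ge0 ?exprn_ge0].
    clear; lra.
  have XK2 : X / K%:R <= e ^+ 2 / 64 * x.
    apply: le_trans XK1 _; rewrite ler_pM2r// mulrC.
    by rewrite -ler_pdivlMr.
  lra.
have hNA : (N - A)%:R <= x by rewrite ler_nat leq_subr.
have D2 : D ^+ 2 <= (J%:R * x * (e / 4)) ^+ 2.
  apply: le_trans hD _; apply: (@le_trans _ _ (x * (J%:R * x + J%:R ^+ 2 * (e ^+ 2 / 32 * x)))).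
    apply: ler_pM => //.
      by rewrite addr_ge0// mulr_ge0// ?exprn_ge0.
    by apply: lerD; [rewrite ler_pM2l|rewrite ler_pM2l ?exprn_gt0].
  have : 32 <= J%:R * e ^+ 2 by rewrite -ler_pdivrMr ?exprn_gt0// ltW.
  move=> h; have : 0 <= J%:R * x ^+ 2 * (J%:R * e ^+ 2 - 32).
    by rewrite mulr_ge0 ?subr_ge0// mulr_ge0// exprn_ge0// ltW.
  lra.
have Dn : `|D| <= J%:R * x * (e / 4).
  rewrite -[leRHS]ger0_norm; last by rewrite !mulr_ge0 ?divr_ge0 ?ltW.
  by rewrite -ler_sqr ?nnegrE// !real_normK ?num_real.
have tail : `|\sum_(A <= n < N) cos (2 * pi * v n)| <= e / 2 * x.
  rewrite -(ler_pM2l JR0); apply: le_trans hS _.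
  have : J%:R * (J%:R * K%:R) <= J%:R * (e / 8 * x) by rewrite ler_pM2l.
  by move=> h; lra.
rewrite (big_cat_nat (n := A))//=; apply: le_trans (ler_normD _ _) _.
have : `|\sum_(0 <= n < A) cos (2 * pi * v n)| <= A%:R.
  apply: le_trans (normr_sum_le (c := 1) _) _; first by move=> n _; exact: cos_max.
  by rewrite mul1r subn0.
rewrite -/x; move: tail hA' x34 e8; clear; lra.
Qed.

End VanDerCorput.

Section WeylTheorem.
Variable R : realType.
Implicit Types (u v : nat -> R).

Lemma noninteger_slopeD u c : noninteger_slope u -> noninteger_slope (fun n => u n + c).
Proof.
move=> [L hL h]; exists L => // eta /h [N hN]; exists N => n /hN.
by rewrite (_ : u n.+1 + c - (u n + c) = u n.+1 - u n); last by ring.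
Qed.

Lemma slow_phaseD v c : slow_phase v -> slow_phase (fun n => v n + c).
Proof.
have E n : v n.+1 + c - (v n + c) = v n.+1 - v n by ring.
move=> [n0 [h1 h2 h3 h4]]; exists n0; split.
- by move=> n hn; rewrite E; exact: h1.
- by move=> n hn; rewrite !E; exact: h2.
- by move=> eta /h3[N hN]; exists N => n /hN; rewrite E.
- by move=> b; have [N hN] := h4 b; exists N => n /hN; rewrite E.
Qed.

Lemma curved_phaseD eps v c : curved_phase eps v -> curved_phase eps (fun n => v n + c).
Proof.
have E h n : sdiff (fun n => v n + c) h n = sdiff v h n by rewrite /sdiff; ring.
move=> [n0 [C [C0 h1 h2 h3]]]; exists n0, C; split => //.
- by move=> n h hn h0; rewrite E; exact: h1.
- by move=> n h hn h0; rewrite E; exact: h2.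
- by move=> n h hn h0; rewrite !E; exact: h3.
Qed.

Lemma cos_2pi_int (x : R) (z : int) : cos (2 * pi * (x + z%:~R)) = cos (2 * pi * x).
Proof.
have nat_case k y : cos (2 * pi * (y + k%:R)) = cos (2 * pi * y) :> R.
  elim: k => [|k IH]; first by rewrite addr0.
  rewrite -{}IH -[RHS]cosD2pi -[k.+1%:R]natr1.
  by congr cos; rewrite -[pi *+ 2]mulr_natr; ring.
case: (intP z) => [|k|k]; first by rewrite addr0.
  by rewrite -pmulrn nat_case.
by rewrite mulrNz -pmulrn -[LHS](nat_case k.+1) subrK.
Qed.

Lemma cos_2pi_sign (s x : R) : issign s -> cos (2 * pi * (s * x)) = cos (2 * pi * x).
Proof. by case=> ->; rewrite ?mul1r// mulN1r mulrN cosN. Qed.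

(** The shift [c] is there for the sine, which is the case [c = -1/4]. At integers, removing an
    integer slope does not change the cosine, and the sign [s] disappears by parity. *)
Lemma weyl_mean0 (eps : R) (p : R -> R) (c : R) : 0 < eps < 1 ->
  logarithmico_exponential p ->
  (exists C : R, forall x y z : R, 0 < x -> 0 < y -> 0 < z ->
    `|p (x + y + z) - p (x + y) - p (x + z) + p x| <= C * (x `^ (eps - 1) * y * z)) ->
  (forall (c : R) (q : {poly rat}),
    `|(c *: map_poly ratr q).[x] - p x| / ln x @[x --> +oo] --> +oo) ->
  mean0 (fun n => cos (2 * pi * (p n%:R + c))).
Proof.
move=> heps hLE h1 h2; have /andP[_ e1] := heps.
have mean0_ext (a b : nat -> R) : a =1 b -> mean0 a -> mean0 b by move=> /funext ->.
have [h|[z [s [hs h]]]|[s [hs h]]] := phase_cases e1 hLE h1 h2.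
- exact: mean0_noninteger (noninteger_slopeD c h).
- apply: mean0_ext (mean0_slow (slow_phaseD (s * c) h)) => n.
  rewrite -mulrDr cos_2pi_sign// -[RHS](cos_2pi_int _ (- (z * n%:Z))).
  by congr cos; rewrite rmorphN rmorphM /=; ring.
- apply: mean0_ext (mean0_curved heps (curved_phaseD (s * c) h)) => n.
  by rewrite -mulrDr cos_2pi_sign.
Qed.

End WeylTheorem.

(** * Martingale tail bounds for Bernoulli trials *)

Section Histories.
Variable R : realType.
Implicit Types (x : nat -> bool) (h : seq bool) (n : nat).

(* Outcomes of the first n trials, most recent first, so that a predictable
   process is a function of the tail. *)
Fixpoint hist x n : seq bool := if n is n'.+1 then x n :: hist x n' else [::].

Lemma size_hist x n : size (hist x n) = n.
Proof. by elim: n => //= n ->. Qed.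

Lemma drop_hist x g n : drop g (hist x (n + g)) = hist x n.
Proof. by elim: g => [|g IH]; rewrite ?addn0 ?drop0// addnS. Qed.

(** Enumerating the histories turns expectations over the first [n] trials into finite weighted
    sums, so that the martingale argument becomes an induction on [n]. *)
Fixpoint hists n : seq (seq bool) := if n is n'.+1 then
  [seq true :: h | h <- hists n'] ++ [seq false :: h | h <- hists n'] else [:: [::]].

Lemma mem_hists h : h \in hists (size h).
Proof.
elim: h => //= b h IH; rewrite mem_cat.
by case: b; apply/orP; [left|right]; apply/mapP; exists h.
Qed.

Variable sg : nat -> R.

Definition trial_weight (b : bool) k := if b then sg k else 1 - sg k.

Fixpoint hist_weight h : R :=
  if h is b :: h' then hist_weight h' * trial_weight b (size h) else 1.

Fixpoint mart (u : seq bool -> R) h : R :=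
  if h is b :: h' then mart u h' + u h' * (b%:R - sg (size h)) else 0.

(** An upper bound for the sum of conditional variances: [sg] stands for [sg (1 - sg)]. *)
Fixpoint qvar (u : seq bool -> R) h : R :=
  if h is b :: h' then qvar u h' + u h' ^+ 2 * sg (size h) else 0.

Lemma mart_hist u x n : mart u (hist x n) =
  \sum_(1 <= k < n.+1) u (hist x k.-1) * ((x k)%:R - sg k).
Proof.
elim: n => [|n IH]; first by rewrite big_geq.
by rewrite big_nat_recr//= IH size_hist.
Qed.

Lemma qvar_hist u x n : qvar u (hist x n) =
  \sum_(1 <= k < n.+1) u (hist x k.-1) ^+ 2 * sg k.
Proof.
elim: n => [|n IH]; first by rewrite big_geq.
by rewrite big_nat_recr//= IH size_hist.
Qed.

Hypothesis sg01 : forall n, 0 <= sg n <= 1.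

Lemma hist_weight_ge0 h : 0 <= hist_weight h.
Proof.
elim: h => //= b h IH; rewrite mulr_ge0// /trial_weight.
have /andP[h0 h1] := sg01 (size h).+1.
by case: b => //; rewrite subr_ge0.
Qed.

Lemma sum_histsS n (F : seq bool -> R) :
  \sum_(h <- hists n.+1) F h = \sum_(h <- hists n) (F (true :: h) + F (false :: h)).
Proof. by rewrite big_cat /= !big_map big_split. Qed.

(** Follows from [expR (- t) >= 1 - t] and [(1 + t + 2 t^2) (1 - t) = 1 + t^2 (1 - 2 t)]. *)
Lemma expR_le_quad (t : R) : t <= 1 / 2 -> expR t <= 1 + t + 2 * t ^+ 2.
Proof.
move=> t2; have h : 1 - t <= (expR t)^-1 by rewrite -expRN; exact: expR_ge1Dx.
have e0 := expR_gt0 t.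
have t0 : 0 < 1 - t by lra.
have : expR t * (1 - t) <= 1.
  by apply: le_trans (ler_wpM2l (ltW e0) h) _; rewrite mulfV ?gt_eqF.
have : 1 <= (1 + t + 2 * t ^+ 2) * (1 - t).
  have : 0 <= t ^+ 2 * (1 - 2 * t) by rewrite mulr_ge0 ?sqr_ge0//; lra.
  by lra.
by move=> h1 h2; rewrite -(ler_pM2r t0); exact: le_trans h1.
Qed.

(** The linear terms cancel because the trial is centered, and the quadratic ones add up to
    [2 y^2 s (1 - s)]. *)
Lemma bernoulli_mgf (y s : R) : 0 <= s <= 1 -> `|y| <= 1 / 2 ->
  s * expR (y * (1 - s)) + (1 - s) * expR (y * (0 - s)) <= expR (2 * y ^+ 2 * s).
Proof.
move=> /andP[s0 s1]; rewrite ler_norml => /andP[y1 y2].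
have h1 : expR (y * (1 - s)) <= 1 + y * (1 - s) + 2 * (y * (1 - s)) ^+ 2.
  by apply: expR_le_quad; nra.
have h2 : expR (y * (0 - s)) <= 1 + y * (0 - s) + 2 * (y * (0 - s)) ^+ 2.
  by apply: expR_le_quad; nra.
apply: le_trans (expR_ge1Dx _).
apply: le_trans (lerD (ler_wpM2l s0 h1) (ler_wpM2l _ h2)) _; first lra.
have : 0 <= y ^+ 2 * s ^+ 2 by rewrite mulr_ge0 ?sqr_ge0.
by lra.
Qed.

(* Freedman's exponential supermartingale *)
Lemma mart_mgf (u : seq bool -> R) (z : R) n : (forall h, `|z * u h| <= 1 / 2) ->
  \sum_(h <- hists n) hist_weight h * expR (z * mart u h - 2 * z ^+ 2 * qvar u h) <= 1.
Proof.
move=> hu; elim: n => [|n IH].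
  by rewrite /= big_seq1 /= !mulr0 subr0 expR0 mul1r.
rewrite sum_histsS; apply: le_trans IH; apply: ler_sum => h _ /=.
set W := hist_weight h; set Q := mart u h; set V := qvar u h.
set s := sg (size h).+1; set y := z * u h.
have -> : z * (Q + u h * (1 - s)) - 2 * z ^+ 2 * (V + u h ^+ 2 * s) =
    (z * Q - 2 * z ^+ 2 * V - 2 * y ^+ 2 * s) + y * (1 - s) by rewrite /y; ring.
have -> : z * (Q + u h * (0 - s)) - 2 * z ^+ 2 * (V + u h ^+ 2 * s) =
    (z * Q - 2 * z ^+ 2 * V - 2 * y ^+ 2 * s) + y * (0 - s) by rewrite /y; ring.
have E a b c : expR (a - b + c) = expR a / expR b * expR c :> R by rewrite !expRD expRN.
rewrite /trial_weight /= -/s -/W !E.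
set A := expR _; set B := expR _; set e1 := expR _; set e2 := expR _.
rewrite (_ : _ + _ = W * (A * ((s * e1 + (1 - s) * e2) / B))); last by ring.
apply: ler_wpM2l; first exact: hist_weight_ge0.
rewrite -[leRHS]mulr1; apply: ler_wpM2l; first exact: expR_ge0.
by rewrite ler_pdivrMr ?expR_gt0// mul1r; exact: (bernoulli_mgf (sg01 _) (hu h)).
Qed.

Lemma mart_tail (u : seq bool -> R) (z t : R) n : (forall h, `|z * u h| <= 1 / 2) ->
  \sum_(h <- hists n | t <= z * mart u h - 2 * z ^+ 2 * qvar u h) hist_weight h
    <= expR (- t).
Proof.
move=> hu; rewrite -[leRHS]mulr1.
apply: le_trans (ler_wpM2l (expR_ge0 _) (mart_mgf n hu)).
rewrite big_mkcond mulr_sumr; apply: ler_sum => h _.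
have w0 := hist_weight_ge0 h.
case: ifPn => [ht|_]; last by rewrite !mulr_ge0 ?expR_ge0.
rewrite mulrCA ler_peMr// -expRD -[leLHS]expR0 ler_expR.
by move: ht; clear; lra.
Qed.

(** Both signs of [z] occur, so that the complementary event gives a two-sided bound. *)
Definition large (z t : R) (u : seq bool -> R) h :=
  (t <= z * mart u h - 2 * z ^+ 2 * qvar u h) ||
  (t <= - z * mart u h - 2 * (- z) ^+ 2 * qvar u h).

Lemma large_tail (us : seq (seq bool -> R)) (z t : R) n :
  (forall i h, (i < size us)%N -> `|z * nth (fun=> 0) us i h| <= 1 / 2) ->
  \sum_(h <- hists n | has (fun u => large z t u h) us) hist_weight h
    <= (2 * size us)%:R * expR (- t).
Proof.
elim: us => [|u us IH] hus.
  by rewrite big_pred0 ?muln0 ?mul0r// => h.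
have hu h : `|z * u h| <= 1 / 2 by exact: (hus 0%N).
have hu' h : `|- z * u h| <= 1 / 2 by rewrite mulNr normrN.
have h1 := mart_tail t n hu; have h2 := mart_tail t n hu'.
have h3 := IH (fun i h => hus i.+1 h).
rewrite (_ : (2 * size (u :: us))%:R = 1 + 1 + (2 * size us)%:R :> R); last first.
  by rewrite /= mulnS natrD.
rewrite !mulrDl mul1r; apply: le_trans (lerD (lerD h1 h2) h3).
rewrite [leLHS]big_mkcond [X in X + _ + _]big_mkcond [X in _ + X + _]big_mkcond
  [X in _ + _ + X]big_mkcond -!big_split /=; apply: ler_sum => h _.
rewrite /large; have w0 := hist_weight_ge0 h.
case: (t <= z * _ - _); case: (t <= - z * _ - _); case: has => /=; lra.
Qed.

Lemma notlarge z t u h : 0 < z -> ~~ large z t u h ->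
  `|mart u h| <= 2 * z * qvar u h + t / z.
Proof.
move=> z0; rewrite negb_or -!ltNge => /andP[h1 h2].
have E : (2 * z * qvar u h + t / z) * z = 2 * z ^+ 2 * qvar u h + t.
  by field; rewrite gt_eqF.
rewrite ler_norml -(ler_pM2r z0) mulNr E -[X in _ && X](ler_pM2r z0) E.
by apply/andP; split; lra.
Qed.

End Histories.

(** * Borel-Cantelli *)

Section SummableEvents.
Variables (R : realType) (d : measure_display) (T : measurableType d).
Variable mu : {measure set T -> \bar R}.

Lemma nneseries_le (u : nat -> \bar R) (K : \bar R) : (forall n, 0 <= u n)%E ->
  (forall n, \sum_(0 <= i < n) u i <= K)%E -> (\sum_(0 <= i <oo) u i <= K)%E.
Proof.
move=> u0 h; apply: lime_le; first by apply: is_cvg_ereal_nneg_natsum => n _; exact: u0.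
exact: nearW.
Qed.

Lemma sum_measure_le (F : nat -> set T) (b : nat -> R) (K : R) :
  (forall n, mu (F n) <= (b n)%:E)%E -> (forall n, \sum_(0 <= i < n) b i <= K) ->
  (\sum_(0 <= i <oo) mu (F i) <= K%:E)%E.
Proof.
move=> hb hK; apply: nneseries_le => n; first exact: measure_ge0.
apply: (@le_trans _ _ (\sum_(0 <= i < n) (b i)%:E)%E); first exact: lee_sum.
by rewrite sumEFin lee_fin.
Qed.

Lemma measure_bigcup_le (F : nat -> set T) (b : nat -> R) (K : R) :
  (forall n, measurable (F n)) ->
  (forall n, mu (F n) <= (b n)%:E)%E -> (forall n, \sum_(0 <= i < n) b i <= K) ->
  (mu (\bigcup_n F n) <= K%:E)%E.
Proof.
move=> mF hb hK; apply: le_trans (sum_measure_le hb hK).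
apply: generalized_Boole_inequality => //.
exact: bigcup_measurable.
Qed.

Lemma borel_cantelli (F : nat -> set T) (b : nat -> R) (K : R) :
  (forall n, measurable (F n)) ->
  (forall n, mu (F n) <= (b n)%:E)%E -> (forall n, \sum_(0 <= i < n) b i <= K) ->
  {ae mu, forall w, exists n0, forall n, (n0 <= n)%N -> ~ F n w}.
Proof.
move=> mF hb hK.
have h0 : mu (lim_sup_set F) = 0%E.
  by apply: lim_sup_set_cvg0 => //; apply: le_lt_trans (sum_measure_le hb hK) (ltry _).
exists (lim_sup_set F); split => //.
  apply: bigcapT_measurable => n; apply: bigcup_measurable => k _; exact: mF.
move=> w /= /forallNP h n _.
have /existsNP[k /not_implyP[nk /contrapT Fk]] := h n.
by exists k.
Qed.

Lemma ae_exists_forall (Q : nat -> T -> Prop) :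
  (forall n, {ae mu, forall w, Q n w}) -> {ae mu, forall w, forall n, Q n w}.
Proof.
move=> h; apply: (@negligibleS _ _ _ _ (\bigcup_n ~` [set w | Q n w])).
  by move=> w /= /existsNP[n hn]; exists n.
exact: negligible_bigcup.
Qed.

End SummableEvents.

(** * The law of the first n trials *)

Section BernoulliTrials.
Variables (R : realType) (d : measure_display) (Omega : measurableType d).
Variables (P : probability Omega R) (X : nat -> {RV P >-> R}) (sg : nat -> R).
Hypothesis X01 : forall n, (1 <= n)%N -> forall w, X n w = 0 \/ X n w = 1.
Hypothesis Xind : independent_RVs [set n | (1 <= n)%N] X.
Hypothesis EX : forall n, (1 <= n)%N -> ('E_P[X n] = (sg n)%:E)%E.

Definition trials (w : Omega) (k : nat) : bool := X k w == 1.

Definition outcome (b : bool) : set R := if b then [set 1] else ~` [set 1].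

Lemma measurable_outcome b : measurable (outcome b).
Proof. by case: b => /=; [|apply: measurableC]; exact: measurable_set1. Qed.

Lemma trialsP k b w : trials w k = b <-> (X k @^-1` outcome b) w.
Proof.
rewrite /trials /preimage /outcome /=; case: b; split.
- by move/eqP.
- by move=> ->; rewrite eqxx.
- by move=> e h; move: e; rewrite h eqxx.
- by move=> /eqP/negbTE.
Qed.

Lemma measurable_trial k b : measurable (X k @^-1` outcome b).
Proof.
rewrite -[X in measurable X]setTI; apply: measurable_funP => //.
exact: measurable_outcome.
Qed.

Lemma trial_prob k b : (1 <= k)%N -> P (X k @^-1` outcome b) = (trial_weight sg b k)%:E.
Proof.
move=> k1; have H : P (X k @^-1` outcome true) = (sg k)%:E.
  rewrite -EX// expectation_def.
  rewrite -[in LHS](setIT (X k @^-1` _)) -(integral_indic P measurableT (measurable_trial k true)).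
  apply: eq_integral => w _; congr (_%:E); rewrite indicE.
  have [e|e] := X01 k1 w.
    rewrite memNset ?e// => /trialsP; rewrite /trials e => /eqP /esym/eqP.
    by rewrite oner_eq0.
  by rewrite mem_set ?e.
case: b => //; rewrite (_ : _ @^-1` _ = ~` (X k @^-1` outcome true))//.
rewrite probability_setC; first by rewrite [P _]H EFinB.
exact: (measurable_trial k true).
Qed.

(** Writes a history as the finite intersection to which [independent_RVs] applies; trial [i] sits
    at position [n - i] because the most recent outcome comes first. *)
Lemma hist_set n h : size h = n ->
  [set w | hist (trials w) n = h] =
  \bigcap_(i in [set k | (1 <= k <= n)%N]) (X i @^-1` outcome (nth false h (n - i))).
Proof.
elim: n h => [|n IH] [|b h] //= => [_|[sh]].
  by apply/seteqP; split => w //= _ k /=; lia.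
have E : [set w | trials w n.+1 :: hist (trials w) n = b :: h] =
    [set w | trials w n.+1 = b] `&` [set w | hist (trials w) n = h].
  by apply/seteqP; split => w /= => [[-> ->]|[-> ->]].
rewrite E IH//; apply/seteqP; split => [w [/= h1 h2] k /= /andP[k1 kn]|w hw].
  move: kn; rewrite leq_eqVlt => /predU1P[->|kn].
    by rewrite subnn /=; exact/trialsP.
  have := h2 k; rewrite /= k1 (_ : (k <= n)%N) ; last lia.
  by move=> /(_ isT); rewrite subSn; last lia.
split => /=.
  by apply/trialsP; have := hw n.+1; rewrite /= subnn; apply; lia.
move=> k /= /andP[k1 kn]; have := hw k; rewrite /= k1 leqW// subSn//=.
by apply.
Qed.

Lemma measurable_hist n h : measurable [set w | hist (trials w) n = h].
Proof.
elim: n h => [|n IH] [|b h] /=.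
- by rewrite (_ : [set _ | _] = setT)//; apply/seteqP; split.
- by rewrite (_ : [set _ | _] = set0)//; apply/seteqP; split.
- by rewrite (_ : [set _ | _] = set0)//; apply/seteqP; split.
- rewrite (_ : [set _ | _] = (X n.+1 @^-1` outcome b) `&` [set w | hist (trials w) n = h]).
    by apply: measurableI => //; exact: measurable_trial.
  apply/seteqP; split => w /= => [[h1 ->]|[h1 ->]]; first by split => //; exact/trialsP.
  by congr (_ :: _); exact/trialsP.
Qed.

Lemma prod_trial_weight n h : size h = n ->
  \prod_(1 <= i < n.+1) trial_weight sg (nth false h (n - i)) i = hist_weight sg h.
Proof.
elim: n h => [|n IH] [|b h] //=; first by rewrite big_geq.
move=> [sh]; rewrite big_nat_recr//= subnn /= sh; congr (_ * _).
rewrite -(IH h sh); apply: eq_big_nat => i /andP[i1 iN].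
by rewrite subSn.
Qed.

Lemma hist_prob n h : size h = n ->
  P [set w | hist (trials w) n = h] = (hist_weight sg h)%:E.
Proof.
move=> sh; rewrite hist_set// -(prod_trial_weight sh).
pose J : {fset nat} := [fset k | k in iota 1 n]%fset.
have EJ : [set` J] = [set k | (1 <= k <= n)%N].
  by apply/seteqP; split => k /=; rewrite !inE mem_iota add1n ltnS.
rewrite -EJ (Xind (B := fun i => outcome (nth false h (n - i)))).
- have pJ : perm_eq (enum_fset J) (index_iota 1 n.+1).
    apply: uniq_perm; [exact: fset_uniq|exact: iota_uniq|].
    by move=> k; rewrite mem_index_iota; have := mem_iota 1 n k; rewrite -[k \in enum_fset J]/(k \in J) inE /= => ->; rewrite add1n.
  rewrite (perm_big _ pJ) /= -prodEFin; apply: eq_big_nat => i /andP[i1 _].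
  exact: trial_prob.
- by rewrite EJ => k /= /andP[].
- by move=> i; exact: measurable_outcome.
Qed.

Lemma measurable_hist_event n (Q : pred (seq bool)) :
  measurable [set w | Q (hist (trials w) n)].
Proof.
rewrite (_ : [set _ | _] = \big[setU/set0]_(h <- hists n | Q h)
   [set w | hist (trials w) n = h]).
  by apply: bigsetU_measurable => h _; exact: measurable_hist.
apply/seteqP; split => w /=.
  move=> Qw; rewrite -bigcup_seq_cond; exists (hist (trials w) n) => //=.
  have := mem_hists (hist (trials w) n); rewrite size_hist => ->.
  by rewrite Qw.
by rewrite -bigcup_seq_cond => -[h /= /andP[_ Qh] ->].
Qed.

Lemma hist_event_le n (Q : pred (seq bool)) :
  (P [set w | Q (hist (trials w) n)] <= (\sum_(h <- hists n | Q h) hist_weight sg h)%:E)%E.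
Proof.
have size_hists h : h \in hists n -> size h = n.
  elim: n h => [|n IH] h /=; first by rewrite inE => /eqP ->.
  by rewrite mem_cat => /orP[] /mapP[h' /IH <- ->].
pose A h := [set w | hist (trials w) n = h].
suff H (s : seq (seq bool)) : {subset s <= hists n} ->
    (P (\big[setU/set0]_(h <- s | Q h) A h) <= (\sum_(h <- s | Q h) hist_weight sg h)%:E)%E.
  apply: le_trans (H _ (fun h => id)).
  rewrite le_measure ?inE//; first exact: measurable_hist_event.
    by apply: bigsetU_measurable => h _; exact: measurable_hist.
  move=> w /= Qw; rewrite -bigcup_seq_cond; exists (hist (trials w) n) => //=.
  have := mem_hists (hist (trials w) n); rewrite size_hist => ->.
  by rewrite Qw.
elim: s => [|h s IH] sub; first by rewrite !big_nil measure0.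
have {}IH := IH (fun k ks => sub k (mem_behead (s := h :: s) ks)).
rewrite !big_cons; case: ifPn => // Qh.
apply: le_trans (measureU2 _ _ _) _; first exact: measurable_hist.
  by apply: bigsetU_measurable => k _; exact: measurable_hist.
rewrite EFinD; apply: leeD => //; rewrite le_eqVlt; apply/orP; left; apply/eqP; apply: hist_prob.
by apply: size_hists; apply: sub; rewrite mem_head.
Qed.

End BernoulliTrials.

(** * Counts and autocorrelations as martingales *)

Section Windows.
Variable R : realType.
Implicit Types (x : nat -> bool) (h : seq bool).

Definition succs x k := count id (hist x k).

(** The factor [th] depends only on trials before [k], and at a success it equals
    [th (succs x k)]. *)
Definition centered (sg : nat -> R) (th : nat -> R) x k : R :=
  ((x k)%:R - sg k) * th (succs x k.-1).+1.

(** The range keeps both [k - g] and [k] inside the window. *)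
Definition lag_sum (c : nat -> R) m l g : R := \sum_((m + g).+1 <= k < (m + l).+1) c (k - g)%N * c k.

Definition win_count x m l : R := \sum_(m.+1 <= k < (m + l).+1) (x k)%:R.

(* What is used of a random sequence on a window (m, m + l] where the success
   probabilities are about s: square-root cancellation up to logarithms, both for
   the number of successes and for the autocorrelations. *)
Definition regular_window (sg th : nat -> R) x m l (s : R) :=
  `|win_count x m l - \sum_(m.+1 <= k < (m + l).+1) sg k|
     <= (1 + 8 * ln l%:R) * Num.sqrt (l%:R * s) /\
  forall g, (0 < g < l)%N ->
    `|lag_sum (centered sg th x) m l g| <=
      (win_count x m l + l%:R * s) / Num.sqrt l%:R + 8 * ln l%:R * (s * Num.sqrt l%:R).

Variables (sg th : nat -> R).
Hypothesis sg01 : forall k, 0 <= sg k <= 1.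
Hypothesis th1 : forall n, `|th n| <= 1.

Definition last_centered h : R :=
  if h is b :: h' then (b%:R - sg (size h)) * th (count id h').+1 else 0.

Lemma last_centered_hist x k : (0 < k)%N ->
  last_centered (hist x k) = centered sg th x k.
Proof. by case: k => // k _; rewrite /last_centered /= size_hist. Qed.

Definition count_proc m l (h : seq bool) : R :=
  if (m <= size h < m + l)%N then 1 else 0.

(** For the term at time [k] the history ends at [k - 1], so dropping [g.-1] outcomes reaches time
    [k - g]. Multiplication by the next centered trial yields the product of [centered] at [k - g]
    and at [k]. *)
Definition lag_proc m l g (h : seq bool) : R :=
  if (m + g <= size h < m + l)%N
  then last_centered (drop g.-1 h) * th (count id h).+1 else 0.

Lemma last_centered_sqr h : last_centered h ^+ 2 <=
  if h is b :: _ then b%:R + sg (size h) ^+ 2 else 0.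
Proof.
case: h => [|b h] /=; first by rewrite expr0n.
set t := th _; have t1 : t ^+ 2 <= 1 by rewrite -(real_normK (num_real t)) exprn_ile1// th1.
have /andP[s0 s1] := sg01 (size h).+1; set s := sg _ in s0 s1 *.
rewrite exprMn; apply: (@le_trans _ _ ((b%:R - s) ^+ 2)).
  by rewrite ler_piMr ?sqr_ge0.
by case: b => /=; nra.
Qed.

Lemma last_centered_le1 h : `|last_centered h| <= 1.
Proof.
case: h => [|b h] /=; first by rewrite normr0.
have /andP[s0 s1] := sg01 (size h).+1; set s := sg _ in s0 s1 *.
rewrite normrM; apply: mulr_ile1 => //.
by rewrite ler_norml; case: b => /=; apply/andP; split; lra.
Qed.

Lemma sum_window (m l n : nat) (F : nat -> R) : n = (m + l)%N ->
  \sum_(1 <= k < n.+1) (if (m <= k.-1 < m + l)%N then F k else 0) =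
  \sum_(m.+1 <= k < (m + l).+1) F k.
Proof.
move=> ->; rewrite (big_cat_nat (n := m.+1))//=; last by lia.
rewrite big_nat big1 ?add0r => [|k hk]; last by rewrite ifF//; lia.
by apply: eq_big_nat => k hk; rewrite ifT//; lia.
Qed.

Lemma mart_count x m l : mart sg (count_proc m l) (hist x (m + l)) =
  win_count x m l - \sum_(m.+1 <= k < (m + l).+1) sg k.
Proof.
rewrite mart_hist -sumrB -(@sum_window m l (m + l) (fun k => (x k)%:R - sg k))//.
apply: eq_bigr => k _; rewrite /count_proc size_hist.
by case: ifP; rewrite ?mul1r ?mul0r.
Qed.

Lemma qvar_count x m l : qvar sg (count_proc m l) (hist x (m + l)) =
  \sum_(m.+1 <= k < (m + l).+1) sg k.
Proof.
rewrite qvar_hist -(@sum_window m l (m + l) sg)//.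
apply: eq_bigr => k _; rewrite /count_proc size_hist.
by case: ifP; rewrite ?expr1n ?mul1r// expr0n mul0r.
Qed.

Lemma lag_proc_hist x m l g k : (0 < g)%N -> (0 < k)%N ->
  lag_proc m l g (hist x k.-1) = if (m + g <= k.-1 < m + l)%N
    then centered sg th x (k - g)%N * th (succs x k.-1).+1 else 0.
Proof.
move=> g0 k0; rewrite /lag_proc size_hist; case: ifP => // hk.
rewrite (_ : k.-1 = (k - g) + g.-1)%N; last by lia.
by rewrite drop_hist last_centered_hist//; lia.
Qed.

Lemma mart_lag x m l g : (0 < g < l)%N -> mart sg (lag_proc m l g) (hist x (m + l)) =
  lag_sum (centered sg th x) m l g.
Proof.
move=> /andP[g0 gl]; rewrite mart_hist /lag_sum.
have E : (m + l = (m + g) + (l - g))%N by lia.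
rewrite [in RHS]E -(@sum_window (m + g) (l - g) (m + l)) -?E//.
apply: eq_big_nat => k /andP[k0 _]; rewrite lag_proc_hist//.
by case: ifP => _; rewrite ?mul0r// /centered; ring.
Qed.

(** Bounding the square of the earlier factor by [x + s] rather than by 1 gains a second power of
    [s] once the count of successes is under control. *)
Lemma qvar_lag x m l g (s : R) : (0 < g < l)%N -> 0 <= s <= 1 ->
  (forall k, (m < k <= m + l)%N -> sg k <= s) ->
  qvar sg (lag_proc m l g) (hist x (m + l)) <= s * (win_count x m l + l%:R * s).
Proof.
move=> /andP[g0 gl] /andP[s0 s1] hs; rewrite qvar_hist.
have E : (m + l = (m + g) + (l - g))%N by lia.
apply: (@le_trans _ _ (\sum_(1 <= k < (m + l).+1)
    (if (m + g <= k.-1 < (m + g) + (l - g))%N then s * ((x (k - g)%N)%:R + s) else 0))).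
  apply: ler_sum_nat => k /andP[k0 kl]; rewrite lag_proc_hist// -E.
  case: ifP => hk; last by rewrite expr0n mul0r.
  have kg : (m < k - g <= m + l)%N by lia.
  have h1 : 0 <= sg k <= s by have /andP[-> _] := sg01 k; apply: hs; lia.
  have h2 := last_centered_sqr (hist x (k - g)).
  rewrite -last_centered_hist; last by lia.
  have E2 : (k - g = (k - g).-1.+1)%N by lia.
  move: h2; rewrite {2}E2 /= size_hist -E2 => h2.
  have h3 : 0 <= sg (k - g)%N <= s by have /andP[-> _] := sg01 (k - g)%N; apply: hs.
  set c := last_centered _ in h2 *; set t := th _.
  have t1 : t ^+ 2 <= 1 by rewrite -(real_normK (num_real t)) exprn_ile1// th1.
  rewrite mulrC; case/andP: h1 => k1 k2; case/andP: h3 => k3 k4.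
  apply: ler_pM => //; first exact: sqr_ge0.
  rewrite exprMn; apply: (@le_trans _ _ (c ^+ 2)); first by rewrite ler_piMr ?sqr_ge0.
  apply: le_trans h2 _; rewrite lerD2l; nra.
rewrite (sum_window _ E) -mulr_sumr; apply: ler_wpM2l => //.
rewrite -E big_split /= lerD//.
  rewrite /win_count -(subnK (_ : g <= m + g)%N); last by lia.
  have -> : \sum_((m + g - g + g).+1 <= i < (m + l).+1) (x (i - g)%N)%:R =
     \sum_(m.+1 <= i < (m + l - g).+1) (x i)%:R :> R.
    rewrite (_ : (m + g - g + g).+1 = m.+1 + g)%N; last by lia.
    rewrite (_ : (m + l).+1 = (m + l - g).+1 + g)%N; last by lia.
    by rewrite big_addn addnK; apply: eq_big_nat => i hi; rewrite addnK.
  rewrite (big_cat_nat (n := (m + l - g).+1) (p := (m + l).+1))//=; try lia.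
  by rewrite lerDl sumr_ge0.
rewrite sumr_const_nat -[leLHS]mulr_natl; apply: ler_wpM2r => //.
by rewrite ler_nat; lia.
Qed.

End Windows.

Section RegularWindows.
Variables (R : realType) (d : measure_display) (Omega : measurableType d).
Variables (P : probability Omega R) (X : nat -> {RV P >-> R}) (sg th : nat -> R).
Hypothesis X01 : forall n, (1 <= n)%N -> forall w, X n w = 0 \/ X n w = 1.
Hypothesis Xind : independent_RVs [set n | (1 <= n)%N] X.
Hypothesis EX : forall n, (1 <= n)%N -> ('E_P[X n] = (sg n)%:E)%E.
Hypothesis sg01 : forall k, 0 <= sg k <= 1.
Hypothesis th1 : forall n, `|th n| <= 1.

Lemma martZ (z : R) u h : mart sg (fun k => z * u k) h = z * mart sg u h.
Proof. by elim: h => [|b h IH] /=; rewrite ?mulr0// IH; ring. Qed.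

Lemma qvarZ (z : R) u h : qvar sg (fun k => z * u k) h = z ^+ 2 * qvar sg u h.
Proof. by elim: h => [|b h IH] /=; rewrite ?mulr0// IH; ring. Qed.

Lemma sum_inv_sqr_le n : \sum_(0 <= i < n) (i.+1%:R ^+ 2)^-1 <= 2 - n%:R^-1 :> R.
Proof.
elim: n => [|n IH]; first by rewrite big_geq// invr0 subr0.
case: n IH => [_|n IH]; first by rewrite big_nat1 expr1n invr1; lra.
rewrite big_nat_recr//=; apply: le_trans (lerD IH (lexx _)) _.
have n0 : 0 < n.+1%:R :> R by rewrite ltr0n.
rewrite -[n.+2%:R]natr1; set y : R := n.+1%:R in n0 *.
rewrite -subr_ge0 (_ : _ - _ = (y * (y + 1) ^+ 2)^-1); last first.
  by field; rewrite !gt_eqF//; lra.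
by rewrite invr_ge0 mulr_ge0 ?sqr_ge0// ltW.
Qed.

(** Each process is divided by twice the order of its standard deviation, [sqrt(l s)] for the count
    and [s sqrt(l)] for a lag. It is then at most 1/2, and the tail bound applies with [z = 1]. *)
Definition win_procs m l (s : R) : seq (seq bool -> R) :=
  (fun h => (2 * Num.sqrt (l%:R * s))^-1 * count_proc R m l h) ::
  [seq (fun h => (2 * (s * Num.sqrt l%:R))^-1 * lag_proc sg th m l g h) | g <- iota 1 l.-1].

Lemma win_procs_le m l (s : R) i h : 1 <= s * Num.sqrt l%:R -> 0 <= s <= 1 ->
  (i < size (win_procs m l s))%N -> `|1 * nth (fun=> 0) (win_procs m l s) i h| <= 1 / 2.
Proof.
move=> sl /andP[s0 s1] hi; rewrite mul1r.
have half (y : R) (v : R) : 1 <= y -> `|v| <= 1 -> `|(2 * y)^-1 * v| <= 1 / 2.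
  move=> y1 v1; have y0 : 0 < 2 * y by lra.
  rewrite normrM ger0_norm ?invr_ge0 ?(ltW y0)// mulrC ler_pdivrMr//.
  lra.
have sq : s * Num.sqrt l%:R <= Num.sqrt (l%:R * s).
  rewrite sqrtrM// [leRHS]mulrC; apply: ler_wpM2r; first exact: sqrtr_ge0.
  by rewrite -[leLHS](ger0_norm s0) -sqrtr_sqr ler_wsqrtr// expr2 ler_piMr.
move: hi; case: i => [_|i] /=.
  apply: half; first exact: le_trans sq.
  by rewrite /count_proc; case: ifP; rewrite ?normr1 ?normr0.
rewrite size_map size_iota ltnS => hi.
rewrite (nth_map 0%N) ?size_iota//; apply: half => //.
rewrite /lag_proc; case: ifP => _; last by rewrite normr0.
by rewrite normrM; apply: mulr_ile1 => //; exact: last_centered_le1.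
Qed.

Lemma regular_window_of_notlarge m l (s : R) x : (0 < l)%N -> 1 <= s * Num.sqrt l%:R ->
  0 <= s <= 1 -> (forall k, (m < k <= m + l)%N -> sg k <= s) ->
  ~~ has (fun u => large sg 1 (4 * ln l%:R) u (hist x (m + l))) (win_procs m l s) ->
  regular_window sg th x m l s.
Proof.
move=> l0 sl s01 hs /=; have /andP[s0 s1] := s01.
have L0 : 0 < Num.sqrt (l%:R : R) by rewrite sqrtr_gt0 ltr0n.
have s_gt0 : 0 < s by rewrite lt0r s0 andbT; apply/eqP => e; move: sl; rewrite e mul0r; lra.
have W0 : 0 < Num.sqrt (l%:R * s) by rewrite sqrtr_gt0 mulr_gt0// ltr0n.
rewrite negb_or => /andP[/(notlarge ltr01) h1]; rewrite has_map => /hasPn h2; split.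
  move: h1; rewrite martZ qvarZ mart_count qvar_count divr1 mulr1.
  set D := _ - _; set V := \sum_(_ <= _ < _) sg _ => h1.
  have V1 : V <= Num.sqrt (l%:R * s) ^+ 2.
    rewrite sqr_sqrtr; last by rewrite mulr_ge0// ltW.
    apply: (@le_trans _ _ (\sum_(m.+1 <= k < (m + l).+1) s)).
      by apply: ler_sum_nat => k hk; apply: hs; lia.
    by rewrite sumr_const_nat subSS addKn mulr_natl.
  set y := Num.sqrt (l%:R * s) in W0 V1 h1 *.
  have y2 : 0 < 2 * y by lra.
  move: h1; rewrite normrM ger0_norm ?invr_ge0 ?(ltW y2)//.
  rewrite -(ler_pM2l y2) mulrA mulfV ?gt_eqF// mul1r => /le_trans; apply.
  have -> : 2 * y * (2 * ((2 * y)^-1 ^+ 2 * V) + 4 * ln l%:R) = V / y + 8 * ln l%:R * y.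
    by field; rewrite gt_eqF.
  rewrite [leRHS]mulrDl mul1r lerD2r ler_pdivrMr//.
move=> g gl; have := h2 g; rewrite mem_iota (_ : (_ <= _ < _)%N); last by lia.
move=> /(_ isT)/(notlarge ltr01).
rewrite martZ qvarZ mart_lag// divr1 mulr1.
have hV := @qvar_lag R sg th sg01 th1 x m l g s gl s01 hs.
set y := s * Num.sqrt l%:R in sl *; set V := qvar _ _ _ in hV *; set D := lag_sum _ _ _ _.
set N := win_count R x m l + l%:R * s in hV *.
have y2 : 0 < 2 * y by rewrite !mulr_gt0.
rewrite normrM ger0_norm ?invr_ge0 ?(ltW y2)//.
rewrite -(ler_pM2l y2) mulrA mulfV ?gt_eqF// mul1r => /le_trans; apply.
have -> : 2 * y * (2 * ((2 * y)^-1 ^+ 2 * V) + 4 * ln l%:R) = V / y + 8 * ln l%:R * y.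
  by field; rewrite gt_eqF// mulr_gt0.
rewrite lerD2r ler_pdivrMr; last by rewrite mulr_gt0.
by apply: le_trans hV _; rewrite /y mulrCA divfK ?gt_eqF// mulrC.
Qed.

Lemma regular_windows (m l : nat -> nat) (s : nat -> R) (i0 : nat) :
  (forall i, (i0 <= i)%N -> [/\ (i < l i)%N, 0 <= s i <= 1,
     1 <= s i * Num.sqrt (l i)%:R &
     forall k, (m i < k <= m i + l i)%N -> sg k <= s i]) ->
  {ae P, forall w, exists i1, forall i, (i1 <= i)%N ->
    regular_window sg th (trials X w) (m i) (l i) (s i)}.
Proof.
move=> H; pose Q i h := (i0 <= i)%N &&
  has (fun u => large sg 1 (4 * ln (l i)%:R) u h) (win_procs (m i) (l i) (s i)).
pose F i := [set w | Q i (hist (trials X w) (m i + l i))].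
have mF i : measurable (F i) by exact: measurable_hist_event.
have PF i : (P (F i) <= (2 * (i.+1%:R ^+ 2)^-1)%:E)%E.
  have [ii|ii] := leqP i0 i; last first.
    rewrite (_ : F i = set0) ?measure0; last first.
      by apply/seteqP; split => // w /=; rewrite /F /Q /= leqNgt ii.
    by rewrite lee_fin mulr_ge0// invr_ge0 exprn_ge0.
  have [il s01 sl hs] := H i ii.
  apply: le_trans (hist_event_le X01 Xind EX (m i + l i) (Q i)) _; rewrite lee_fin.
  rewrite (eq_bigl (fun h => has (fun u => large sg 1 (4 * ln (l i)%:R) u h)
    (win_procs (m i) (l i) (s i)))); last by move=> h; rewrite /Q ii.
  apply: le_trans (large_tail sg01 _ _ _) _.
    by move=> j h; exact: win_procs_le.
  have l0 : 0 < (l i)%:R :> R by rewrite ltr0n; lia.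
  (* The level [4 ln l] beats the union bound over [l] processes: what remains, [2 l^-3], is
     summable because [l i > i]. *)
  have -> : expR (- (4 * ln (l i)%:R)) = ((l i)%:R ^+ 4)^-1 :> R.
    by rewrite expRN mulr_natl -lnXn// lnK// posrE exprn_gt0.
  rewrite [size _]/= size_map size_iota prednK; last by lia.
  rewrite natrM -mulrA; apply: ler_wpM2l => //.
  rewrite exprS invfM mulrA mulfV ?gt_eqF// mul1r lef_pV2 ?posrE ?exprn_gt0//.
  apply: (@le_trans _ _ ((l i)%:R ^+ 2)).
    by rewrite lerXn2r ?nnegrE// ler_nat.
  by rewrite -subr_ge0 (_ : _ - _ = (l i)%:R ^+ 2 * ((l i)%:R - 1)); [rewrite mulr_ge0 ?sqr_ge0 ?subr_ge0 ?ler1n; lia|ring].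
have K n : \sum_(0 <= i < n) (2 * (i.+1%:R ^+ 2)^-1) <= 4 :> R.
  rewrite -mulr_sumr; have := sum_inv_sqr_le n.
  have : 0 <= n%:R^-1 :> R by rewrite invr_ge0.
  by lra.
have := borel_cantelli mF PF K; apply: filterS => w [n0 hn0].
exists (n0 + i0)%N => i hi; have ii : (i0 <= i)%N by lia.
have [il s01 sl hs] := H i ii.
apply: regular_window_of_notlarge => //; first by lia.
apply/negP => hb; apply: (hn0 i); first by lia.
by rewrite /F /Q /= ii.
Qed.

End RegularWindows.

(** * Mean ergodic theorem *)

Section BoundedFunctions.
Variables (R : realType) (d : measure_display) (Y : measurableType d).
Variable mu : probability Y R.
Implicit Types (f g : Y -> R) (A : set Y).

(** For bounded measurable functions integrability is automatic and survives products; integrable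
    functions are reached later by truncation or approximation. *)
Definition bmf f := measurable_fun setT f /\ exists K : R, forall y, `|f y| <= K.

Lemma bmf_cst (c : R) : bmf (fun=> c).
Proof. by split; [exact: measurable_cst|exists `|c|]. Qed.

Lemma bmfD f g : bmf f -> bmf g -> bmf (fun y => f y + g y).
Proof.
move=> [mf [K hK]] [mg [L hL]]; split; first exact: measurable_funD.
by exists (K + L) => y; apply: le_trans (ler_normD _ _) _; apply: lerD.
Qed.

Lemma bmfM f g : bmf f -> bmf g -> bmf (fun y => f y * g y).
Proof.
move=> [mf [K hK]] [mg [L hL]]; split; first exact: measurable_funM.
by exists (K * L) => y; rewrite normrM; apply: ler_pM.
Qed.

Lemma bmfZ (c : R) f : bmf f -> bmf (fun y => c * f y).
Proof. exact/bmfM/bmf_cst. Qed.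

Lemma bmfN f : bmf f -> bmf (fun y => - f y).
Proof. by move=> /(bmfZ (-1)); under [X in bmf X]eq_fun do rewrite mulN1r. Qed.

Lemma bmfB f g : bmf f -> bmf g -> bmf (fun y => f y - g y).
Proof. by move=> bf bg; apply: bmfD => //; exact: bmfN. Qed.

Lemma bmf_max f g : bmf f -> bmf g -> bmf (fun y => Num.max (f y) (g y)).
Proof.
move=> [mf [K hK]] [mg [L hL]]; split; first exact: measurable_maxr.
exists (K + L) => y; have K0 := le_trans (normr_ge0 _) (hK y).
have L0 := le_trans (normr_ge0 _) (hL y).
by case: (leP (f y) (g y)) => _; [apply: le_trans (hL y) _|apply: le_trans (hK y) _]; lra.
Qed.

Lemma bmf_sum (I : Type) (r : seq I) (F : I -> Y -> R) :
  (forall i, bmf (F i)) -> bmf (fun y => \sum_(i <- r) F i y).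
Proof.
move=> h; elim: r => [|i r IH].
  by under [X in bmf X]eq_fun do rewrite big_nil; exact: bmf_cst.
by under [X in bmf X]eq_fun do rewrite big_cons; exact: bmfD.
Qed.

Lemma bmf_indic A : measurable A -> bmf (\1_A : Y -> R).
Proof.
move=> mA; split; first exact: measurable_indic.
by exists 1 => y; rewrite indicE; case: (_ \in _); rewrite ?normr1 ?normr0.
Qed.

Lemma bmf_integrable f : bmf f -> mu.-integrable setT (EFin \o f).
Proof.
move=> [mf [K hK]]; apply: measurable_bounded_integrable => //.
  by rewrite ltey_eq fin_num_measure.
exists K; split => [|M KM y _]; first exact: num_real.
by apply: le_trans (hK y) (ltW _).
Qed.

Definition mean f : R := \int[mu]_y f y.

Lemma meanD f g : bmf f -> bmf g -> mean (fun y => f y + g y) = mean f + mean g.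
Proof. by move=> bf bg; apply: RintegralD => //; exact: bmf_integrable. Qed.

Lemma meanZ (c : R) f : bmf f -> mean (fun y => c * f y) = c * mean f.
Proof. by move=> bf; apply: RintegralZl => //; exact: bmf_integrable. Qed.

Lemma meanB f g : bmf f -> bmf g -> mean (fun y => f y - g y) = mean f - mean g.
Proof. by move=> bf bg; apply: RintegralB => //; exact: bmf_integrable. Qed.

Lemma mean_cst (c : R) : mean (fun=> c) = c.
Proof.
rewrite /mean Rintegral_cst//.
rewrite [LHS](congr1 (fun z => c * fine z) (probability_setT mu)).
exact: mulr1.
Qed.

Lemma mean_le f g : bmf f -> bmf g -> (forall y, f y <= g y) -> mean f <= mean g.
Proof. by move=> bf bg h; apply: le_Rintegral => //; exact: bmf_integrable. Qed.

Lemma mean_ge0 f : (forall y, 0 <= f y) -> 0 <= mean f.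
Proof. by move=> h; apply: Rintegral_ge0. Qed.

Lemma mean_sum (I : Type) (r : seq I) (F : I -> Y -> R) : (forall i, bmf (F i)) ->
  mean (fun y => \sum_(i <- r) F i y) = \sum_(i <- r) mean (F i).
Proof.
move=> h; elim: r => [|i r IH].
  by rewrite big_nil -[RHS]mean_cst; apply: eq_Rintegral => y _; rewrite big_nil.
rewrite big_cons -IH -meanD//; last exact: bmf_sum.
by apply: eq_Rintegral => y _; rewrite big_cons.
Qed.

Definition prob A : R := fine (mu A).

Lemma probE A : measurable A -> mu A = (prob A)%:E.
Proof. by move=> mA; rewrite /prob fineK// fin_num_measure. Qed.

Lemma mean_indic A : measurable A -> mean (\1_A) = prob A.
Proof. by move=> mA; rewrite /mean /Rintegral integral_indic// setIT. Qed.

Lemma prob_ge0 A : 0 <= prob A.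
Proof. by rewrite fine_ge0. Qed.

Lemma prob_le A B : measurable A -> measurable B -> A `<=` B -> prob A <= prob B.
Proof.
by move=> mA mB AB; rewrite -lee_fin -!probE//; apply: le_measure; rewrite ?inE.
Qed.

Lemma measureU_le A B (r1 r2 : R) : measurable A -> measurable B ->
  (mu A <= r1%:E)%E -> (mu B <= r2%:E)%E -> (mu (A `|` B) <= (r1 + r2)%:E)%E.
Proof.
move=> mA mB h1 h2; apply: le_trans; first exact: measureU2.
by rewrite EFinD; exact: leeD.
Qed.

Lemma measurable_gt_level f (t : R) : measurable_fun setT f -> measurable [set y | t < f y].
Proof.
move=> mf; rewrite (_ : [set _ | _] = setT `&` f @^-1` `]t, +oo[%classic).
  by apply: mf => //; exact: measurable_itv.
by rewrite setTI; apply/seteqP; split => y /=; rewrite in_itv /= andbT.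
Qed.

Lemma markov_bmf f (t : R) : bmf f -> (forall y, 0 <= f y) -> 0 < t ->
  prob [set y | t < f y] <= mean f / t.
Proof.
move=> bf f0 t0; have mA := measurable_gt_level t (proj1 bf).
rewrite ler_pdivlMr// mulrC -mean_indic// -meanZ; last exact: bmf_indic.
apply: mean_le => //; first exact/bmfZ/bmf_indic.
move=> y; rewrite indicE; have [|_] := boolP (_ \in _); last by rewrite mulr0.
by rewrite inE /= mulr1 => /ltW.
Qed.

Lemma nondecreasing_bigcup_le (F : nat -> set Y) (K : R) :
  (forall n, measurable (F n)) -> nondecreasing_seq F -> (forall n, prob (F n) <= K) ->
  (mu (\bigcup_n F n) <= K%:E)%E.
Proof.
move=> mF nF hK; have mU : measurable (\bigcup_n F n) by exact: bigcup_measurable.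
have h := nondecreasing_cvg_mu (mu := mu) mF mU nF.
rewrite -(cvg_lim _ h)//; apply: lime_le; first by apply/cvg_ex; eexists; exact: h.
by apply: nearW => n /=; rewrite probE// lee_fin.
Qed.

End BoundedFunctions.

(** * The maximal ergodic theorem *)

Section Invariance.
Variables (R : realType) (d : measure_display) (Y : measurableType d).
Variables (mu : probability Y R) (T : Y -> Y).
Hypothesis mpT : measure_preserving mu T.
Implicit Types (f g : Y -> R).

Lemma bmf_comp f : bmf f -> bmf (fun y => f (T y)).
Proof.
move=> [mf [K hK]]; split; first exact: (measurableT_comp mf (proj1 mpT)).
by exists K.
Qed.

Lemma bmf_iter n f : bmf f -> bmf (fun y => f (iter n T y)).
Proof.
elim: n f => //= n IH f bf; apply: (IH (fun y => f (T y))).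
exact: bmf_comp.
Qed.

Lemma mean_comp f : bmf f -> mean mu (fun y => f (T y)) = mean mu f.
Proof.
move=> bf; have [mT hT] := mpT; rewrite /mean /Rintegral; congr fine.
have mf : measurable_fun setT (EFin \o f) by apply/measurable_EFinP; case: bf.
have := @integral_pushforward _ _ _ _ R T mT mu setT (EFin \o f) mf.
rewrite preimage_setT => /(_ (bmf_integrable _ (bmf_comp bf)) measurableT) <-.
by apply: eq_measure_integral => A mA _; exact: hT.
Qed.

Lemma mean_iter n f : bmf f -> mean mu (fun y => f (iter n T y)) = mean mu f.
Proof.
elim: n f => //= n IH f bf.
by rewrite (IH (fun y => f (T y))) ?mean_comp//; exact: bmf_comp.
Qed.

Definition birkhoff_sum f n y := \sum_(0 <= i < n) f (iter i T y).

Lemma birkhoff_sumS f n y : birkhoff_sum f n.+1 y = f y + birkhoff_sum f n (T y).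
Proof.
rewrite /birkhoff_sum big_nat_recl//; congr (_ + _).
by apply: eq_bigr => i _; rewrite iterSr.
Qed.

Lemma bmf_birkhoff f n : bmf f -> bmf (birkhoff_sum f n).
Proof. by move=> bf; apply: bmf_sum => i; exact: bmf_iter. Qed.

(* The maximum of the Birkhoff sums of length at most n. *)
Fixpoint birkhoff_max g n y : R :=
  if n is n'.+1 then Num.max 0 (g y + birkhoff_max g n' (T y)) else 0.

Lemma bmf_birkhoff_max g n : bmf g -> bmf (birkhoff_max g n).
Proof.
move=> bg; elim: n => [|n IH] /=; first exact: bmf_cst.
apply: bmf_max; first exact: bmf_cst.
by apply: bmfD => //; exact: bmf_comp.
Qed.

Lemma birkhoff_max_ge0 g n y : 0 <= birkhoff_max g n y.
Proof. by case: n => //= n; rewrite le_max lexx. Qed.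

Lemma birkhoff_maxS g n y : birkhoff_max g n y <= birkhoff_max g n.+1 y.
Proof.
elim: n y => [|n IH] y; first exact: birkhoff_max_ge0.
rewrite [leLHS]/= [leRHS]/= ge_max le_max lexx /= le_max; apply/orP; right.
by rewrite lerD2l.
Qed.

Lemma birkhoff_sum_le_max g n k y : (k <= n)%N -> birkhoff_sum g k y <= birkhoff_max g n y.
Proof.
elim: n k y => [|n IH] [|k] y //= kn; first by rewrite /birkhoff_sum big_geq.
  by rewrite /birkhoff_sum big_geq// le_max lexx.
by rewrite birkhoff_sumS le_max; apply/orP; right; rewrite lerD2l IH.
Qed.

(** Where the maximum is positive the empty sum does not attain it, so a first step can be split
    off. *)
Lemma birkhoff_max_gt0 g n y : 0 < birkhoff_max g n y ->
  birkhoff_max g n y <= g y + birkhoff_max g n (T y).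
Proof.
case: n => [|n] h; first by move: h; rewrite /= ltxx.
apply: (@le_trans _ _ (g y + birkhoff_max g n (T y))); last first.
  by rewrite lerD2l; exact: birkhoff_maxS.
move: h; rewrite /= lt_max ltxx /= => h.
by rewrite ge_max lexx ltW.
Qed.

(** With [M] the maximum of the Birkhoff sums, [M - M o T] has mean 0, is at most [g] where [M > 0],
    and is at most 0 elsewhere. *)
Lemma garsia g n : bmf g ->
  0 <= mean mu (fun y => g y * \1_[set y | 0 < birkhoff_max g n y] y).
Proof.
move=> bg; pose M := birkhoff_max g n; have bM : bmf M by exact: bmf_birkhoff_max.
have mE : measurable [set y | 0 < M y] by apply: measurable_gt_level; case: bM.
have h0 : mean mu (fun y => M y - M (T y)) = 0.
  by rewrite meanB ?(mean_comp bM) ?subrr//; exact: (bmf_comp bM).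
rewrite -[leLHS]h0; apply: mean_le.
- by apply: bmfB => //; exact: (bmf_comp bM).
- exact: (bmfM bg (bmf_indic R mE)).
move=> y; rewrite indicE; have [|hy] := boolP (y \in _).
  by rewrite inE /= mulr1 lerBlDr => /birkhoff_max_gt0.
have My : M y = 0.
  apply/eqP; rewrite eq_le birkhoff_max_ge0 andbT leNgt; apply/negP => h.
  by move/negP: hy; apply; rewrite inE.
by rewrite My sub0r mulr0 oppr_le0 birkhoff_max_ge0.
Qed.

(** Garsia's inequality for [f - t], whose Birkhoff sums are positive exactly when those of [f]
    exceed [t k]. *)
Lemma maximal_ergodic f (t : R) : bmf f -> (forall y, 0 <= f y) -> 0 < t ->
  exists U, [/\ measurable U, (mu U <= (mean mu f / t)%:E)%E &
    forall y, ~ U y -> forall k, birkhoff_sum f k y <= t * k%:R].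
Proof.
move=> bf f0 t0; pose g y := f y - t.
have bg : bmf g by apply: bmfB => //; exact: bmf_cst.
pose F n := [set y | 0 < birkhoff_max g n y].
have mF n : measurable (F n).
  by apply: measurable_gt_level; case: (bmf_birkhoff_max n bg).
exists (\bigcup_n F n); split; first exact: bigcup_measurable.
  apply: nondecreasing_bigcup_le => //.
    apply/nondecreasing_seqP => n; apply/subsetPset => y /=.
    by rewrite /F /= => /lt_le_trans; apply; exact: birkhoff_maxS.
  move=> n; have bF : bmf (\1_(F n) : Y -> R) by exact: bmf_indic.
  rewrite ler_pdivlMr// mulrC -mean_indic// -meanZ// -subr_ge0.
  apply: le_trans (garsia n bg) _; rewrite -meanB//; last exact: bmfZ.
  apply: mean_le => [| |y]; [exact: bmfM|by apply: bmfB => //; exact: bmfZ|].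
  rewrite /g mulrBl lerD2r indicE.
  by case: (_ \in _); rewrite ?mulr1// mulr0.
move=> y nU k; rewrite leNgt; apply/negP => h; apply: nU; exists k => //.
rewrite /F /=; apply: lt_le_trans (birkhoff_sum_le_max g y (leqnn k)).
have -> : birkhoff_sum g k y = birkhoff_sum f k y - t * k%:R.
  by rewrite /birkhoff_sum sumrB sumr_const_nat subn0 mulr_natr.
by rewrite subr_gt0.
Qed.

End Invariance.

(** * Upper limits of time means *)

Section Birkhoff.
Variables (R : realType) (d : measure_display) (Y : measurableType d).
Variables (mu : probability Y R) (T : Y -> Y).
Hypothesis mpT : measure_preserving mu T.
Implicit Types (f g : Y -> R).

Lemma bounded_seq (u : nat -> R) (K : R) : (forall n, `|u n| <= K) -> bounded_fun (u : nat -> R^o).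
Proof.
move=> h; exists K; split => [|M KM n _]; first exact: num_real.
by apply: le_trans (h n) (ltW _).
Qed.

Lemma limn_sup_ub (u : nat -> R) (K e : R) : (forall n, `|u n| <= K) -> 0 < e ->
  exists N, forall n, (N <= n)%N -> u n < limn_sup u + e.
Proof.
move=> hK e0; have bu := bounded_seq hK.
rewrite (limn_supE bu).
have hi : has_inf (range (sups (u : nat -> R^o))).
  by split; [exists (sups u 0%N); exists 0%N|exact: bounded_fun_has_lbound_sups].
have [_ [N _ <-] hN] := inf_adherent e0 hi.
exists N => n Nn; apply: le_lt_trans hN.
apply: ub_le_sup; last by exists n.
exact/has_ubound_sdrop/bounded_fun_has_ubound.
Qed.

Lemma limn_sup_lb (u : nat -> R) (K e : R) N : (forall n, `|u n| <= K) -> 0 < e ->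
  exists2 n, (N <= n)%N & limn_sup u - e < u n.
Proof.
move=> hK e0; have bu := bounded_seq hK.
rewrite (limn_supE bu).
have hs : has_sup (sdrop (u : nat -> R^o) N).
  split; first by exists (u N); exists N => /=.
  exact/has_ubound_sdrop/bounded_fun_has_ubound.
have [_ [n Nn <-] hn] := sup_adherent e0 hs.
exists n => //; apply: le_lt_trans hn; rewrite lerD2r.
apply: ge_inf; first exact: bounded_fun_has_lbound_sups.
by exists N.
Qed.

Lemma limn_sup_le (u v : nat -> R) (K : R) :
  (forall n, `|u n| <= K) -> (forall n, `|v n| <= K) ->
  (forall e, 0 < e -> exists N, forall n, (N <= n)%N -> u n <= v n + e) ->
  limn_sup u <= limn_sup v.
Proof.
move=> hu hv h; rewrite leNgt; apply/negP => lt.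
pose e := (limn_sup u - limn_sup v) / 4.
have e0 : 0 < e by rewrite divr_gt0// subr_gt0.
have [N1 h1] := h e e0; have [N2 h2] := limn_sup_ub hv e0.
have [n nN h3] := limn_sup_lb (N1 + N2) hu e0.
have := h1 n ltac:(lia); have := h2 n ltac:(lia); rewrite /e in e0 h3 *; lra.
Qed.

Definition time_mean f n y : R := n.+1%:R^-1 * birkhoff_sum T f n.+1 y.

Lemma bmf_time_mean f n : bmf f -> bmf (time_mean f n).
Proof. by move=> bf; apply: bmfZ; exact: (bmf_birkhoff mpT). Qed.

Lemma time_mean_le f (K : R) n y : (forall y, `|f y| <= K) -> `|time_mean f n y| <= K.
Proof.
move=> hK; rewrite /time_mean normrM ger0_norm ?invr_ge0// mulrC ler_pdivrMr ?ltr0n//.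
apply: le_trans (ler_norm_sum _ _ _) _.
apply: (@le_trans _ _ (\sum_(0 <= i < n.+1) K)); first by apply: ler_sum => i _; exact: hK.
by rewrite sumr_const_nat subn0 mulr_natr.
Qed.

Lemma time_meanT f (K : R) n y : (forall y, `|f y| <= K) ->
  `|time_mean f n (T y) - time_mean f n y| <= 2 * K / n.+1%:R.
Proof.
move=> hK; rewrite /time_mean -mulrBr normrM ger0_norm ?invr_ge0// mulrC.
apply: ler_wpM2r; first by rewrite invr_ge0.
have -> : birkhoff_sum T f n.+1 (T y) - birkhoff_sum T f n.+1 y =
    f (iter n.+1 T y) - f y.
  have := birkhoff_sumS T f n.+1 y; rewrite {1}/birkhoff_sum big_nat_recr//= -/(birkhoff_sum T f n.+1 y).
  lra.
by apply: le_trans (ler_normB _ _) _; rewrite mulr2n mulrDl mul1r lerD.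
Qed.

(** As an upper limit it is defined and invariant at every point, so no null set has to be followed
    along orbits. *)
Definition upper_mean f y : R := limn_sup (fun n => time_mean f n y).

Lemma upper_mean_le f (K : R) y : (forall y, `|f y| <= K) -> `|upper_mean f y| <= K.
Proof.
move=> hK; have h n := time_mean_le n y hK.
rewrite ler_norml; apply/andP; split; apply/ler_addgt0Pr => e e0.
  have [N hN] := limn_sup_ub h e0; apply: ltW; apply: le_lt_trans (hN N (leqnn _)).
  by have := h N; rewrite ler_norml => /andP[].
have [n _ hn] := limn_sup_lb 0 h e0; rewrite -lerBlDr; apply: ltW; apply: lt_le_trans hn _.
by have := h n; rewrite ler_norml => /andP[].
Qed.

Lemma bmf_upper_mean f : bmf f -> bmf (upper_mean f).
Proof.
move=> bf; have [mf [K hK]] := bf; split; last by exists K => y; exact: upper_mean_le.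
have h y : bounded_fun (time_mean f ^~ y : nat -> R^o).
  by apply: (@bounded_seq _ K) => n; exact: time_mean_le.
apply: measurable_fun_limn_sup => [y _|y _|n].
- exact: bounded_fun_has_ubound.
- exact: bounded_fun_has_lbound.
- by have [] := bmf_time_mean n bf.
Qed.

Lemma upper_mean_inv f y : bmf f -> upper_mean f (T y) = upper_mean f y.
Proof.
move=> [mf [K hK]].
have key (e : R) : 0 < e -> exists N, forall n, (N <= n)%N ->
    `|time_mean f n (T y) - time_mean f n y| <= e.
  move=> e0; have [N hN] : exists N : nat, 2 * K / e < N%:R.
    by exists (Num.truncn (2 * K / e)).+1; exact: truncnS_gt.
  exists N => n Nn; apply: le_trans (time_meanT n y hK) _.
  rewrite ler_pdivrMr ?ltr0n// [leRHS]mulrC -ler_pdivrMr//; apply: ltW; apply: lt_le_trans hN _.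
  by rewrite ler_nat leqW.
apply/eqP; rewrite eq_le; apply/andP; split; apply: (@limn_sup_le _ _ K) => [n|n|e /key[N hN]];
  try exact: time_mean_le; exists N => n /hN; rewrite ler_norml => /andP[]; lra.
Qed.

(** For [g = f - upper_mean f + e] every point has a positive Birkhoff sum, since the subtracted
    function is invariant. The sets [E n] therefore exhaust the space, and Garsia's inequality on
    them gives [mean g >= 0] in the limit. *)
Lemma upper_mean_ge f : bmf f -> mean mu (upper_mean f) <= mean mu f.
Proof.
move=> bf; have bs := bmf_upper_mean bf; have [mf [K hK]] := bf.
apply/ler_addgt0Pr => e e0.
pose g y := f y - upper_mean f y + e.
have bg : bmf g by apply: bmfD; [exact: bmfB|exact: bmf_cst].
pose E n := [set y | 0 < birkhoff_max T g n y].
have mE n : measurable (E n).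
  by apply: measurable_gt_level; case: (bmf_birkhoff_max mpT n bg).
have [mg [L hL]] := bg.
have L0 : 0 <= L by apply: le_trans (hL point).
have UE : \bigcup_n E n = setT.
  apply/seteqP; split => // y _.
  have [n _ hn] := limn_sup_lb 0 (fun n => time_mean_le n y hK) e0.
  exists n.+1 => //; rewrite /E /=.
  apply: (lt_le_trans _ (birkhoff_sum_le_max T g y (leqnn n.+1))).
  have -> : birkhoff_sum T g n.+1 y =
      n.+1%:R * (time_mean f n y - upper_mean f y + e).
    rewrite /time_mean mulrDr mulrBr mulrA mulfV ?pnatr_eq0// mul1r.
    rewrite /birkhoff_sum big_split /= sumrB sumr_const_nat subn0 mulr_natl.
    rewrite [X in _ - X + _](eq_bigr (fun=> upper_mean f y)); last first.
      by move=> i _; elim: i => //= i IH; rewrite upper_mean_inv.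
    by rewrite sumr_const_nat subn0 mulr_natl.
  by rewrite mulr_gt0 ?ltr0n//; move: hn; rewrite /upper_mean; lra.
suff : 0 <= mean mu g.
  rewrite meanD; [|exact: bmfB|exact: bmf_cst].
  by rewrite meanB// mean_cst; lra.
apply/ler_addgt0Pr => r r0; rewrite -lerBlDr sub0r.
have cv : prob mu (E n) @[n --> \oo] --> (1 : R).
  have := nondecreasing_cvg_mu (mu := mu) mE (bigcup_measurable (fun k _ => mE k)).
  rewrite UE => h; have e1 : (1%:E : \bar R) = mu setT := esym (probability_setT mu).
  apply: (@fine_cvg R _ _ _ (fun n => mu (E n)) 1).
  rewrite e1; apply: h; apply/nondecreasing_seqP => n; apply/subsetPset => y /=.
  by rewrite /E /= => /lt_le_trans; apply; exact: birkhoff_maxS.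
have Lr : 0 < r / (L + 1) by rewrite divr_gt0// ltr_wpDl.
have /cvgrPdist_lt/(_ _ Lr)[N _ /(_ N (leqnn _)) hN] := cv.
have b1 := bmf_indic R (mE N).
(* Outside [E N] the bound [g >= - L] costs at most [r], because [E N] has nearly full measure. *)
apply: (@le_trans _ _ (mean mu (fun y => g y * \1_(E N) y - L * (1 - \1_(E N) y)))).
  rewrite meanB; [|exact: bmfM|by apply: bmfZ; apply: bmfB => //; exact: bmf_cst].
  rewrite meanZ; last by apply: bmfB => //; exact: bmf_cst.
  rewrite meanB//; last exact: bmf_cst.
  rewrite mean_cst mean_indic//.
  have := garsia mpT N bg; rewrite -/(E N).
  have : L * (1 - prob mu (E N)) <= r.
    have h1 : 1 - prob mu (E N) <= r / (L + 1).
      by apply: le_trans (ltW hN); exact: ler_norm.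
    apply: le_trans (ler_wpM2l L0 h1) _.
    rewrite mulrA ler_pdivrMr ?ltr_wpDl// mulrC ler_pM2l// lerDl.
    exact: ler01.
  by lra.
apply: mean_le => // [|y].
  by apply: bmfB; [exact: bmfM|apply: bmfZ; apply: bmfB => //; exact: bmf_cst].
rewrite indicE; case: (_ \in _); first by rewrite subrr mulr0 subr0 mulr1.
rewrite mulr0 subr0 mulr1 sub0r lerNl; apply: le_trans (hL y).
by rewrite -normrN ler_norm.
Qed.

End Birkhoff.

Section BirkhoffL1.
Variables (R : realType) (d : measure_display) (Y : measurableType d).
Variables (mu : probability Y R) (T : Y -> Y).
Hypothesis mpT : measure_preserving mu T.
Implicit Types (f g : Y -> R).

Lemma time_meanN f n y : time_mean T (fun y => - f y) n y = - time_mean T f n y.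
Proof. by rewrite /time_mean /birkhoff_sum sumrN mulrN. Qed.

(** The upper minus the lower mean is nonnegative, and its integral is at most [mean f - mean f] by
    [upper_mean_ge] for [f] and [- f]. *)
Lemma ae_upper_eq_lower f : bmf f ->
  {ae mu, forall y, upper_mean T f y = - upper_mean T (fun y => - f y) y}.
Proof.
move=> bf; have bN := bmfN bf.
have bu := bmf_upper_mean mpT bf; have bl := bmf_upper_mean mpT bN.
pose D y := upper_mean T f y + upper_mean T (fun y => - f y) y.
have [mf [K hK]] := bf; have hNK y : `|- f y| <= K by rewrite normrN.
have D0 y : 0 <= D y.
  apply/ler_addgt0Pr => e e0; have e2 : 0 < e / 2 by rewrite divr_gt0.
  have [N1 h1] := limn_sup_ub (fun n => time_mean_le T n y hK) e2.
  have [N2 h2] := limn_sup_ub (fun n => time_mean_le T n y hNK) e2.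
  have := h1 (N1 + N2)%N ltac:(lia); have := h2 (N1 + N2)%N ltac:(lia).
  rewrite time_meanN /D /upper_mean; lra.
have bD : bmf D by exact: bmfD.
have mD : mean mu D = 0.
  apply/eqP; rewrite eq_le mean_ge0// andbT meanD//.
  have := upper_mean_ge mpT bf; have := upper_mean_ge mpT bN.
  have -> : mean mu (fun y => - f y) = - mean mu f.
    rewrite -[RHS]mulN1r -meanZ//; apply: eq_Rintegral => y _; by rewrite mulN1r.
  by lra.
have mDE : measurable_fun setT (EFin \o D) by apply/measurable_EFinP; case: bD.
have h0 : (\int[mu]_y `|(EFin \o D) y| = 0)%E.
  under eq_integral do rewrite gee0_abs ?lee_fin//.
  have := bmf_integrable mu bD => iD.
  rewrite -[LHS]fineK; first by rewrite [fine _]mD.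
  exact: integrable_fin_num.
have /(ae_eq_integral_abs mu measurableT mDE) := h0.
apply: filterS => y /(_ I) /= [] /eqP; rewrite addr_eq0 => /eqP; exact.
Qed.

Lemma mean_ergodic f : bmf f -> exists fs, [/\ bmf fs, forall y, fs (T y) = fs y &
  forall e, 0 < e -> exists n, mean mu (fun y => `|time_mean T f n y - fs y|) <= e].
Proof.
move=> bf; exists (upper_mean T f); have bu := bmf_upper_mean mpT bf.
split => //; first by move=> y; exact: upper_mean_inv.
have [mf [K hK]] := bf; have hNK y : `|- f y| <= K by rewrite normrN.
have m1 n : measurable_fun setT (EFin \o time_mean T f n).
  by apply/measurable_EFinP; case: (bmf_time_mean mpT n bf).
have m2 : measurable_fun setT (EFin \o upper_mean T f).
  by apply/measurable_EFinP; case: bu.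
have cv : {ae mu, forall y, setT y ->
    (EFin \o time_mean T f n) y @[n --> \oo] --> (EFin \o upper_mean T f) y}.
  have := ae_upper_eq_lower bf; apply: filterS => y E _.
  apply: cvg_EFin; first by near=> n.
  apply/cvgrPdist_lt => e e0.
  have [N1 h1] := limn_sup_ub (fun n => time_mean_le T n y hK) e0.
  have [N2 h2] := limn_sup_ub (fun n => time_mean_le T n y hNK) e0.
  exists (N1 + N2)%N => // n /= hn.
  have := h1 n ltac:(lia); have := h2 n ltac:(lia).
  rewrite time_meanN -/(upper_mean T f y) -/(upper_mean T (fun y => - f y) y) => a1 a2.
  by rewrite distrC ltr_norml /comp /=; apply/andP; split; lra.
have [||_ + _] := @dominated_convergence _ Y R mu setT measurableT
   (fun n => EFin \o time_mean T f n) (EFin \o upper_mean T f) (fun=> K%:E) m1 m2 cv.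
- by apply: (bmf_integrable mu (bmf_cst _ K)).
- by apply: aeW => y n _; rewrite lee_fin; exact: time_mean_le.
move=> /fine_cvgP[_ /cvgrPdist_lt h] e /h[N _ /(_ N (leqnn _))].
rewrite sub0r normrN /= => hN; exists N; apply: le_trans (ltW hN).
exact: ler_norm.
Unshelve. all: by end_near. Qed.

End BirkhoffL1.

(** * Weak type maximal inequality *)

Section WeakType.
Variables (R : realType) (d : measure_display) (Y : measurableType d).
Variables (mu : probability Y R) (T : Y -> Y).
Hypothesis mpT : measure_preserving mu T.
Implicit Types (f F : Y -> R) (c : nat -> R).

Definition win_sum c F m l y : R := \sum_(m.+1 <= k < (m + l).+1) c k * F (iter k T y).

Definition autocorr F g : R := mean mu (fun y => F y * F (iter g T y)).

Lemma bmf_win_sum c F m l : bmf F -> bmf (win_sum c F m l).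
Proof. by move=> bF; apply: bmf_sum => k; apply: bmfZ; exact: (bmf_iter mpT). Qed.

Lemma mean_iter2 F k n : bmf F -> (k <= n)%N ->
  mean mu (fun y => F (iter k T y) * F (iter n T y)) = autocorr F (n - k).
Proof.
move=> bF kn; rewrite -[RHS](mean_iter mpT k); last by apply: bmfM => //; exact: (bmf_iter mpT).
by apply: eq_Rintegral => y _; rewrite -iterD subnK.
Qed.

(** By invariance of [mu] the correlation of two iterates depends only on their distance, so the
    weights enter through their squares and lag sums alone. This is how bounds on the random weights
    serve all systems. The induction appends the last point of the window. *)
Lemma mean_win_sum_sqr c F m l : bmf F ->
  mean mu (fun y => win_sum c F m l y ^+ 2) =
  (\sum_(m.+1 <= k < (m + l).+1) c k ^+ 2) * autocorr F 0 +
  2 * \sum_(1 <= g < l) lag_sum c m l g * autocorr F g.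
Proof.
move=> bF; elim: l => [|l IH].
  rewrite addn0 [\sum_(1 <= _ < 0) _]big_geq// big_geq// mul0r mulr0 addr0.
  rewrite -[RHS](mean_cst mu); apply: eq_Rintegral => y _.
  by rewrite /win_sum addn0 big_geq// expr0n.
have bS := bmf_win_sum c m l bF.
pose n := (m + l).+1; have bn : bmf (fun y => F (iter n T y)) by exact: (bmf_iter mpT).
have -> : mean mu (fun y => win_sum c F m l.+1 y ^+ 2) =
    mean mu (fun y => win_sum c F m l y ^+ 2 +
      (c n ^+ 2 * (F (iter n T y) * F (iter n T y)) +
      2 * c n * \sum_(m.+1 <= k < n) c k * (F (iter k T y) * F (iter n T y)))).
  apply: eq_Rintegral => y _; rewrite /win_sum addnS big_nat_recr ?ltnS ?leq_addr//= -/n.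
  set S := \sum_(_ <= _ < _) _.
  have -> : \sum_(m.+1 <= k < n) c k * (F (iter k T y) * F (iter n T y)) =
      S * F (iter n T y).
    by rewrite mulr_suml; apply: eq_bigr => k _; rewrite mulrA.
  ring.
have bcross k : bmf (fun y => c k * (F (iter k T y) * F (iter n T y))).
  by apply: bmfZ; apply: bmfM => //; exact: (bmf_iter mpT).
rewrite meanD; [|by under [X in bmf X]eq_fun do rewrite expr2; exact: bmfM|]; last first.
  by apply: bmfD; apply: bmfZ; [exact: bmfM|exact: bmf_sum].
rewrite {}IH meanD; [|by apply: bmfZ; exact: bmfM|by apply: bmfZ; exact: bmf_sum].
rewrite meanZ; last exact: bmfM.
rewrite (mean_iter2 bF (leqnn n)) subnn meanZ; last exact: bmf_sum.
rewrite mean_sum//.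
have -> : \sum_(m.+1 <= k < n) mean mu (fun y => c k * (F (iter k T y) * F (iter n T y))) =
    \sum_(m.+1 <= k < n) c k * autocorr F (n - k).
  apply: eq_big_nat => k /andP[mk kn]; rewrite meanZ; last by apply: bmfM => //; exact: (bmf_iter mpT).
  by rewrite mean_iter2// ltnW.
have -> : \sum_(1 <= g < l.+1) lag_sum c m l.+1 g * autocorr F g =
    \sum_(1 <= g < l) lag_sum c m l g * autocorr F g +
    c n * \sum_(m.+1 <= k < n) c k * autocorr F (n - k).
  rewrite (_ : \sum_(m.+1 <= k < n) _ = \sum_(1 <= g < l.+1) c (n - g)%N * autocorr F g).
    rewrite (_ : \sum_(1 <= g < l) _ = \sum_(1 <= g < l.+1) lag_sum c m l g * autocorr F g).
      rewrite mulr_sumr -big_split /=; apply: eq_big_nat => g /andP[g0 gl].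
      rewrite [in LHS]/lag_sum addnS big_nat_recr/=; last by lia.
      by rewrite -/(lag_sum c m l g) -/n; ring.
    case: (posnP l) => [->|l0]; first by rewrite !big_geq.
    have e : lag_sum c m l l = 0 by rewrite /lag_sum big_geq.
    by rewrite [RHS]big_nat_recr//= e mul0r addr0.
  rewrite (_ : \sum_(m.+1 <= k < n) _ = \sum_(1 + m <= k < l.+1 + m) c k * autocorr F (n - k)).
    rewrite big_addn addnK big_nat_rev /=.
    apply: eq_big_nat => g /andP[g0 gl]; rewrite add1n subSS.
    have e1 : (l.+1 - g + m = n - g)%N by rewrite /n; clear -g0 gl; lia.
    have e2 : (n - (n - g) = g)%N by rewrite /n; clear -g0 gl; lia.
    by rewrite e1 e2.
  by rewrite add1n /n addSn addnC.
have -> : \sum_(m.+1 <= k < (m + l.+1).+1) c k ^+ 2 =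
    \sum_(m.+1 <= k < (m + l).+1) c k ^+ 2 + c n ^+ 2.
  by rewrite addnS big_nat_recr//= ltnS leq_addr.
by ring.
Qed.

Lemma geometric_low (q v : R) J : 1 < q -> 0 <= v ->
  \sum_(0 <= j < J) (if q ^+ j < v then q ^+ j else 0) <= v * (q / (q - 1)).
Proof.
move=> q1 v0; have q10 : 0 < q - 1 by rewrite subr_gt0.
rewrite mulrA ler_pdivlMr// mulr_suml.
(* The term [q^j (q - 1)] is the increment of the powers; the minimum stops the telescoping after
   the last power below [v]. *)
apply: (@le_trans _ _ (Num.min (v * q) (q ^+ J) - Num.min (v * q) 1)); last first.
  apply: (@le_trans _ _ (Num.min (v * q) (q ^+ J))).
    by rewrite gerBl le_min ler01 andbT mulr_ge0//; lra.
  by rewrite ge_min lexx.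
elim: J => [|J IH]; first by rewrite big_geq// expr0 subrr.
rewrite big_nat_recr//=; apply: le_trans (lerD IH (lexx _)) _.
rewrite addrAC lerD2r; have qJ : 0 < q ^+ J by rewrite exprn_gt0//; lra.
case: ifPn => [h|_]; last first.
  rewrite mul0r addr0 le_min ge_min lexx /= ge_min; apply/orP; right.
  by rewrite exprS ler_peMl// ltW.
have h1 : q ^+ J.+1 <= v * q by rewrite exprS mulrC ler_pM2r ?ltW//; lra.
rewrite (min_idPr h1) (_ : Num.min _ _ = q ^+ J); last first.
  by apply/min_idPr; apply: le_trans h1; rewrite exprS ler_peMl// ltW.
by rewrite exprS; lra.
Qed.

Lemma geometric_high (q v : R) J : 1 < q -> 0 < v ->
  \sum_(0 <= j < J) (if v <= q ^+ j then (q ^+ j)^-1 else 0) <= v^-1 * (q / (q - 1)).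
Proof.
move=> q1 v0; have q10 : 0 < q - 1 by rewrite subr_gt0.
have q0 : 0 < q by lra.
rewrite mulrA ler_pdivlMr// mulr_suml -ler_pdivrMr// mulr_suml.
apply: (@le_trans _ _ (Num.min v^-1 1 - Num.min v^-1 (q ^+ J)^-1)); last first.
  apply: (@le_trans _ _ (Num.min v^-1 1)); last by rewrite ge_min lexx.
  by rewrite gerBl le_min !invr_ge0 (ltW v0) exprn_ge0// ltW.
elim: J => [|J IH]; first by rewrite big_geq// expr0 invr1 subrr.
rewrite big_nat_recr//=; apply: le_trans (lerD IH (lexx _)) _.
have qJ : 0 < q ^+ J by rewrite exprn_gt0.
have le1 : (q ^+ J.+1)^-1 <= (q ^+ J)^-1.
  by rewrite lef_pV2 ?posrE ?exprn_gt0// exprS ler_peMl// ltW.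
case: ifPn => [h|_]; last first.
  rewrite !mul0r addr0 lerD2l lerN2 le_min ge_min lexx /= ge_min.
  by apply/orP; right.
have h1 : (q ^+ J)^-1 <= v^-1 by rewrite lef_pV2 ?posrE.
rewrite (min_idPr h1) (min_idPr (le_trans le1 h1)).
have -> : (q ^+ J)^-1 * (q - 1) / q = (q ^+ J)^-1 - (q ^+ J.+1)^-1.
  by rewrite exprS; field; rewrite !gt_eqF.
by lra.
Qed.

(** * Truncation at height proportional to the expected count *)

Section Dyadic.
Variables (x : nat -> bool) (sg : nat -> R) (q : R) (rho : nat -> R) (Krho : R) (j0 : nat).
Hypothesis q1 : 1 < q.
Let L j := (2 ^ j)%N.
(** With [q ^+ j] the scale of the number of successes in the window, [s j] is the scale of the
    success probability. *)
Let s j : R := q ^+ j / (L j)%:R.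
Hypothesis sg_le : forall j k, (L j < k <= L j + L j)%N -> 0 <= sg k <= s j.
Hypothesis s_le1 : forall j, s j <= 1.
Hypothesis rho0 : forall j, 0 <= rho j.
Hypothesis rho_sum : forall J, \sum_(0 <= j < J) rho j <= Krho.
Hypothesis count_le : forall j, (j0 <= j)%N -> win_count R x (L j) (L j) <= 2 * q ^+ j.
Let c k : R := (x k)%:R - sg k.
Hypothesis lag_le : forall j g, (j0 <= j)%N -> (0 < g < L j)%N ->
  `|lag_sum c (L j) (L j) g| <= rho j * (q ^+ j) ^+ 2 / (L j)%:R.

Let Lgt0 j : 0 < (L j)%:R :> R. Proof. by rewrite ltr0n expn_gt0. Qed.
Let w_gt0 j : 0 < q ^+ j. Proof. by rewrite exprn_gt0// (lt_trans ltr01 q1). Qed.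
Let wE j : q ^+ j = (L j)%:R * s j.
Proof. by rewrite /s mulrC divfK// gt_eqF. Qed.
Let s_gt0 j : 0 < s j. Proof. by rewrite divr_gt0. Qed.

Lemma sum_centered_sqr j : (j0 <= j)%N ->
  \sum_((L j).+1 <= k < (L j + L j).+1) c k ^+ 2 <= 3 * q ^+ j.
Proof.
move=> jj.
apply: (@le_trans _ _ (\sum_((L j).+1 <= k < (L j + L j).+1) ((x k)%:R + s j))).
  apply: ler_sum_nat => k hk; have /andP[h1 h2] := sg_le (j := j) (k := k) hk.
  by have h3 := s_le1 j; rewrite /c; case: (x k) => /=; nra.
rewrite big_split /= sumr_const_nat subSS addKn -[X in _ + X]mulr_natl -wE.
have := count_le jj; rewrite /win_count; lra.
Qed.

Variables (f : Y -> R) (t : R).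
Hypotheses (bf : bmf f) (f0 : forall y, 0 <= f y) (t0 : 0 < t).

(* The truncation controls both terms of the expanded square: the height bound makes
   the diagonal summable over j, the bound on Birkhoff sums the autocorrelations. *)
Let A j := [set y | f y <= t * q ^+ j] `&` [set y | birkhoff_sum T f (L j) y <= t * (L j)%:R].
Let F j y := f y * \1_(A j) y.

Let mA j : measurable (A j).
Proof.
have le_level g (r : R) : bmf g -> measurable [set y | g y <= r].
  move=> [mg _]; rewrite (_ : [set _ | _] = ~` [set y | r < g y]).
    by apply: measurableC; exact: measurable_gt_level.
  by apply/seteqP; split => y /=; [move=> h; apply/negP; rewrite -leNgt|move/negP; rewrite -leNgt].
by apply: measurableI; apply: le_level => //; exact: (bmf_birkhoff mpT).
Qed.

Let bF j : bmf (F j). Proof. by apply: bmfM => //; exact: bmf_indic. Qed.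
Let F0 j y : 0 <= F j y.
Proof. by rewrite mulr_ge0// indicE ler0n. Qed.
Let Ff j y : F j y <= f y.
Proof. by rewrite /F indicE; case: (_ \in _); rewrite ?mulr1// mulr0. Qed.

(** The second truncation bounds the forward sum of [F j] by [t L j] wherever [F j] does not
    vanish. *)
Lemma sum_autocorr j : \sum_(1 <= g < L j) autocorr (F j) g <= t * (L j)%:R * mean mu f.
Proof.
rewrite /autocorr -mean_sum; last by move=> g; apply: bmfM => //; exact: (bmf_iter mpT).
rewrite -meanZ//; apply: mean_le; last 1 first.
- move=> y; rewrite -mulr_sumr.
  have [Ay|nA] := boolP (y \in A j); last by rewrite /F indicE (negbTE nA) mulr0 mul0r !mulr_ge0// ltW.
  rewrite mulrC; apply: ler_pM => //; first by apply: sumr_ge0.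
  move: Ay; rewrite inE => -[_ /=]; apply: le_trans.
  rewrite /birkhoff_sum [leRHS](big_cat_nat (n := 1))//=; last by rewrite expn_gt0.
  by rewrite ler_wpDl ?sumr_ge0//; apply: ler_sum => g _; exact: Ff.
- by apply: bmf_sum => g; apply: bmfM => //; exact: (bmf_iter mpT).
- exact: bmfZ.
Qed.

Lemma mean_win_sum_le j : (j0 <= j)%N ->
  mean mu (fun y => win_sum c (F j) (L j) (L j) y ^+ 2) <=
  3 * q ^+ j * mean mu (fun y => F j y ^+ 2) + 2 * rho j * (q ^+ j) ^+ 2 * t * mean mu f.
Proof.
move=> jj; rewrite mean_win_sum_sqr//; apply: lerD.
  rewrite (_ : autocorr _ _ = mean mu (fun y => F j y ^+ 2)); last first.
    by apply: eq_Rintegral => y _; rewrite expr2.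
  apply: ler_wpM2r; last exact: sum_centered_sqr.
  by apply: mean_ge0 => y; exact: sqr_ge0.
apply: (@le_trans _ _ (2 * \sum_(1 <= g < L j)
    (rho j * (q ^+ j) ^+ 2 / (L j)%:R) * autocorr (F j) g)).
  apply: ler_wpM2l => //; apply: ler_sum_nat => g hg; apply: ler_wpM2r.
    by apply: mean_ge0 => y; rewrite mulr_ge0.
  by apply: le_trans (ler_norm _) _; exact: lag_le.
rewrite -mulr_sumr; have h := sum_autocorr j.
have r0 : 0 <= rho j * (q ^+ j) ^+ 2 / (L j)%:R.
  by rewrite divr_ge0// mulr_ge0// sqr_ge0.
have := ler_wpM2l r0 h.
have -> : rho j * (q ^+ j) ^+ 2 / (L j)%:R * (t * (L j)%:R * mean mu f) =
   rho j * (q ^+ j) ^+ 2 * t * mean mu f by field; rewrite gt_eqF.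
by lra.
Qed.

Let B j := [set y | t * q ^+ j < f y].

Let mB j : measurable (B j). Proof. by apply: measurable_gt_level; case: bf. Qed.

(** The sum counts the successes of the window at which the orbit is in [B j], so exceeding 1/2
    means that there is one. *)
Let V j := [set y | 1 / 2 < win_sum (fun k => (x k)%:R) (\1_(B j)) (L j) (L j) y].
Let Z j := [set y | (t * q ^+ j) ^+ 2 < win_sum c (F j) (L j) (L j) y ^+ 2].

Let bV j : bmf (win_sum (fun k => (x k)%:R) (\1_(B j)) (L j) (L j)).
Proof. by apply: bmf_win_sum; exact: bmf_indic. Qed.

Let bZ j : bmf (fun y => win_sum c (F j) (L j) (L j) y ^+ 2).
Proof.
by under [X in bmf X]eq_fun do rewrite expr2; apply: bmfM; exact: bmf_win_sum.
Qed.

Let mV j : measurable (V j). Proof. by apply: measurable_gt_level; case: (bV j). Qed.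
Let mZ j : measurable (Z j). Proof. by apply: measurable_gt_level; case: (bZ j). Qed.

Lemma prob_V j : (j0 <= j)%N -> prob mu (V j) <= 4 * q ^+ j * prob mu (B j).
Proof.
move=> jj; have half0 : 0 < 1 / 2 :> R by rewrite divr_gt0.
apply: le_trans (@markov_bmf _ _ _ mu _ (1 / 2) (bV j) _ half0) _.
  by move=> y; apply: sumr_ge0 => k _; rewrite mulr_ge0// indicE ler0n.
rewrite ler_pdivrMr// /win_sum mean_sum; last first.
  by move=> k; apply: bmfZ; apply: (bmf_iter mpT); exact: bmf_indic.
rewrite (eq_bigr (fun k => (x k)%:R * prob mu (B j))); last first.
  move=> k _; rewrite meanZ; last by apply: (bmf_iter mpT); exact: bmf_indic.
  by rewrite (mean_iter mpT); [rewrite mean_indic|exact: bmf_indic].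
rewrite -mulr_suml; have := ler_wpM2r (prob_ge0 mu (B j)) (count_le jj).
by rewrite /win_count; lra.
Qed.

Lemma prob_Z j : (j0 <= j)%N -> prob mu (Z j) <=
  3 * (mean mu (fun y => F j y ^+ 2) / (t ^+ 2 * q ^+ j)) + 2 * (mean mu f / t) * rho j.
Proof.
move=> jj; have w0 := w_gt0 j.
have tw0 : 0 < (t * q ^+ j) ^+ 2 by rewrite exprn_gt0// mulr_gt0.
apply: le_trans (@markov_bmf _ _ _ mu _ ((t * q ^+ j) ^+ 2) (bZ j) _ tw0) _.
  by move=> y; exact: sqr_ge0.
rewrite ler_pdivrMr ?exprn_gt0 ?mulr_gt0//; apply: le_trans (mean_win_sum_le jj) _.
rewrite le_eqVlt; apply/orP; left; apply/eqP.
by field; rewrite !gt_eqF.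
Qed.

(** The powers [q^j] below [f y / t], and the inverses of those above it, form geometric series
    dominated by the term next to [f y / t]. The total is thus linear in [f], as a weak type (1,1)
    bound requires. *)
Lemma level_sums_le y J :
  \sum_(0 <= j < J) (4 * (q ^+ j * \1_(B j) y) + 3 * (F j y ^+ 2 / (t ^+ 2 * q ^+ j))) <=
  7 * (q / (q - 1)) / t * f y.
Proof.
have v0 : 0 <= f y / t by rewrite divr_ge0// ltW.
rewrite big_split /= -!mulr_sumr.
have h1 : \sum_(0 <= j < J) q ^+ j * \1_(B j) y <= f y / t * (q / (q - 1)).
  apply: le_trans (geometric_low J q1 v0); apply: ler_sum => j _.
  rewrite indicE; have [|nB] := boolP (_ \in _); last first.
    by rewrite mulr0; case: ifP => // _; exact: ltW.
  by rewrite inE /B /= ltr_pdivlMr// mulrC => ->; rewrite mulr1.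
have h2 : \sum_(0 <= j < J) F j y ^+ 2 / (t ^+ 2 * q ^+ j) <= f y / t * (q / (q - 1)).
  have [fy0|fy] := eqVneq (f y) 0.
    rewrite big1 ?fy0 ?mul0r// => j _.
    by rewrite /F fy0 mul0r expr0n mul0r.
  have v1 : 0 < f y / t by rewrite divr_gt0// lt0r fy f0.
  apply: (@le_trans _ _ ((f y / t) ^+ 2 *
     \sum_(0 <= j < J) (if f y / t <= q ^+ j then (q ^+ j)^-1 else 0))).
    rewrite mulr_sumr; apply: ler_sum => j _.
    rewrite /F indicE; have [|nA] := boolP (_ \in _).
      rewrite inE /A => -[/= h _].
      have -> : f y / t <= q ^+ j by rewrite ler_pdivrMr// mulrC.
      rewrite mulr1.
      by rewrite le_eqVlt; apply/orP; left; apply/eqP; field; rewrite !gt_eqF.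
    rewrite mulr0 expr0n mul0r; apply: mulr_ge0; first exact: sqr_ge0.
    by case: ifP => // _; rewrite invr_ge0 ltW.
  apply: le_trans (ler_wpM2l (sqr_ge0 _) (geometric_high J q1 v1)) _.
  move: v1; set v := f y / t => v1.
  rewrite (_ : v ^+ 2 * _ = v * (q / (q - 1)))//.
  by field; rewrite subr_eq0 !gt_eqF.
by have := lerD h1 h2; lra.
Qed.

(** Off the exceptional set [f] agrees with its truncation at the successes of each window; the
    centered sum and the compensator are then at most [t q^j] each. *)
Lemma weak_type_bounded : exists U, [/\ measurable U,
  (mu U <= ((7 * (q / (q - 1)) + 2 * Krho + 3) * (mean mu f / t))%:E)%E &
  forall y, ~ U y -> forall j, (j0 <= j)%N ->
    win_sum (fun k => (x k)%:R) f (L j) (L j) y <= 2 * t * q ^+ j].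
Proof.
(* Level [t / 3], because a point of the window lies up to [2 L j] steps along the orbit and looks
   [L j] steps further. *)
have t3 : 0 < t / 3 by rewrite divr_gt0.
have [U0 [mU0 hU0 U0P]] := maximal_ergodic mpT bf f0 t3.
pose E j := if (j0 <= j)%N then V j `|` Z j else set0.
have mE j : measurable (E j).
  by rewrite /E; case: ifP => // _; exact: measurableU.
have mf0 : 0 <= mean mu f by exact: mean_ge0.
pose b j := 4 * (q ^+ j * prob mu (B j)) +
  3 * (mean mu (fun y => F j y ^+ 2) / (t ^+ 2 * q ^+ j)) + 2 * (mean mu f / t) * rho j.
have bE j : (mu (E j) <= (b j)%:E)%E.
  have mF2 : 0 <= mean mu (fun y => F j y ^+ 2) by apply: mean_ge0 => y; exact: sqr_ge0.
  rewrite /E; case: ifP => jj; last first.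
    rewrite measure0 lee_fin /b; have w0 := w_gt0 j.
    have i1 : 0 <= q ^+ j * prob mu (B j) by rewrite mulr_ge0 ?prob_ge0// ltW.
    have i2 : 0 <= mean mu (fun y => F j y ^+ 2) / (t ^+ 2 * q ^+ j).
      by rewrite divr_ge0// mulr_ge0 ?sqr_ge0// ltW.
    have i3 : 0 <= mean mu f / t * rho j by rewrite mulr_ge0// divr_ge0// ltW.
    by lra.
  rewrite /b -addrA; apply: measureU_le => //.
    by rewrite probE// lee_fin mulrA; exact: prob_V.
  by rewrite probE// lee_fin; exact: prob_Z.
have bF2 j : bmf (fun y => F j y ^+ 2).
  by under [X in bmf X]eq_fun do rewrite expr2; exact: bmfM.
have sum_b J : \sum_(0 <= j < J) b j <=
    (7 * (q / (q - 1)) + 2 * Krho) * (mean mu f / t).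
  rewrite /b big_split /= -mulr_sumr [leRHS]mulrDl; apply: lerD; last first.
    have M0 : 0 <= mean mu f / t by rewrite divr_ge0// ltW.
    by have := ler_wpM2l M0 (rho_sum J); lra.
  have bj j : bmf (fun y => 4 * (q ^+ j * \1_(B j) y) + 3 * (F j y ^+ 2 / (t ^+ 2 * q ^+ j))).
    apply: bmfD; first by do 2! apply: bmfZ; exact: bmf_indic.
    by apply: bmfZ; apply: bmfM => //; exact: bmf_cst.
  have -> : \sum_(0 <= j < J) (4 * (q ^+ j * prob mu (B j)) +
      3 * (mean mu (fun y => F j y ^+ 2) / (t ^+ 2 * q ^+ j))) =
    mean mu (fun y => \sum_(0 <= j < J) (4 * (q ^+ j * \1_(B j) y) +
       3 * (F j y ^+ 2 / (t ^+ 2 * q ^+ j)))).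
    rewrite mean_sum//; apply: eq_bigr => j _.
    rewrite meanD; last 2 first.
    - by do 2! apply: bmfZ; exact: bmf_indic.
    - by apply: bmfZ; apply: bmfM => //; exact: bmf_cst.
    rewrite meanZ; last by apply: bmfZ; exact: bmf_indic.
    rewrite meanZ; last exact: bmf_indic.
    rewrite mean_indic// meanZ; last by apply: bmfM => //; exact: bmf_cst.
    congr (_ + 3 * _); rewrite mulrC -meanZ//; apply: eq_Rintegral => y _.
    by rewrite mulrC.
  apply: (@le_trans _ _ (mean mu (fun y => 7 * (q / (q - 1)) / t * f y))).
    by apply: mean_le; [exact: bmf_sum|exact: bmfZ|move=> y; exact: level_sums_le].
  by rewrite meanZ//; lra.
exists (U0 `|` \bigcup_j E j); split.
- by apply: measurableU => //; exact: bigcup_measurable.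
- have mUE : measurable (\bigcup_j E j) by exact: bigcup_measurable.
  rewrite addrC mulrDl; apply: measureU_le => //.
    by rewrite (_ : 3 * (mean mu f / t) = mean mu f / (t / 3)) //; field; rewrite gt_eqF.
  exact: (measure_bigcup_le mE bE sum_b).
move=> y /not_orP[nU0 nE] j jj; have w0 := w_gt0 j.
have [nV nZ] : ~ V j y /\ ~ Z j y.
  by apply/not_orP => h; apply: nE; exists j => //; rewrite /E jj.
have goodA k : (L j < k <= L j + L j)%N -> birkhoff_sum T f (L j) (iter k T y) <= t * (L j)%:R.
  move=> hk; apply: (@le_trans _ _ (birkhoff_sum T f (k + L j) y)).
    rewrite [leRHS]/birkhoff_sum (big_cat_nat (n := k))//=; last by rewrite leq_addr.
    rewrite ler_wpDl ?sumr_ge0// addnC -{2}[k]add0n big_addn addnK.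
    by apply: ler_sum => i _; rewrite iterD.
  apply: le_trans (U0P y nU0 _) _; rewrite mulrAC ler_pdivrMr// -mulrA ler_pM2l//.
  by rewrite -natrM ler_nat; lia.
have eqF k : (L j < k <= L j + L j)%N ->
    (x k)%:R * f (iter k T y) = (x k)%:R * F j (iter k T y).
  move=> hk; case xk : (x k); last by rewrite !mul0r.
  rewrite /F indicE mem_set ?mulr1//; split => /=; last exact: goodA.
  rewrite leNgt; apply/negP => hB; apply: nV; rewrite /V /=.
  apply: (@lt_le_trans _ _ (1 * \1_(B j) (iter k T y))).
    have -> : \1_(B j) (iter k T y) = 1 :> R by rewrite indicE mem_set.
    by rewrite mulr1; lra.
  rewrite /win_sum (big_cat_nat (n := k))//=; try lia.
  rewrite [X in _ + X]big_ltn; last by lia.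
  have pos i : 0 <= (x i)%:R * \1_(B j) (iter i T y) :> R by rewrite mulr_ge0// indicE ler0n.
  by rewrite xk addrCA lerDl addr_ge0// sumr_ge0.
have -> : win_sum (fun k => (x k)%:R) f (L j) (L j) y =
    win_sum c (F j) (L j) (L j) y + win_sum sg (F j) (L j) (L j) y.
  rewrite /win_sum -big_split /=; apply: eq_big_nat => k hk.
  by rewrite eqF// /c; ring.
have h1 : win_sum c (F j) (L j) (L j) y <= t * q ^+ j.
  apply: le_trans (ler_norm _) _; rewrite -[leRHS]ger0_norm; last by rewrite mulr_ge0// ltW.
  rewrite -ler_sqr ?nnegrE// !real_normK ?num_real// leNgt.
  by apply/negP => h; apply: nZ.
have h2 : win_sum sg (F j) (L j) (L j) y <= t * q ^+ j.
  apply: (@le_trans _ _ (s j * birkhoff_sum T f (L j + L j).+1 y)).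
    rewrite /win_sum /birkhoff_sum (big_cat_nat (n := (L j).+1) (m := 0))//=; last by lia.
    rewrite mulrDr ler_wpDl//; first by rewrite mulr_ge0 ?sumr_ge0// ltW.
    rewrite mulr_sumr; apply: ler_sum_nat => k hk.
    by have /andP[h3 h4] := sg_le (j := j) (k := k) hk; apply: ler_pM.
  apply: le_trans (ler_wpM2l (ltW (s_gt0 j)) (U0P y nU0 _)) _.
  have h : (L j + L j).+1%:R <= 3 * (L j)%:R :> R.
    have L0 : (0 < L j)%N by rewrite expn_gt0.
    by rewrite -natrM ler_nat; lia.
  have st0 : 0 <= s j * t by rewrite mulr_ge0 ?ltW.
  by have := ler_wpM2l st0 h; rewrite wE; lra.
lra.
Qed.

End Dyadic.
End WeakType.

Section WeakTypeIntegrable.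
Variables (R : realType) (d : measure_display) (Y : measurableType d).
Variables (mu : probability Y R) (T : Y -> Y).
Hypothesis mpT : measure_preserving mu T.
Variables (x : nat -> bool) (sg : nat -> R) (q : R) (rho : nat -> R) (Krho : R) (j0 : nat).
Hypothesis q1 : 1 < q.
Let L j := (2 ^ j)%N.
Let s j : R := q ^+ j / (L j)%:R.
Hypothesis sg_le : forall j k, (L j < k <= L j + L j)%N -> 0 <= sg k <= s j.
Hypothesis s_le1 : forall j, s j <= 1.
Hypothesis rho0 : forall j, 0 <= rho j.
Hypothesis rho_sum : forall J, \sum_(0 <= j < J) rho j <= Krho.
Hypothesis count_le : forall j, (j0 <= j)%N -> win_count R x (L j) (L j) <= 2 * q ^+ j.
Hypothesis count_ge : forall j, (j0 <= j)%N -> q ^+ j / 4 <= win_count R x (L j) (L j).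
Hypothesis lag_le : forall j g, (j0 <= j)%N -> (0 < g < L j)%N ->
  `|lag_sum (fun k => (x k)%:R - sg k) (L j) (L j) g| <= rho j * (q ^+ j) ^+ 2 / (L j)%:R.
Variables (f : Y -> R) (t : R).
Hypotheses (intf : mu.-integrable setT (EFin \o f)) (f0 : forall y, 0 <= f y) (t0 : 0 < t).

Let Cw := 7 * (q / (q - 1)) + 2 * Krho + 3.

Lemma weak_type_integrable : exists U, [/\ measurable U,
  (mu U <= (Cw * (mean mu f / t))%:E)%E &
  forall y, ~ U y -> forall j, (j0 <= j)%N ->
    win_sum T (fun k => (x k)%:R) f (L j) (L j) y <= 2 * t * q ^+ j].
Proof.
have mf : measurable_fun setT f by apply/measurable_EFinP; case/integrableP : intf.
pose fK (K : nat) y := Num.min (f y) K%:R.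
have bfK K : bmf (fK K).
  split; first by apply: measurable_minr => //; exact: measurable_cst.
  exists K%:R => y; rewrite ger0_norm; last by rewrite le_min f0 ler0n.
  by rewrite ge_min lexx orbT.
have fK0 K y : 0 <= fK K y by rewrite le_min f0 ler0n.
have fKf K y : fK K y <= f y by rewrite ge_min lexx.
have fKm K y : fK K y <= fK K.+1 y.
  by rewrite le_min !ge_min lexx /= ler_nat leqnSn orbT.
pose ws (g : Y -> R) j y : R := win_sum T (fun k => (x k)%:R) g (L j) (L j) y.
pose E K := \bigcup_(j in [set j | (j0 <= j)%N]) [set y | 2 * t * q ^+ j < ws (fK K) j y].
have mE K : measurable (E K).
  apply: bigcup_measurable => j _; apply: measurable_gt_level.
  by case: (bmf_win_sum mpT (fun k => (x k)%:R) (L j) (L j) (bfK K)).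
have q10 : 0 < q - 1 by rewrite subr_gt0.
have Krho0 : 0 <= Krho by have := rho_sum 0; rewrite big_geq.
have Cw0 : 0 <= Cw.
  have : 0 <= q / (q - 1) by rewrite divr_ge0// ltW// (lt_trans ltr01 q1).
  by rewrite /Cw; lra.
exists (\bigcup_K E K); split.
- exact: bigcup_measurable.
- apply: nondecreasing_bigcup_le => //.
    apply/nondecreasing_seqP => K; apply/subsetPset => y /= [j jj h]; exists j => //=.
    apply: lt_le_trans h _; apply: ler_sum => k _; apply: ler_wpM2l => //.
  move=> K; have [U [mU hU UP]] := weak_type_bounded mpT q1 sg_le s_le1 rho0 rho_sum
    count_le lag_le (bfK K) (fK0 K) t0.
  apply: (@le_trans _ _ (prob mu U)).
    apply: prob_le => // y [j jj /= h]; apply: contrapT => nU.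
    by have := UP y nU j jj; rewrite leNgt h.
  move: hU; rewrite probE// lee_fin => /le_trans; apply.
  apply: ler_wpM2l => //; rewrite ler_pM2r ?invr_gt0//.
  by apply: le_Rintegral => //; exact: bmf_integrable.
move=> y nU j jj; rewrite leNgt; apply/negP => h; apply: nU.
(* Only finitely many orbit points enter the window, so a high enough truncation leaves the sum
   unchanged. *)
pose K := \max_((L j).+1 <= k < (L j + L j).+1) (Num.truncn (f (iter k T y))).+1.
exists K => //; exists j => //=; apply: lt_le_trans h _.
apply: ler_sum_nat => k hk; apply: ler_wpM2l => //.
rewrite /fK le_min lexx /=; apply: le_trans (ltW (truncnS_gt _)) _.
rewrite ler_nat /K; apply: (@leq_bigmax_seq _ _ _ (fun k => (Num.truncn (f (iter k T y))).+1) k) => //.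
by rewrite mem_index_iota.
Qed.

Lemma succs_sum k : (succs x k)%:R = \sum_(1 <= i < k.+1) (x i)%:R :> R.
Proof.
elim: k => [|k IH]; first by rewrite big_geq.
by rewrite big_nat_recr//= -IH /succs /= natrD addrC.
Qed.

(** The bounds of the windows add up geometrically, and the last complete window already has a fixed
    proportion of that total in successes; [A] absorbs what precedes window [j0]. *)
Lemma weak_type_average : exists U, [/\ measurable U,
  (mu U <= (Cw * (mean mu f / t))%:E)%E &
  forall y, ~ U y -> exists A : R, forall M, (2 ^ j0.+1 <= M)%N ->
    \sum_(1 <= k < M.+1) (x k)%:R * f (iter k T y) <=
    A + 8 * q ^+ 2 / (q - 1) * t * (succs x M)%:R].
Proof.
have [U [mU hU UP]] := weak_type_integrable.
exists U; split => // y nU; have {}UP := UP y nU.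
pose F k : R := (x k)%:R * f (iter k T y).
have F0 k : 0 <= F k by rewrite mulr_ge0.
pose A := \sum_(1 <= k < (L j0).+1) F k.
have q0 : 0 < q by exact: lt_trans q1.
have q10 : 0 < q - 1 by rewrite subr_gt0.
have step J : (j0 <= J)%N -> \sum_(1 <= k < (L J).+1) F k <= A + 2 * t * (q ^+ J / (q - 1)).
  elim: J => [|J IH].
    rewrite leqn0 => /eqP j00; rewrite /A j00 lerDl.
    by rewrite !mulr_ge0 ?invr_ge0 ?ltW// expr0.
  rewrite leq_eqVlt => /predU1P[<-|].
    by rewrite /A lerDl !mulr_ge0 ?invr_ge0 ?exprn_ge0 ?ltW.
  rewrite ltnS => jJ; have LL : (L J.+1 = L J + L J)%N by rewrite /L expnS mul2n addnn.
  rewrite LL (big_cat_nat (n := (L J).+1))//=; last by rewrite ltnS leq_addr.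
  have h1 := IH jJ; have h2 := UP J jJ; rewrite /win_sum -/F in h2.
  apply: le_trans (lerD h1 h2) _; rewrite -addrA lerD2l exprS.
  rewrite (_ : 2 * t * (q * q ^+ J / (q - 1)) =
     2 * t * (q ^+ J / (q - 1)) + 2 * t * q ^+ J)//.
  by field; rewrite gt_eqF.
exists A => M hM; pose J := trunc_log 2 M.
have M0 : (0 < M)%N by apply: leq_trans hM; rewrite expn_gt0.
have /andP[h1 h2] : (2 ^ J <= M < 2 ^ J.+1)%N by apply: trunc_log_bounds.
have jJ : (j0 < J)%N.
  by rewrite -ltnS -(ltn_exp2l (m := 2))//; exact: leq_ltn_trans h2.
apply: (@le_trans _ _ (\sum_(1 <= k < (L J.+1).+1) F k)).
  rewrite [leRHS](big_cat_nat (n := M.+1))//=; last by rewrite ltnS ltnW.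
  by rewrite lerDl sumr_ge0.
apply: le_trans (step J.+1 _) _; first by rewrite ltnW// leqW.
rewrite lerD2l.
(* The window of index [J.-1] is the last one that lies entirely in [[1, M]]. *)
have hS : q ^+ J.-1 / 4 <= (succs x M)%:R.
  apply: le_trans (count_ge (j := J.-1) _) _; first by lia.
  rewrite succs_sum /win_count.
  have LL : (L J.-1 + L J.-1 = L J)%N by rewrite /L addnn -mul2n -expnS prednK//; lia.
  rewrite LL [leRHS](big_cat_nat (n := (L J).+1))//= [X in _ <= X + _](big_cat_nat (n := (L J.-1).+1))//=; last first.
    by rewrite ltnS -LL leq_addr.
  by rewrite addrAC lerDr addr_ge0// sumr_ge0.
have -> : 2 * t * (q ^+ J.+1 / (q - 1)) = 8 * q ^+ 2 / (q - 1) * t * (q ^+ J.-1 / 4).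
  have -> : q ^+ J.+1 = q ^+ 2 * q ^+ J.-1 by rewrite -exprD; congr (_ ^+ _); lia.
  by field; rewrite gt_eqF.
apply: ler_wpM2l => //; apply: ltW; rewrite mulr_gt0// divr_gt0// mulr_gt0// exprn_gt0//.
Qed.

End WeakTypeIntegrable.

(** * Twisted averages *)

Section TwistedAverages.
Variables (R : realType) (x : nat -> bool) (sg th : nat -> R).
Hypothesis th1 : forall n, `|th n| <= 1.
Hypothesis sg01 : forall k, 0 <= sg k <= 1.
Hypothesis sg_decr : forall k, (0 < k)%N -> sg k.+1 <= sg k.
Hypothesis sg_cvg0 : forall eta : R, 0 < eta -> exists k0, forall k, (k0 <= k)%N -> sg k <= eta.
Hypothesis succs_infty : forall A : R, exists M0, forall M, (M0 <= M)%N -> A <= (succs x M)%:R.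
Implicit Types (F G : nat -> R).

(** Little-o of the number of successes, the normalisation that becomes [N] along the hitting
    times. *)
Definition negligible_sum F := forall e : R, 0 < e ->
  exists M0, forall M, (M0 <= M)%N -> `|F M| <= e * (succs x M)%:R.

Lemma negligible_sumD F G : negligible_sum F -> negligible_sum G ->
  negligible_sum (fun M => F M + G M).
Proof.
move=> hF hG e e0; have e2 : 0 < e / 2 by rewrite divr_gt0.
have [M1 h1] := hF _ e2; have [M2 h2] := hG _ e2.
exists (M1 + M2)%N => M hM; apply: le_trans (ler_normD _ _) _.
by have := h1 M ltac:(lia); have := h2 M ltac:(lia); lra.
Qed.

Lemma negligible_sumZ (a : R) F : negligible_sum F -> negligible_sum (fun M => a * F M).
Proof.
move=> hF e e0; have a0 : 0 < `|a| + 1 by rewrite ltr_wpDl.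
have [M0 h] := hF (e / (`|a| + 1)) ltac:(by rewrite divr_gt0).
exists M0 => M /h hM; rewrite normrM.
apply: (@le_trans _ _ ((`|a| + 1) * (e / (`|a| + 1) * (succs x M)%:R))).
  by apply: ler_pM => //; rewrite lerDl.
by rewrite mulrA [_ * (e / _)]mulrC divfK// gt_eqF.
Qed.

Lemma negligible_sum_ext F G : F =1 G -> negligible_sum F -> negligible_sum G.
Proof. by move=> /funext ->. Qed.

Lemma negligible_sum_le F G (A : R) : negligible_sum G ->
  (forall M, `|F M| <= A + `|G M|) -> negligible_sum F.
Proof.
move=> hG h e e0; have e2 : 0 < e / 2 by rewrite divr_gt0.
have [M1 h1] := hG _ e2; have [M2 h2] := succs_infty (A / (e / 2)).
exists (M1 + M2)%N => M hM; apply: le_trans (h M) _.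
have := h1 M ltac:(lia); have := h2 M ltac:(lia).
rewrite ler_pdivrMr// => a1 a2; lra.
Qed.

Definition predictable_weight k : R := th (succs x k.-1).+1.

Lemma predictable_weightS k : ~~ x k -> (0 < k)%N ->
  predictable_weight k.+1 = predictable_weight k.
Proof. by case: k => // k nx _; rewrite /predictable_weight /succs /= (negbTE nx). Qed.

(** At a success the count is its previous value plus 1; at a failure the centered part and the
    compensator cancel. *)
Lemma twisted_split k : (0 < k)%N ->
  (x k)%:R * th (succs x k) = centered sg th x k + sg k * predictable_weight k.
Proof.
case: k => // k _; rewrite /centered /predictable_weight /=.
rewrite {1}/succs /=; case: (x k.+1) => /=; rewrite ?add1n -/(succs x k); ring.
Qed.

Lemma abel_telescope (u G : nat -> R) (K : R) M : (forall k, `|G k| <= K) ->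
  `|\sum_(1 <= k < M.+1) u k * (G k - G k.+1) + u M * G M.+1| <=
  K * (`|u 0%N| + \sum_(0 <= k < M) `|u k.+1 - u k|).
Proof.
move=> hG; elim: M => [|M IH].
  by rewrite !big_geq// add0r addr0 normrM mulrC ler_wpM2r.
rewrite [in leLHS]big_nat_recr//= [X in K * (_ + X)]big_nat_recr//= addrA [leRHS]mulrDr.
move: IH; set S := \sum_(1 <= _ < M.+1) _; set V := \sum_(0 <= _ < M) _ => IH.
have -> : S + u M.+1 * (G M.+1 - G M.+2) + u M.+1 * G M.+2 =
    (S + u M * G M.+1) + (u M.+1 - u M) * G M.+1 by ring.
apply: le_trans (ler_normD _ _) _; apply: lerD => //.
by rewrite normrM mulrC ler_wpM2r.
Qed.

(* The weights of the compensator change only at the (sparse) times of success. *)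
Lemma compensator_coboundary (G : nat -> R) (K : R) : (forall k, `|G k| <= K) ->
  negligible_sum (fun M => \sum_(1 <= k < M.+1)
    sg k * predictable_weight k * (G k - G k.+1)).
Proof.
move=> hG; pose u k := sg k * predictable_weight k.
have K0 : 0 <= K by apply: le_trans (hG 0%N).
have u1 k : `|u k| <= 1.
  have /andP[s0 s1] := sg01 k.
  by rewrite normrM (ger0_norm s0); apply: mulr_ile1; rewrite ?th1.
(* The decrease of [sg] telescopes, and the twist changes only after a success, at cost [2 sg k]. *)
have du k : (0 < k)%N -> `|u k.+1 - u k| <= (sg k - sg k.+1) + 2 * (sg k * (x k)%:R).
  move=> k0; have d0 := sg_decr k0; have /andP[s0 _] := sg01 k.
  have -> : u k.+1 - u k = (sg k.+1 - sg k) * predictable_weight k.+1 +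
      sg k * (predictable_weight k.+1 - predictable_weight k) by rewrite /u; ring.
  apply: le_trans (ler_normD _ _) _; apply: lerD.
    rewrite normrM distrC [ `|sg k - _|]ger0_norm ?subr_ge0// ler_piMr ?subr_ge0//; exact: th1.
  rewrite normrM (ger0_norm s0) mulrCA; apply: ler_wpM2l => //.
  have [xk|nxk] := boolP (x k).
    by rewrite mulr1; apply: le_trans (ler_normB _ _) _; rewrite -[leRHS]/(1 + 1 : R) lerD ?th1.
  by rewrite predictable_weightS// subrr normr0 mulr0.
pose V M := \sum_(1 <= k < M) sg k * (x k)%:R.
(* Each success contributes only [sg k], which tends to 0. *)
have hV : negligible_sum V.
  move=> e e0; have e2 : 0 < e / 2 by rewrite divr_gt0.
  have [k0 hk0] := sg_cvg0 e2; have [M0 hM0] := succs_infty (k0.+1%:R / (e / 2)).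
  exists (M0 + k0.+1)%N => M hM; rewrite ger0_norm; last first.
    by apply: sumr_ge0 => k _; rewrite mulr_ge0//; have /andP[] := sg01 k.
  rewrite /V (big_cat_nat (n := k0.+1))//=; last by lia.
  have h1 : \sum_(1 <= k < k0.+1) sg k * (x k)%:R <= k0.+1%:R.
    apply: (@le_trans _ _ (\sum_(1 <= k < k0.+1) 1)).
      apply: ler_sum => k _; have /andP[s0 s1] := sg01 k.
      by case: (x k); rewrite ?mulr1 ?mulr0.
    by rewrite sumr_const_nat ler_nat subSS subn0.
  have h2 : \sum_(k0.+1 <= k < M) sg k * (x k)%:R <= e / 2 * (succs x M)%:R.
    rewrite succs_sum [X in _ * X](big_cat_nat (n := M))//=; last by lia.
    rewrite [X in _ * (X + _)](big_cat_nat (n := k0.+1))//=; last by lia.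
    apply: (@le_trans _ _ (e / 2 * \sum_(k0.+1 <= k < M) (x k)%:R)).
      rewrite mulr_sumr; apply: ler_sum_nat => k hk; apply: ler_wpM2r => //.
      by apply: hk0; lia.
    apply: ler_wpM2l; first exact: ltW.
    by rewrite addrAC lerDr addr_ge0// sumr_ge0.
  have := hM0 M ltac:(lia); rewrite ler_pdivrMr// => h3; lra.
apply: (@negligible_sum_le _ (fun M => 2 * K * V M) (K * 5)).
  exact: negligible_sumZ.
move=> M; have := @abel_telescope u G K M hG.
set S := \sum_(1 <= k < M.+1) _ => hS.
have -> : S = S + u M * G M.+1 - u M * G M.+1 by ring.
apply: le_trans (ler_normB _ _) _.
have h1 : `|u M * G M.+1| <= K.
  by rewrite normrM -[leRHS]mul1r; apply: ler_pM.
(* The constant 2 pays for the step from index 0, to which [du] does not apply. *)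
have h2 : \sum_(0 <= k < M) `|u k.+1 - u k| <= 2 + 2 * V M + (if (0 < M)%N then sg 1%N - sg M else 0).
  elim: M {S hS h1} => [|M IH]; first by rewrite /V !big_geq// mulr0 !addr0.
  rewrite big_nat_recr//=; case: (posnP M) => [->|M0].
    rewrite big_geq// add0r /V big_geq// mulr0 subrr !addr0.
    by apply: le_trans (ler_normB _ _) _; rewrite -[leRHS]/(1 + 1 : R) lerD.
  rewrite M0 in IH; have := du M M0; rewrite /V big_nat_recr//= -/(V M); lra.
have h3 : (if (0 < M)%N then sg 1%N - sg M else 0) <= 1.
  case: ifP => // _; have /andP[_ a1] := sg01 1%N; have /andP[a2 _] := sg01 M; lra.
have V0 : 0 <= V M by apply: sumr_ge0 => k _; rewrite mulr_ge0//; have /andP[] := sg01 k.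
rewrite [X in _ <= _ + X]ger0_norm; last by rewrite !mulr_ge0.
have h4 : `|u 0%N| + \sum_(0 <= k < M) `|u k.+1 - u k| <= 4 + 2 * V M.
  by have := u1 0%N; lra.
by have := ler_wpM2l K0 h4; lra.
Qed.

Definition twisted_sum (f : nat -> R) M : R :=
  \sum_(1 <= k < M.+1) (x k)%:R * th (succs x k) * f k.

Lemma twisted_sumD (f g : nat -> R) M :
  twisted_sum (fun k => f k + g k) M = twisted_sum f M + twisted_sum g M.
Proof. by rewrite /twisted_sum -big_split; apply: eq_bigr => k _; rewrite mulrDr. Qed.

Lemma twisted_sum_le (f : nat -> R) M :
  `|twisted_sum f M| <= \sum_(1 <= k < M.+1) (x k)%:R * `|f k|.
Proof.
apply: le_trans (ler_norm_sum _ _ _) _; apply: ler_sum => k _.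
by rewrite !normrM (ger0_norm (ler0n _ _)) ler_wpM2r// ler_piMr// th1.
Qed.

Lemma sum_succs (F : nat -> R) M :
  \sum_(1 <= k < M.+1) (x k)%:R * F (succs x k) = \sum_(1 <= n < (succs x M).+1) F n.
Proof.
elim: M => [|M IH]; first by rewrite !big_geq.
rewrite big_nat_recr//= IH {2 3}/succs /=; case: (x M.+1) => /=.
  by rewrite add1n -/(succs x M) [RHS]big_nat_recr//= mul1r.
by rewrite mul0r addr0.
Qed.

(** * Almost everywhere bounds in a given system *)

Section System.
Variables (d : measure_display) (Y : measurableType d).
Variables (mu : probability Y R) (T : Y -> Y).
Hypothesis mpT : measure_preserving mu T.
Variables (m l : nat -> nat) (w beta : nat -> R) (Kb : R) (i0 : nat).
Hypothesis mS : forall i, m i.+1 = (m i + l i)%N.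
Hypothesis l0 : forall i, (0 < l i)%N.
Hypothesis w0 : forall i, (i0 <= i)%N -> 0 < w i.
Hypothesis count2 : forall i, (i0 <= i)%N -> win_count R x (m i) (l i) <= 2 * w i.
Hypothesis count4 : forall i, (i0 <= i)%N -> w i / 4 <= win_count R x (m i) (l i).
Hypothesis sg_w : forall i, (i0 <= i)%N -> \sum_((m i).+1 <= k < (m i + l i).+1) sg k <= w i.
Hypothesis beta_le : forall i, (i0 <= i)%N ->
  3 * w i + 2 * \sum_(1 <= g < l i) `|lag_sum (centered sg th x) (m i) (l i) g|
    <= beta i * w i ^+ 2.
Hypothesis beta0 : forall i, 0 <= beta i.
Hypothesis beta_sum : forall n, \sum_(0 <= i < n) beta i <= Kb.
Hypothesis w_small : forall eta : R, 0 < eta -> exists i1, forall i, (i1 <= i)%N ->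
  w i <= eta * (succs x (m i))%:R.

Let c := centered sg th x.

Lemma centered_norm k : `|c k| <= (x k)%:R + sg k.
Proof.
have /andP[s0 s1] := sg01 k; rewrite /c /centered normrM.
apply: le_trans (ler_piMr _ (th1 _)) _ => //.
by apply: le_trans (ler_normB _ _) _; rewrite !ger0_norm.
Qed.

Lemma centered_sqr k : c k ^+ 2 <= (x k)%:R + sg k.
Proof.
apply: le_trans (centered_norm k); rewrite -(real_normK (num_real (c k))) expr2 ler_piMr//.
have /andP[s0 s1] := sg01 k; rewrite /c /centered normrM.
have h : `|(x k)%:R - sg k| <= 1 by rewrite ler_norml; case: (x k) => /=; apply/andP; split; lra.
by apply: mulr_ile1.
Qed.

Lemma sum_win_abs i : (i0 <= i)%N ->
  \sum_((m i).+1 <= k < (m i + l i).+1) ((x k)%:R + sg k) <= 3 * w i.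
Proof.
by move=> ii; rewrite big_split /=; have := count2 ii; have := sg_w ii; rewrite /win_count; lra.
Qed.

Lemma window_cover i2 M : (m i2 < M)%N -> exists i, (i2 <= i)%N /\ (m i < M <= m i.+1)%N.
Proof.
move=> h; rewrite -(subnKC h); elim: (M - (m i2).+1)%N => [|n [i [ii /andP[h1 h2]]]].
  by exists i2; rewrite addn0 leqnn ltnSn mS; have := l0 i2; lia.
rewrite addnS; have [h3|h3] := ltnP ((m i2).+1 + n) (m i.+1).
  by exists i; split => //; lia.
exists i.+1; split; first exact: leqW.
by rewrite [m i.+2]mS; have := l0 i.+1; lia.
Qed.

Lemma mean_win_sum_bound (f : Y -> R) (K : R) i : bmf f -> (forall y, `|f y| <= K) ->
  (i0 <= i)%N ->
  mean mu (fun y => win_sum T c f (m i) (l i) y ^+ 2) <= K ^+ 2 * (beta i * w i ^+ 2).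
Proof.
move=> bf hK ii; rewrite mean_win_sum_sqr//.
have acorr g : `|autocorr mu T f g| <= K ^+ 2.
  have bb : bmf (fun y => f y * f (iter g T y)) by apply: bmfM => //; exact: (bmf_iter mpT).
  have h y : `|f y * f (iter g T y)| <= K ^+ 2 by rewrite normrM expr2; apply: ler_pM.
  rewrite ler_norml -[X in - X <= _](mean_cst mu) -[X in _ && (_ <= X)](mean_cst mu).
  apply/andP; split.
    rewrite -mulN1r -meanZ; last exact: bmf_cst.
    apply: mean_le => // [|y]; first by apply: bmfZ; exact: bmf_cst.
    by rewrite mulN1r; have := h y; rewrite ler_norml => /andP[].
  apply: mean_le => // [|y]; first exact: bmf_cst.
  by have := h y; rewrite ler_norml => /andP[].
have K2 : 0 <= K ^+ 2 by exact: sqr_ge0.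
have S0 : 0 <= \sum_((m i).+1 <= k < (m i + l i).+1) c k ^+ 2.
  by apply: sumr_ge0 => k _; exact: sqr_ge0.
apply: (@le_trans _ _ (K ^+ 2 * (3 * w i + 2 * \sum_(1 <= g < l i) `|lag_sum c (m i) (l i) g|))).
  rewrite mulrDr; apply: lerD.
    rewrite mulrC; apply: ler_pM => //.
      by apply: mean_ge0 => y; rewrite -expr2 sqr_ge0.
      by apply: le_trans (ler_norm _) _.
    apply: le_trans (sum_win_abs ii); apply: ler_sum => k _; exact: centered_sqr.
  rewrite mulrCA; apply: ler_wpM2l => //; rewrite mulr_sumr; apply: ler_sum => g _.
  apply: le_trans (ler_norm _) _; rewrite normrM mulrC; apply: ler_wpM2r => //.
by apply: ler_wpM2l => //; exact: beta_le.
Qed.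

(** Chebyshev's inequality at level [w i / r.+1] gives probabilities of order [beta i], which are
    summable. In the sum over windows, [w i] is paid by four times the count of the window; an
    incomplete window is bounded trivially by [3 K w i], negligible against the past successes. *)
Lemma ae_centered_negligible (f : Y -> R) : bmf f ->
  {ae mu, forall y, negligible_sum (fun M => \sum_(1 <= k < M.+1) c k * f (iter k T y))}.
Proof.
move=> bf; have [_ [K0 hK0]] := bf.
pose K := `|K0| + 1.
have hK y : `|f y| <= K.
  by apply: le_trans (hK0 y) _; apply: le_trans (ler_norm _) _; rewrite lerDl.
have K_gt0 : 0 < K by rewrite ltr_wpDl.
have bW i : bmf (fun y => win_sum T c f (m i) (l i) y ^+ 2).
  by under [X in bmf X]eq_fun do rewrite expr2; apply: bmfM; exact: (bmf_win_sum mpT).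
pose Z r i := if (i0 <= i)%N then
  [set y | (w i / r.+1%:R) ^+ 2 < win_sum T c f (m i) (l i) y ^+ 2] else set0.
have mZ r i : measurable (Z r i).
  by rewrite /Z; case: ifP => // _; apply: measurable_gt_level; case: (bW i).
have PZ r i : (mu (Z r i) <= (r.+1%:R ^+ 2 * K ^+ 2 * beta i)%:E)%E.
  rewrite /Z; case: ifP => ii; last first.
    rewrite measure0 lee_fin; apply: mulr_ge0; last exact: beta0.
    by apply: mulr_ge0; exact: sqr_ge0.
  have t0 : 0 < (w i / r.+1%:R) ^+ 2 by rewrite exprn_gt0// divr_gt0// ?w0// ltr0n.
  rewrite probE; last by have := mZ r i; rewrite /Z ii.
  rewrite lee_fin; apply: le_trans (markov_bmf mu (bW i) _ t0) _.
    by move=> y; exact: sqr_ge0.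
  rewrite ler_pdivrMr//; apply: le_trans (mean_win_sum_bound bf hK ii) _.
  have r0 : r.+1%:R != 0 :> R by rewrite pnatr_eq0.
  rewrite le_eqVlt; apply/orP; left; apply/eqP.
  by field.
have sumZ r n : \sum_(0 <= i < n) r.+1%:R ^+ 2 * K ^+ 2 * beta i <= r.+1%:R ^+ 2 * K ^+ 2 * Kb.
  by rewrite -mulr_sumr; apply: ler_wpM2l => //; apply: mulr_ge0; exact: sqr_ge0.
have := ae_exists_forall (fun r => borel_cantelli (mZ r) (PZ r) (sumZ r)).
apply: filterS => y hy e e0.
have e4 : 0 < e / 4 by rewrite divr_gt0.
pose r := Num.truncn (4 / (e / 4)).
have hr : 4 / r.+1%:R <= e / 4.
  rewrite ler_pdivrMr ?ltr0n// mulrC -ler_pdivrMr//; apply: ltW; exact: truncnS_gt.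
have [i1 hi1] := hy r.
have eta0 : 0 < e / 4 / (3 * K) by rewrite divr_gt0// mulr_gt0.
have [i2 hi2] := w_small eta0.
pose i3 := (i0 + i1 + i2)%N.
pose F M := \sum_(1 <= k < M.+1) c k * f (iter k T y).
pose A := `|F (m i3)|.
have mono M M' : (M <= M')%N -> (succs x M)%:R <= (succs x M')%:R :> R.
  move=> MM; rewrite !succs_sum [leRHS](big_cat_nat (n := M.+1))//=.
  by rewrite lerDl sumr_ge0.
have step i : (i3 <= i)%N -> `|F (m i)| <= A + 4 / r.+1%:R * (succs x (m i))%:R.
  elim: i => [|i IH].
    by rewrite leqn0 => /eqP e3; rewrite /A e3 lerDl mulr_ge0// divr_ge0.
  rewrite leq_eqVlt => /predU1P[<-|]; first by rewrite lerDl mulr_ge0// divr_ge0.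
  rewrite ltnS => ii; have {}IH := IH ii.
  have ii0 : (i0 <= i)%N by apply: leq_trans ii; rewrite /i3 -addnA leq_addr.
  rewrite /F mS (big_cat_nat (n := (m i).+1))//=; last by rewrite ltnS leq_addr.
  rewrite -/(F (m i)) -/(win_sum T c f (m i) (l i) y).
  have hw : `|win_sum T c f (m i) (l i) y| <= w i / r.+1%:R.
    have := hi1 i; rewrite (_ : (i1 <= i)%N); last first.
      by apply: leq_trans ii; rewrite /i3 -addnA addnCA leq_addr.
    move=> /(_ isT); rewrite /Z ii0 /= => /negP; rewrite -leNgt.
    have wr : 0 <= w i / r.+1%:R by rewrite divr_ge0// ltW// w0.
    by rewrite -(real_normK (num_real (win_sum _ _ _ _ _ _))) ler_sqr ?nnegrE.
  apply: le_trans (ler_normD _ _) _.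
  have hs : (succs x (m i + l i))%:R = (succs x (m i))%:R + win_count R x (m i) (l i).
    by rewrite !succs_sum (big_cat_nat (n := (m i).+1))//= ltnS leq_addr.
  rewrite hs mulrDr addrA; apply: lerD => //; apply: le_trans hw _.
  have := count4 ii0; have r0 : 0 < r.+1%:R^-1 :> R by rewrite invr_gt0 ltr0n.
  move=> /(ler_wpM2l (ltW r0)); move: (r.+1%:R^-1) => rr h.
  have -> : w i * rr = 4 * (rr * (w i / 4)) by field.
  by rewrite -mulrA; apply: ler_wpM2l.
have [M0 hM0] := succs_infty (A / (e / 2)).
exists (M0 + (m i3).+1)%N => M hM.
have [i [ii /andP[h1 h2]]] := @window_cover i3 M ltac:(lia).
have ii0 : (i0 <= i)%N by apply: leq_trans ii; rewrite /i3 -addnA leq_addr.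
rewrite -/(F M) /F (big_cat_nat (n := (m i).+1))//=; last by rewrite ltnW.
rewrite -/(F (m i)); apply: le_trans (ler_normD _ _) _.
have b1 := step i ii.
have b2 : `|\sum_((m i).+1 <= k < M.+1) c k * f (iter k T y)| <= K * (3 * w i).
  apply: le_trans (ler_norm_sum _ _ _) _.
  apply: (@le_trans _ _ (K * \sum_((m i).+1 <= k < M.+1) ((x k)%:R + sg k))).
    rewrite mulr_sumr; apply: ler_sum => k _; rewrite normrM mulrC; apply: ler_pM => //.
    exact: centered_norm.
  apply: ler_wpM2l; first exact: ltW.
  apply: le_trans (sum_win_abs ii0).
  rewrite [leRHS](big_cat_nat (n := M.+1))//=; last by rewrite -mS ltnS.
    rewrite lerDl; apply: sumr_ge0 => k _; rewrite addr_ge0//.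
    by have /andP[] := sg01 k.
  by rewrite ltnW.
have b3 := hi2 i (leq_trans (leq_addl _ _) ii).
have b4 : K * (3 * w i) <= e / 4 * (succs x (m i))%:R.
  rewrite mulrA [K * 3]mulrC -ler_pdivlMl ?mulr_gt0// mulrA [_^-1 * _]mulrC.
  exact: b3.
have b5 := mono _ _ (ltnW h1).
have b6 := hM0 M (leq_trans (leq_addr _ _) hM); rewrite ler_pdivrMr in b6; last by rewrite divr_gt0.
have b7 := ler_wpM2r (ler0n R (succs x (m i))) hr.
have b8 := ler_wpM2l (ltW e4) b5.
have c1 := le_trans b1 (lerD (lexx A) (le_trans b7 b8)).
have c2 := le_trans b2 (le_trans b4 b8).
apply: le_trans (lerD c1 c2) _; apply: le_trans (lerD (lerD b6 (lexx _)) (lexx _)) _.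
by rewrite le_eqVlt; apply/orP; left; apply/eqP; field.
Qed.

Lemma ae_coboundary_negligible (g : Y -> R) : bmf g ->
  {ae mu, forall y, negligible_sum
    (twisted_sum (fun k => g (iter k T y) - g (iter k.+1 T y)))}.
Proof.
move=> bg; have bf : bmf (fun y => g y - g (T y)).
  by apply: bmfB => //; exact: (bmf_comp mpT).
have := ae_centered_negligible bf; apply: filterS => y hy.
have [_ [K hK]] := bg.
have := negligible_sumD hy (@compensator_coboundary (fun k => g (iter k T y)) K (fun k => hK _)).
apply: negligible_sum_ext => M; rewrite -big_split /=; apply: eq_big_nat => k /andP[k0 _].
by rewrite twisted_split// mulrDl.
Qed.

Hypothesis th_mean : forall e : R, 0 < e -> exists N0, forall N, (N0 <= N)%N ->
  `|\sum_(1 <= n < N.+1) th n| <= e * N%:R.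

(** For constant values, reindexing by the successes leaves the plain means of [th]. *)
Lemma invariant_negligible (a : R) : negligible_sum (twisted_sum (fun=> a)).
Proof.
apply: (@negligible_sum_ext (fun M => a * \sum_(1 <= n < (succs x M).+1) th n)).
  move=> M; rewrite -sum_succs mulr_sumr; apply: eq_bigr => k _.
  by rewrite mulrC.
apply: negligible_sumZ => e e0; have [N0 hN0] := th_mean e0.
have [M0 hM0] := succs_infty N0%:R; exists M0 => M /hM0; rewrite ler_nat => h.
exact: hN0.
Qed.

End System.
End TwistedAverages.

(** * Decomposition into a small, a coboundary and an invariant part *)

Section Approximation.
Variables (R : realType) (d : measure_display) (Y : measurableType d).
Variables (mu : probability Y R) (T : Y -> Y).
Hypothesis mpT : measure_preserving mu T.

Lemma bmf_approximation (f : Y -> R) (e : R) : mu.-integrable setT (EFin \o f) -> 0 < e ->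
  exists g, bmf g /\ mean mu (fun y => `|f y - g y|) <= e.
Proof.
move=> intf e0.
have [g [intg _ cvg]] := @approximation_sfun_integrable _ _ _ mu setT measurableT _ intf.
have /fine_cvgP[_ /cvgrPdist_lt h] := cvg.
have [N _ /(_ N (leqnn _)) hN] := h e e0.
exists (HBSimple.SimpleFun.sort (g N)); split.
  split; first by have /integrableP[/measurable_EFinP] := intg N.
  have [K [_ hK]] := simple_bounded (g N).
  by exists (K + 1) => y; apply: (hK (K + 1)) => //; rewrite ltrDl.
apply: ltW; move: hN; rewrite sub0r normrN; apply: le_lt_trans.
rewrite /=; exact: ler_norm.
Qed.

Lemma birkhoff_sum_coboundary (f : Y -> R) n y :
  birkhoff_sum T f n y - birkhoff_sum T f n (T y) = f y - f (iter n T y).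
Proof.
have := birkhoff_sumS T f n y; rewrite {1}/birkhoff_sum big_nat_recr//= -/(birkhoff_sum T f n y).
by move=> h; apply/eqP; rewrite subr_eq addrAC -h addrK.
Qed.

Lemma coboundary_approximation (f : Y -> R) (e : R) : mu.-integrable setT (EFin \o f) -> 0 < e ->
  exists h G fs, [/\ mu.-integrable setT (EFin \o h), bmf G, forall y, fs (T y) = fs y,
    mean mu (fun y => `|h y|) <= e & forall y, f y = h y + (G y - G (T y)) + fs y].
Proof.
move=> intf e0; have e2 : 0 < e / 2 by rewrite divr_gt0.
have [g [bg hg]] := bmf_approximation intf e2.
have [fs [bfs fsT hfs]] := mean_ergodic mpT bg.
have [n hn] := hfs _ e2.
(* The mean of the first Birkhoff sums solves [G - G o T = g - time_mean T g n]. *)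
pose G y := n.+1%:R^-1 * \sum_(0 <= i < n.+1) birkhoff_sum T g i y.
have bG : bmf G by apply: bmfZ; apply: bmf_sum => i; exact: (bmf_birkhoff mpT).
have GE y : G y - G (T y) = g y - time_mean T g n y.
  rewrite /G -mulrBr -sumrB; under eq_bigr do rewrite birkhoff_sum_coboundary.
  rewrite sumrB mulrBr; congr (_ - _).
  by rewrite sumr_const_nat subn0 -[g y *+ _]mulr_natl mulrA mulVf ?mul1r// pnatr_eq0.
pose h1 y := f y - g y; pose h2 y := time_mean T g n y - fs y.
have bh2 : bmf h2 by apply: bmfB => //; exact: (bmf_time_mean mpT).
have ih1 : mu.-integrable setT (EFin \o h1).
  by apply: (@integrableB _ _ _ mu setT measurableT (EFin \o f) (EFin \o g)) => //; exact: bmf_integrable.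
have ih2 := bmf_integrable mu bh2.
exists (fun y => h1 y + h2 y), G, fs; split => //.
- exact: (@integrableD _ _ _ mu setT measurableT (EFin \o h1) (EFin \o h2)).
- apply: (@le_trans _ _ (mean mu (fun y => `|h1 y| + `|h2 y|))).
    apply: le_Rintegral => //.
    + apply: (@integrable_norm _ _ _ mu setT (fun y => h1 y + h2 y)).
      exact: (@integrableD _ _ _ mu setT measurableT (EFin \o h1) (EFin \o h2)).
    + apply: (@integrableD _ _ _ mu setT measurableT (EFin \o (fun y => `|h1 y|)) (EFin \o (fun y => `|h2 y|))).
        exact: integrable_norm.
      exact: integrable_norm.
    + by move=> y _; exact: ler_normD.
  rewrite [leLHS]RintegralD//; [|exact: integrable_norm|exact: integrable_norm].
  have : mean mu (fun y => `|h1 y|) <= e / 2 by [].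
  have : mean mu (fun y => `|h2 y|) <= e / 2 by [].
  by rewrite /mean; lra.
- by move=> y; rewrite GE /h1 /h2; ring.
Qed.

End Approximation.

Section BanachPrinciple.
Variables (R : realType) (x : nat -> bool) (th : nat -> R).
Hypothesis th1 : forall n, `|th n| <= 1.
Hypothesis succs_infty : forall A : R, exists M0, forall M, (M0 <= M)%N -> A <= (succs x M)%:R.
Hypothesis invariant_sum : forall a : R, negligible_sum x (twisted_sum x th (fun=> a)).
Variables (d : measure_display) (Y : measurableType d).
Variables (mu : probability Y R) (T : Y -> Y) (Cw Ct : R).
Hypothesis mpT : measure_preserving mu T.
Hypothesis Cw0 : 0 <= Cw.
Hypothesis weak_type : forall (h : Y -> R) (t : R), mu.-integrable setT (EFin \o h) ->
  (forall y, 0 <= h y) -> 0 < t -> exists U, [/\ measurable U,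
    (mu U <= (Cw * (mean mu h / t))%:E)%E & forall y, ~ U y -> exists (A : R) (M1 : nat),
    forall M, (M1 <= M)%N -> \sum_(1 <= k < M.+1) (x k)%:R * h (iter k T y) <=
    A + Ct * t * (succs x M)%:R].
Hypothesis coboundary_sum : forall g : Y -> R, bmf g -> {ae mu, forall y, negligible_sum x
    (twisted_sum x th (fun k => g (iter k T y) - g (iter k.+1 T y)))}.

(** At stage [r] the small part has mean at most [b r * t r], so the weak type inequality at level
    [t r] leaves out a set of measure at most [Cw * b r], which is summable. Almost every point is
    therefore good for all large [r], while the levels [t r] tend to 0. *)
Lemma ae_negligible_integrable (f : Y -> R) : mu.-integrable setT (EFin \o f) ->
  {ae mu, forall y, negligible_sum x (twisted_sum x th (fun k => f (iter k T y)))}.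
Proof.
move=> intf; pose t r : R := r.+1%:R^-1; pose b r : R := (1 / 2) ^+ r.
have t0 r : 0 < t r by rewrite invr_gt0 ltr0n.
have b0 r : 0 < b r by rewrite exprn_gt0// divr_gt0.
have A1 r : exists hGf : (Y -> R) * (Y -> R) * (Y -> R),
    [/\ mu.-integrable setT (EFin \o hGf.1.1), bmf hGf.1.2, forall y, hGf.2 (T y) = hGf.2 y,
    mean mu (fun y => `|hGf.1.1 y|) <= b r * t r &
    forall y, f y = hGf.1.1 y + (hGf.1.2 y - hGf.1.2 (T y)) + hGf.2 y].
  have [h [G [fs [? ? ? ? ?]]]] := coboundary_approximation mpT intf (mulr_gt0 (b0 r) (t0 r)).
  by exists (h, G, fs).
have {A1}[hGf hG] := choice A1.
have A2 r : exists U, [/\ measurable U, (mu U <= (Cw * b r)%:E)%E &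
    forall y, ~ U y -> exists (A : R) (M1 : nat),
    forall M, (M1 <= M)%N -> \sum_(1 <= k < M.+1) (x k)%:R * `|(hGf r).1.1 (iter k T y)| <=
    A + Ct * t r * (succs x M)%:R].
  have [ih _ _ hm _] := hG r.
  have [U [mU hU UP]] := weak_type (integrable_norm ih) (fun y => normr_ge0 _) (t0 r).
  exists U; split => //; apply: le_trans hU _; rewrite lee_fin; apply: ler_wpM2l => //.
  by rewrite ler_pdivrMr.
have {A2}[U hU] := choice A2.
have sumb n : \sum_(0 <= i < n) Cw * b i <= Cw * 2.
  rewrite -mulr_sumr; apply: ler_wpM2l => //.
  have -> : \sum_(0 <= i < n) b i = 2 - 2 * b n; last by have := b0 n; lra.
  elim: n => [|n IH]; first by rewrite big_geq// /b expr0; lra.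
  by rewrite big_nat_recr//= IH /b exprS; field.
have mU r : measurable (U r) by have [] := hU r.
have PU r : (mu (U r) <= (Cw * b r)%:E)%E by have [] := hU r.
have B1 := borel_cantelli mU PU sumb.
have B2 : {ae mu, forall y, forall r, negligible_sum x (twisted_sum x th
    (fun k => (hGf r).1.2 (iter k T y) - (hGf r).1.2 (iter k.+1 T y)))}.
  by apply: ae_exists_forall => r; apply: coboundary_sum; have [] := hG r.
move: B1 B2; apply: filterS2 => y [r0 hr0] hc e e0.
have e4 : 0 < e / 4 by rewrite divr_gt0.
pose r := (r0 + Num.truncn (Ct / (e / 4)))%N.
have tr : Ct * t r <= e / 4.
  rewrite /t ler_pdivrMr ?ltr0n// mulrC -ler_pdivrMr//; apply: le_trans (ltW (truncnS_gt _)) _.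
  by rewrite ler_nat ltnS leq_addl.
have [ih bG fsT _ fE] := hG r; have [_ _ /(_ y (hr0 r (leq_addr _ _)))] := hU r.
move=> [A [M1 hA]]; have [M2 hM2] := hc r _ e4.
have [M3 hM3] := invariant_sum ((hGf r).2 y) e4.
have [M4 hM4] := succs_infty (A / (e / 4)).
exists (M1 + M2 + M3 + M4)%N => M hM.
have [[l1 l2] [l3 l4]] : ((M1 <= M) /\ (M2 <= M))%N /\ ((M3 <= M) /\ (M4 <= M))%N by move: hM; clear; lia.
have fsi k : (hGf r).2 (iter k T y) = (hGf r).2 y by elim: k => //= k <-; rewrite fsT.
have -> : twisted_sum x th (fun k => f (iter k T y)) M =
    twisted_sum x th (fun k => (hGf r).1.1 (iter k T y)) M +
    twisted_sum x th (fun k => (hGf r).1.2 (iter k T y) - (hGf r).1.2 (iter k.+1 T y)) M +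
    twisted_sum x th (fun=> (hGf r).2 y) M.
  by rewrite -!twisted_sumD; apply: eq_bigr => k _; rewrite fE fsi.
have c1 := le_trans (twisted_sum_le x th1 _ M) (hA M l1).
have c2 := hM2 M l2; have c3 := hM3 M l3.
have := hM4 M l4; rewrite ler_pdivrMr// => c4.
have c5 := ler_wpM2r (ler0n R (succs x M)) tr.
apply: le_trans (ler_normD _ _) _; apply: le_trans (lerD (ler_normD _ _) (lexx _)) _.
apply: le_trans (lerD (lerD (le_trans c1 (lerD c4 c5)) c2) c3) _.
by rewrite le_eqVlt; apply/orP; left; apply/eqP; field.
Qed.

End BanachPrinciple.

(** * Dyadic and polynomial windows *)

Section Growth.
Variable R : realType.
Implicit Types (z al be eta : R).

Lemma arith_geom_sum z al be n : 0 <= z < 1 -> 0 <= al -> 0 <= be ->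
  \sum_(0 <= j < n) (al + be * j%:R) * z ^+ j <= al / (1 - z) + be / (1 - z) ^+ 2.
Proof.
move=> /andP[z0 z1] al0 be0; have d0 : 0 < 1 - z by rewrite subr_gt0.
have d1 : 1 - z != 0 by rewrite gt_eqF.
(* The exact sum together with its remainder, which is nonnegative and makes the induction close. *)
have E : \sum_(0 <= j < n) (al + be * j%:R) * z ^+ j +
    z ^+ n * ((al + be * n%:R) / (1 - z) + be * z / (1 - z) ^+ 2) =
    al / (1 - z) + be * z / (1 - z) ^+ 2.
  elim: n => [|n IH]; first by rewrite big_geq// expr0; field.
  by rewrite big_nat_recr//= -IH exprS -[n.+1%:R]natr1; field.
have h1 : be * z / (1 - z) ^+ 2 <= be / (1 - z) ^+ 2.
  by rewrite ler_pM2r ?invr_gt0 ?exprn_gt0// ler_piMr// ltW.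
apply: le_trans (lerD (lexx _) h1); rewrite -E lerDl.
apply: mulr_ge0; first exact: exprn_ge0.
have d2 : 0 <= (1 - z)^-1 by rewrite invr_ge0 ltW.
by rewrite -exprVn; apply: addr_ge0; apply: mulr_ge0; rewrite ?exprn_ge0//; [apply: addr_ge0|]; rewrite ?mulr_ge0.
Qed.

Lemma geom_small z eta : 0 <= z < 1 -> 0 < eta -> exists j0, forall j, (j0 <= j)%N -> z ^+ j <= eta.
Proof.
move=> /andP[z0 z1] eta0; have : `|z| < 1 by rewrite ger0_norm.
move=> /cvg_expr /cvgrPdist_lt /(_ eta eta0) [j0 _ h]; exists j0 => j /h /=.
by rewrite sub0r normrN ger0_norm ?exprn_ge0// => /ltW.
Qed.

Lemma arith_geom_small z al be eta : 0 <= z < 1 -> 0 <= al -> 0 <= be -> 0 < eta ->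
  exists j0, forall j, (j0 <= j)%N -> (al + be * j%:R) * z ^+ j <= eta.
Proof.
(* Half of the decay, a factor [y^j], absorbs the linear term, and the other half tends to 0. *)
move=> /andP[z0 z1] al0 be0 eta0; pose y := Num.sqrt z.
have y0 : 0 <= y by exact: sqrtr_ge0.
have yz : y ^+ 2 = z by rewrite sqr_sqrtr.
have y1 : y < 1 by rewrite -(ltr_sqr (x := y)) ?nnegrE// yz expr1n.
have y01 : 0 <= y < 1 by rewrite y0.
pose K := al / (1 - y) + be / (1 - y) ^+ 2.
have K0 : 0 <= K.
  have := @arith_geom_sum y al be 0 y01 al0 be0; by rewrite big_geq.
have hK j : (al + be * j%:R) * y ^+ j <= K.
  apply: le_trans (@arith_geom_sum y al be j.+1 y01 al0 be0).
  rewrite big_nat_recr//= lerDr; apply: sumr_ge0 => i _.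
  by apply: mulr_ge0; rewrite ?exprn_ge0// addr_ge0// mulr_ge0.
have [j0 hj] := @geom_small y (eta / (K + 1)) y01 ltac:(by rewrite divr_gt0// ltr_wpDl).
exists j0 => j /hj h; rewrite -yz -exprM mul2n -addnn exprD mulrA.
apply: (@le_trans _ _ (K * (eta / (K + 1)))).
  apply: ler_pM => //; rewrite ?exprn_ge0// mulr_ge0 ?exprn_ge0// addr_ge0// mulr_ge0//.
rewrite mulrCA ler_piMr ?ltW// ltr_pdivrMr ?mul1r ?ltrDl// ltr_wpDl//.
Qed.

Lemma ln_natX_le (b n : nat) : (0 < b)%N -> ln (b ^ n)%:R <= n%:R * (b%:R - 1) :> R.
Proof.
move=> b0; have b0' : 0 < b%:R :> R by rewrite ltr0n.
rewrite natrX lnXn// -[ln _ *+ n]mulr_natl; apply: ler_wpM2l => //.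
rewrite -{1}(subrKC 1 b%:R); apply: le_ln1Dx; rewrite ltrBrDl subrr//.
Qed.

Lemma window_count_bounds (c S e Q : R) : Q / 2 <= S <= Q -> `|c - S| <= e -> e <= Q / 4 ->
  0 <= Q -> Q / 4 <= c <= 2 * Q.
Proof.
move=> /andP[h1 h2]; rewrite ler_norml => /andP[h3 h4] h5 h6.
by apply/andP; split; lra.
Qed.

End Growth.

(** * The weights n^(-a) on dyadic windows *)

Section PowerWeights.
Variables (R : realType) (a : R).
Hypothesis ha : 0 < a < 1 / 2.
Definition power_weight k : R := k%:R `^ (- a).

Lemma power_weight01 k : 0 <= power_weight k <= 1.
Proof.
rewrite powR_ge0 /=; case: k => [|k].
  by rewrite /power_weight powR0//; case/andP: ha => h _; rewrite oppr_eq0 gt_eqF.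
rewrite /power_weight powRN invf_le1 ?powR_gt0 ?ltr0n// -[leLHS](powRr0 k.+1%:R).
by apply: ler_powR; rewrite ?ler1n//; case/andP: ha => /ltW.
Qed.

Lemma power_weight_le k k' : (0 < k)%N -> (k <= k')%N -> power_weight k' <= power_weight k.
Proof.
move=> k0 kk; rewrite /power_weight !powRN lef_pV2 ?posrE ?powR_gt0 ?ltr0n//; last exact: leq_trans kk.
by apply: ge0_ler_powR; rewrite ?nnegrE ?ler_nat//; case/andP: ha => /ltW.
Qed.

Lemma power_weightM k k' : power_weight (k * k') = power_weight k * power_weight k'.
Proof. by rewrite /power_weight natrM powRM. Qed.

Lemma power_weightX k n : power_weight (k ^ n) = power_weight k ^+ n.
Proof.
elim: n => [|n IH]; first by rewrite expr0 expn0 /power_weight powR1.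
by rewrite expnS exprS power_weightM IH.
Qed.

Lemma power_weight_gt0 k : (0 < k)%N -> 0 < power_weight k.
Proof. by move=> k0; rewrite powR_gt0// ltr0n. Qed.

(** On dyadic scales [a < 1/2] enters here, as [2^(1/2 - a) > 1]. *)
Lemma power_weight2 : 1 < power_weight 2 * Num.sqrt 2 /\ power_weight 2 < 1.
Proof.
have /andP[a0 a2] := ha; split.
  rewrite /power_weight -powR12_sqrt// -powRD; last by rewrite pnatr_eq0 /= implybT.
  rewrite -[ltLHS](powRr0 2) /powR pnatr_eq0 /= ltr_expR mul0r mulr_gt0 ?ln_gt0 ?ltr1n//; lra.
by rewrite /power_weight powRN invf_lt1 ?powR_gt0// -[ltLHS](powRr0 2) /powR pnatr_eq0 /= ltr_expR mul0r mulr_gt0 ?ln_gt0 ?ltr1n.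
Qed.

Lemma power_weight_cvg0 (eta : R) : 0 < eta -> exists k0, forall k, (k0 <= k)%N -> power_weight k <= eta.
Proof.
move=> eta0; have [_ h] := power_weight2.
have [j0 hj] := @geom_small R (power_weight 2) eta ltac:(by rewrite powR_ge0) eta0.
exists (2 ^ j0)%N => k hk; apply: le_trans (hj j0 (leqnn _)); rewrite -power_weightX.
by apply: power_weight_le => //; rewrite expn_gt0.
Qed.

Section DyadicWindows.
Variable x : nat -> bool.
Let v := power_weight 2.
Let q := 2 * v.
Let L j := (2 ^ j)%N.
Hypothesis reg : exists j1, forall j, (j1 <= j)%N ->
  regular_window power_weight (fun=> 1) x (L j) (L j) (v ^+ j).

Lemma dyadic_weights j k : (L j < k <= L j + L j)%N -> v ^+ j.+1 <= power_weight k <= v ^+ j.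
Proof.
move=> /andP[h1 h2]; rewrite -!power_weightX; have L0 : (0 < L j)%N by rewrite expn_gt0.
apply/andP; split; apply: power_weight_le => //; [exact: leq_ltn_trans h1 |by rewrite expnS mul2n -addnn|exact: ltnW].
Qed.

Lemma dyadic_window_regular j : [/\ (j < L j)%N, 0 <= v ^+ j <= 1 & 1 <= v ^+ j * Num.sqrt (L j)%:R].
Proof.
have [h1 h2] := power_weight2; have v0 := powR_ge0 2 (- a).
split; first exact: ltn_expl.
  by rewrite exprn_ge0//= exprn_ile1// ltW.
have -> : Num.sqrt (L j)%:R = Num.sqrt 2 ^+ j :> R.
  rewrite /L natrX; elim: j => [|j IH]; first by rewrite !expr0 sqrtr1.
  by rewrite !exprS sqrtrM// IH.
by rewrite -exprMn exprn_ege1// ltW.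
Qed.

Lemma dyadic_regular : exists (rho : nat -> R) (Krho : R) (j0 : nat), 
  [/\ forall j, 0 <= rho j, forall J, \sum_(0 <= j < J) rho j <= Krho,
   forall j, (j0 <= j)%N -> win_count R x (L j) (L j) <= 2 * q ^+ j,
   forall j, (j0 <= j)%N -> q ^+ j / 4 <= win_count R x (L j) (L j) &
   forall j g, (j0 <= j)%N -> (0 < g < L j)%N ->
   `|lag_sum (fun k => (x k)%:R - power_weight k) (L j) (L j) g|
      <= rho j * (q ^+ j) ^+ 2 / (L j)%:R].
Proof.
have [hv hv1] := power_weight2; have v0 : 0 < v by exact: power_weight_gt0.
have s2 : Num.sqrt 2 ^+ 2 = 2 :> R by rewrite sqr_sqrtr.
have s20 : 0 < Num.sqrt 2 :> R by rewrite sqrtr_gt0.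
have q0 : 0 < q by rewrite mulr_gt0.
have qE : q = Num.sqrt 2 * (power_weight 2 * Num.sqrt 2) by rewrite mulrCA -expr2 s2 mulrC.
have s21 : 1 < Num.sqrt 2 :> R by rewrite -[ltLHS]sqrtr1 ltr_sqrt ?ltr0n// ltr1n.
have q1 : 1 < q by rewrite qE; move: hv s21; move: (power_weight 2 * _) => u; move: (Num.sqrt 2) => w; nra.
have v_half : 1 / 2 < v by move: q1; rewrite /q; lra.
pose sq := Num.sqrt q; have sqE : sq ^+ 2 = q by rewrite sqr_sqrtr// ltW.
have sq1 : 1 < sq by rewrite -[ltLHS]sqrtr1 ltr_sqrt// ltr0n.
have z1 : 0 <= sq^-1 < 1 by rewrite invr_ge0 sqrtr_ge0/= invf_lt1// (lt_trans ltr01).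
(* Up to a factor linear in [j], a lag sum has order [q^j / sqrt(L j)]; its quotient by the target
   [(q^j)^2 / L j] is [sqrt(L j) / q^j = z^j]. *)
pose z := Num.sqrt 2 / q.
have z01 : 0 <= z < 1.
  by rewrite divr_ge0 ?ltW//= ltr_pdivrMr// mul1r qE ltr_pMr.
have [j1 hreg] := reg.
(* From [j2] on, the counting error [(1 + 8 j) sqrt(q^j)] is at most a quarter of [q^j]. *)
have [j2 hj2] := arith_geom_small (al := 1) (be := 8) z1 ler01 (ler0n _ 8) (divr_gt0 ltr01 (ltr0n R 4)).
pose rho j : R := (3 + 8 * j%:R) * z ^+ j.
have L0 j : 0 < (L j)%:R :> R by rewrite ltr0n expn_gt0.
have qj0 j : 0 < q ^+ j by rewrite exprn_gt0.
have qL j : (L j)%:R * v ^+ j = q ^+ j by rewrite /L natrX -exprMn.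
have lnL j : ln (L j)%:R <= j%:R :> R.
  have := @ln_natX_le R 2 j isT; rewrite (_ : 2%:R - 1 = 1 :> R) ?mulr1//; ring.
have sumsg j : v * q ^+ j <= \sum_((L j).+1 <= k < (L j + L j).+1) power_weight k <= q ^+ j.
  have cst (c : R) : \sum_((L j).+1 <= k < (L j + L j).+1) c = (L j)%:R * c.
    by rewrite sumr_const_nat subSS addnK -[c *+ _]mulr_natl.
  rewrite -{1}qL mulrCA -exprS -qL -!cst; apply/andP.
  by split; apply: ler_sum_nat => k hk; have /andP[] := @dyadic_weights j k hk.
have err j : (j2 <= j)%N -> (1 + 8 * ln (L j)%:R) * Num.sqrt ((L j)%:R * v ^+ j) <= q ^+ j / 4.
  move=> /hj2; have sj0 : 0 < sq ^+ j by rewrite exprn_gt0// (lt_trans ltr01).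
  have -> : q ^+ j = sq ^+ j * sq ^+ j by rewrite -expr2 exprAC sqE.
  rewrite qL (_ : Num.sqrt (q ^+ j) = sq ^+ j); last first.
    by rewrite -sqE exprAC sqrtr_sqr gtr0_norm.
  rewrite exprVn ler_pdivrMr// => h; rewrite mulrC -mulrA; apply: ler_wpM2l; first exact: ltW.
  apply: le_trans (lerD (lexx 1) (ler_wpM2l (ler0n R 8) (lnL j))) _.
  by apply: le_trans h _; rewrite div1r mulrC.
have count j : (j1 + j2 <= j)%N -> q ^+ j / 4 <= win_count R x (L j) (L j) <= 2 * q ^+ j.
  move=> hj; have [h _] := hreg j (leq_trans (leq_addr _ _) hj).
  have /andP[h2 h3] := sumsg j.
  apply: (window_count_bounds _ h (err j (leq_trans (leq_addl _ _) hj)) (ltW (qj0 j))).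
  rewrite h3 andbT; apply: le_trans h2; rewrite mulrC ler_pM2r// ltW//.
  by rewrite -[ltLHS]mul1r.
exists rho, (3 / (1 - z) + 8 / (1 - z) ^+ 2), (j1 + j2)%N; split.
- move=> j; apply: mulr_ge0; first by rewrite addr_ge0// mulr_ge0.
  by apply: exprn_ge0; case/andP: z01.
- by move=> J; exact: arith_geom_sum.
- by move=> j /count /andP[].
- by move=> j /count /andP[].
- move=> j g hj hg; have [h1 h2] := hreg j (leq_trans (leq_addr _ _) hj).
  have -> : lag_sum (fun k => (x k)%:R - power_weight k) (L j) (L j) g =
      lag_sum (centered power_weight (fun=> 1) x) (L j) (L j) g.
    by apply: eq_bigr => k _; rewrite /centered !mulr1.
  apply: le_trans (h2 g hg) _; rewrite qL.
  have /andP[_ hc] := count j hj.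
  pose sL : R := Num.sqrt 2 ^+ j; have sL0 : 0 < sL by rewrite exprn_gt0.
  have LE : (L j)%:R = sL * sL by rewrite -expr2 exprAC s2 /L natrX.
  have -> : Num.sqrt (L j)%:R = sL by rewrite LE -expr2 sqrtr_sqr gtr0_norm.
  have -> : v ^+ j * sL = q ^+ j / sL.
    by rewrite -qL LE; field; rewrite gt_eqF.
  have -> : rho j * (q ^+ j) ^+ 2 / (L j)%:R = (3 + 8 * j%:R) * (q ^+ j / sL).
    rewrite /rho /z exprMn exprVn -/sL LE; field.
    by rewrite !gt_eqF//.
  have b0 : 0 <= q ^+ j / sL by rewrite divr_ge0// ltW.
  rewrite [leRHS]mulrDl; apply: lerD.
    rewrite mulrA ler_pM2r ?invr_gt0//; apply: le_trans (lerD hc (lexx _)) _.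
    by rewrite le_eqVlt; apply/orP; left; apply/eqP; ring.
  by apply: ler_wpM2r => //; apply: ler_wpM2l.
Qed.

End DyadicWindows.
End PowerWeights.

(** Bernoulli's inequality [(1 - 1/y)^n >= 1 - n/y] multiplied by [y^(n+1)]. *)
Lemma bernoulli_sub (R : realType) (y : R) n : 1 <= y -> y ^+ n * (y - n%:R) <= y * (y - 1) ^+ n.
Proof.
move=> y1; have y0 : 0 <= y by lra.
elim: n => [|n IH]; first by rewrite !expr0 subr0 mulrC.
rewrite [in leRHS]exprS mulrCA; apply: le_trans (ler_wpM2l _ IH); last by rewrite subr_ge0.
have -> : y ^+ n.+1 * (y - n.+1%:R) = (y - 1) * (y ^+ n * (y - n%:R)) - y ^+ n * n%:R.
  by rewrite exprS -[n.+1%:R]natr1; ring.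
by rewrite lerBlDr lerDl mulr_ge0// exprn_ge0.
Qed.

(** * The weights n^(-a) on polynomial windows *)

Section PolynomialWindows.
Variables (R : realType) (a : R).
Hypothesis ha : 0 < a < 1 / 2.
Variable B : nat.
Hypothesis hB : 4 <= B%:R * (1 / 2 - a).
Let m i := (i ^ B)%N.
Let l i := (i.+1 ^ B - i ^ B)%N.
Let s i := power_weight a (m i).
Let w i := (l i)%:R * s i.

Lemma window_degree : (8 < B)%N.
Proof.
rewrite -(ltr_nat R) -(ltr_pM2r (x := 1 / 2)) ?divr_gt0//.
apply: (@le_lt_trans _ _ (B%:R * (1 / 2 - a))).
  by apply: le_trans hB; rewrite le_eqVlt; apply/orP; left; apply/eqP; field.
rewrite ltr_pM2l; first by case/andP: ha => h1 h2; lra.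
rewrite ltr0n lt0n; apply/eqP => B0; move: hB; by rewrite B0 mul0r leNgt ltr0n.
Qed.

Lemma windows_consecutive i : m i.+1 = (m i + l i)%N.
Proof. by rewrite /m /l subnKC// leq_exp2r// (leq_trans _ window_degree). Qed.

Lemma window_length_ge i : (i ^ B.-1 <= l i)%N.
Proof.
have B0 : (0 < B)%N by exact: leq_trans window_degree.
rewrite /l leq_subRL; last by rewrite leq_exp2r.
by rewrite -{1 3}(prednK B0) !expnS addnC -mulSn leq_pmul2l// leq_exp2r//; have := window_degree; lia.
Qed.

Lemma window_length_gt0 i : (0 < l i)%N.
Proof. by rewrite /l subn_gt0 ltn_exp2r// (leq_trans _ window_degree). Qed.

(** Relative to its starting point the window has length of order [B / i], which tends to 0, unlike
    that of a dyadic window. *)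
Lemma window_length_le i : (2 * B <= i.+1)%N ->
  (l i <= m i)%N /\ i.+1%:R * (l i)%:R <= 2 * B%:R * (m i)%:R :> R.
Proof.
move=> hi; have := @bernoulli_sub R i.+1%:R B ltac:(by rewrite ler1n).
have -> : i.+1%:R - 1 = i%:R :> R by rewrite -natr1 addrK.
rewrite -!natrX -/(m i) -/(m i.+1) => h.
have hB2 : B%:R <= i.+1%:R / 2 :> R by rewrite ler_pdivlMr// mulrC -natrM ler_nat.
have y0 : 0 < i.+1%:R :> R by rewrite ltr0n.
have h2 : (m i.+1)%:R <= 2 * (m i)%:R :> R.
  have h3 : (m i.+1)%:R * (i.+1%:R / 2) <= i.+1%:R * (m i)%:R :> R.
    apply: le_trans h; apply: ler_wpM2l => //; move: hB2; move: (i.+1%:R) (B%:R) => u v; lra.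
  rewrite -(ler_pM2r (x := i.+1%:R / 2)); last by rewrite divr_gt0.
  by apply: le_trans h3 _; rewrite le_eqVlt; apply/orP; left; apply/eqP; field.
split.
  by move: h2; rewrite -natrM ler_nat windows_consecutive; lia.
have -> : (l i)%:R = (m i.+1)%:R - (m i)%:R :> R by rewrite windows_consecutive natrD addrAC subrr add0r.
rewrite mulrBr; move: h; rewrite mulrBr lerBlDr => h.
rewrite lerBlDl; rewrite mulrC in h; apply: le_trans h _; rewrite lerD2l.
by rewrite mulrC [2 * _]mulrC -mulrA; apply: ler_wpM2l.
Qed.

Lemma window_weight01 i : 0 <= s i <= 1.
Proof. exact: power_weight01. Qed.

(** The exponent of [i] is [- a B + (B - 1) / 2 = B (1/2 - a) - 1/2], and the choice of [B] makes it
    at least 7/2. *)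
Lemma window_weight_ge i : (0 < i)%N -> i%:R ^+ 3 <= s i * Num.sqrt (l i)%:R.
Proof.
move=> i0; have i0' : 0 < i%:R :> R by rewrite ltr0n.
have iN0 : i%:R != 0 :> R by rewrite gt_eqF.
have B1 : (0 < B)%N by exact: leq_trans window_degree.
apply: (@le_trans _ _ (s i * Num.sqrt (i ^ B.-1)%:R)); last first.
  apply: ler_wpM2l; first by case/andP: (window_weight01 i).
  by apply: ler_wsqrtr; rewrite ler_nat window_length_ge.
rewrite /s /power_weight /m !natrX -!powR_mulrn ?(ltW i0')//.
rewrite -powR12_sqrt ?powR_ge0// -!powRrM -powRD; last by rewrite iN0 implybT.
apply: ler_powR; first by rewrite ler1n.
have -> : B.-1%:R = B%:R - 1 :> R by rewrite -[in RHS](prednK B1) -natr1 addrK.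
by move: hB; move: (B%:R) => b; lra.
Qed.

Lemma polynomial_window_regular i : (2 <= i)%N -> [/\ (i < l i)%N, 0 <= s i <= 1,
  1 <= s i * Num.sqrt (l i)%:R & forall k, (m i < k <= m i + l i)%N -> power_weight a k <= s i].
Proof.
move=> i2; have i0 : (0 < i)%N by exact: ltnW.
split.
- apply: leq_trans (window_length_ge i); rewrite -{1}(expn1 i) ltn_exp2l//.
  by have := window_degree; lia.
- exact: window_weight01.
- apply: le_trans (window_weight_ge i0); rewrite -natrX ler1n expn_gt0 i0//.
- by move=> k /andP[h _]; apply: power_weight_le => //; [rewrite expn_gt0 i0|exact: ltnW].
Qed.

Section RegularSequence.
Variables (x : nat -> bool) (th : nat -> R).
Hypothesis reg : exists i1, forall i, (i1 <= i)%N ->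
  regular_window (power_weight a) th x (m i) (l i) (s i).

Let C : R := 9 + 16 * B%:R.
(** The product in the denominator makes the sum telescope. The 6 comes from
    [(i + 1) (i + 2) <= 6 i^2], and [C] from [9 + 16 ln(l i) <= C i]. *)
Let beta i : R := 6 * C / (i.+1%:R * i.+2%:R).

Lemma window_mass_ge i : (0 < i)%N -> i%:R ^+ 4 <= w i.
Proof.
move=> i0; have h := window_weight_ge i0; have i1 : 1 <= i%:R :> R by rewrite ler1n.
have /andP[s0 s1] := window_weight01 i.
have l0 : 0 <= (l i)%:R :> R by [].
apply: (@le_trans _ _ ((s i * Num.sqrt (l i)%:R) ^+ 2)).
  apply: (@le_trans _ _ ((i%:R ^+ 3) ^+ 2)).
    by rewrite -exprM ler_weXn2l.
  by rewrite ler_sqr ?nnegrE ?exprn_ge0// mulr_ge0// sqrtr_ge0.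
by rewrite exprMn sqr_sqrtr// expr2 /w mulrC; apply: ler_wpM2l => //; rewrite ler_piMr.
Qed.

Lemma ln_window_length i : ln (l i)%:R <= B%:R * i%:R :> R.
Proof.
have := @ln_natX_le R i.+1 B isT; rewrite -[i.+1%:R]natr1 addrK; apply: le_trans.
by rewrite ler_ln ?posrE ?ltr0n ?window_length_gt0 ?expn_gt0// ler_nat leq_subr.
Qed.

(** Within the window [k] at most doubles, and [2^(-a) >= 1/2]. *)
Lemma window_weight_sum i : (2 * B <= i.+1)%N ->
  w i / 2 <= \sum_((m i).+1 <= k < (m i + l i).+1) power_weight a k <= w i.
Proof.
move=> hi; have B8 := window_degree; have i2 : (2 <= i)%N by lia.
have [_ _ _ hs] := polynomial_window_regular i2; have [lm _] := window_length_le hi.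
have cst (c : R) : \sum_((m i).+1 <= k < (m i + l i).+1) c = (l i)%:R * c.
  by rewrite sumr_const_nat subSS addKn -[c *+ _]mulr_natl.
have [h1 h2] := power_weight2 ha; have /andP[s0 s1] := window_weight01 i.
have p2 : 1 / 2 <= power_weight a 2.
  have := sqr_sqrtr (ler0n R 2); have := sqrtr_ge0 (2 : R); move: h1.
  move: (power_weight a 2) (Num.sqrt 2) => u v; nra.
have m0 : (0 < m i)%N by rewrite expn_gt0 ltnW.
rewrite /w -mulrA -!cst; apply/andP; split; apply: ler_sum_nat => k hk; last exact: hs.
apply: (@le_trans _ _ (power_weight a (2 * m i))).
  by rewrite power_weightM -/(s i) mulrC; apply: ler_wpM2r => //; rewrite -div1r.
by apply: power_weight_le => //; lia.
Qed.

Lemma window_count_error i : (4 * (1 + 8 * B) <= i)%N ->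
  (1 + 8 * ln (l i)%:R) * Num.sqrt ((l i)%:R * s i) <= w i / 4.
Proof.
move=> hi; have i0 : (0 < i)%N by apply: leq_trans hi; rewrite muln_gt0.
have i1 : 1 <= i%:R :> R by rewrite ler1n.
have w4 := window_mass_ge i0.
have w0 : 0 <= w i by apply: le_trans w4; rewrite exprn_ge0.
rewrite -/(w i); pose W := Num.sqrt (w i); have WE : W ^+ 2 = w i by rewrite sqr_sqrtr.
have W2 : i%:R ^+ 2 <= W.
  rewrite -ler_sqr ?nnegrE ?exprn_ge0 ?sqrtr_ge0// WE -exprM//.
rewrite -[in leRHS]WE -/W expr2 mulrC -mulrA; apply: ler_wpM2l; first exact: sqrtr_ge0.
apply: (@le_trans _ _ (i%:R ^+ 2 / 4)); last by rewrite ler_pM2r// invr_gt0.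
have h1 : 4 * (1 + 8 * B%:R) <= i%:R :> R by move: hi; rewrite -(ler_nat R) natrM natrD natrM.
have := ln_window_length i; have := ler0n R B; move: h1 i1; rewrite expr2.
move: (ln _) (i%:R) (B%:R) => u v b; nra.
Qed.

Let C_ge0 : 0 <= C.
Proof. by apply: addr_ge0 => //; apply: mulr_ge0. Qed.

Lemma beta_ge0 i : 0 <= beta i.
Proof. by rewrite /beta -natrM; apply: divr_ge0 => //; apply: mulr_ge0. Qed.

Lemma sum_beta n : \sum_(0 <= i < n) beta i <= 6 * C.
Proof.
have C0 : 0 <= 6 * C by apply: mulr_ge0.
have -> : \sum_(0 <= i < n) beta i = 6 * C * (1 - n.+1%:R^-1).
  elim: n => [|n IH]; first by rewrite big_geq// invr1 subrr mulr0.
  rewrite big_nat_recr//= IH /beta -[n.+2%:R]natr1 -[n.+1%:R]natr1.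
  by field; have := ler0n R n => h; apply/andP; split; rewrite gt_eqF//; lra.
by rewrite ler_piMr// gerBl invr_ge0.
Qed.

(** With [r = sqrt l] and [u = s r] one has [w = r u]. All lags together have order at most
    [l u ln l], so relative to [w^2 = l u^2] the loss is [ln l / u], at most of order [i / i^3]. *)
Lemma window_lag_sum i : (2 <= i)%N -> regular_window (power_weight a) th x (m i) (l i) (s i) ->
  win_count R x (m i) (l i) <= 2 * w i ->
  3 * w i + 2 * \sum_(1 <= g < l i) `|lag_sum (centered (power_weight a) th x) (m i) (l i) g|
    <= beta i * w i ^+ 2.
Proof.
move=> i2 [_ hl] hc; have i0 : (0 < i)%N by exact: ltnW.
have hu := window_weight_ge i0; set u := s i * _ in hu.
pose r := Num.sqrt (l i)%:R : R; have rr : r * r = (l i)%:R by rewrite -expr2 sqr_sqrtr.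
have r1 : 1 <= r by rewrite -[leLHS]sqrtr1 ler_wsqrtr// ler1n window_length_gt0.
have r0 : 0 < r by exact: lt_le_trans r1.
have i1 : 1 <= i%:R :> R by rewrite ler1n.
have wE : w i = r * u by rewrite /w -rr /u -/r; ring.
have u0 : 0 <= u by apply: le_trans hu; rewrite exprn_ge0.
have ln0 : 0 <= ln (l i)%:R :> R by rewrite ln_ge0// ler1n window_length_gt0.
have hg : \sum_(1 <= g < l i) `|lag_sum (centered (power_weight a) th x) (m i) (l i) g|
   <= r * r * (3 * u + 8 * ln (l i)%:R * u).
  apply: (@le_trans _ _ (\sum_(1 <= g < l i) (3 * u + 8 * ln (l i)%:R * u))).
    apply: ler_sum_nat => g gl; apply: le_trans (hl g gl) _; rewrite -/r -/u lerD2r.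
    rewrite ler_pdivrMr// -/(w i); apply: le_trans (lerD hc (lexx _)) _.
    by rewrite wE le_eqVlt; apply/orP; left; apply/eqP; ring.
  rewrite sumr_const_nat -[_ *+ (l i - 1)]mulr_natl; apply: ler_wpM2r.
    by apply: addr_ge0; [exact: mulr_ge0|apply: mulr_ge0 => //; exact: mulr_ge0].
  by rewrite rr ler_nat leq_subr.
have hb : 9 + 16 * ln (l i)%:R <= beta i * u.
  apply: (@le_trans _ _ (beta i * i%:R ^+ 3)); last by apply: ler_wpM2l => //; exact: beta_ge0.
  apply: (@le_trans _ _ (C * i%:R)).
    by have := ln_window_length i; rewrite /C; move: i1; move: (ln _) (i%:R) (B%:R) => v j b; lra.
  rewrite /beta mulrAC ler_pdivlMr; last by rewrite mulr_gt0 ?ltr0n.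
  have -> : 6 * C * i%:R ^+ 3 = C * i%:R * (6 * i%:R ^+ 2) by ring.
  apply: ler_wpM2l; first exact: mulr_ge0.
  rewrite -[i.+2%:R]natr1 -[i.+1%:R]natr1; move: i1; move: (i%:R) => j; nra.
have -> : beta i * w i ^+ 2 = r * r * u * (beta i * u) by rewrite wE; ring.
have ru0 : 0 <= r * r * u by rewrite rr; exact: mulr_ge0.
apply: le_trans (ler_wpM2l ru0 hb).
have h3 : r * u <= r * r * u by rewrite -mulrA ler_peMl// mulr_ge0// ltW.
rewrite wE; apply: le_trans (lerD (ler_wpM2l (ler0n R 3) h3) (ler_wpM2l (ler0n R 2) hg)) _.
by rewrite le_eqVlt; apply/orP; left; apply/eqP; ring.
Qed.

Lemma polynomial_regular : exists i0, 
  [/\ forall i, (i0 <= i)%N -> 0 < w i,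
   forall i, (i0 <= i)%N -> win_count R x (m i) (l i) <= 2 * w i,
   forall i, (i0 <= i)%N -> w i / 4 <= win_count R x (m i) (l i),
   forall i, (i0 <= i)%N -> \sum_((m i).+1 <= k < (m i + l i).+1) power_weight a k <= w i &
   forall i, (i0 <= i)%N ->
     3 * w i + 2 * \sum_(1 <= g < l i) `|lag_sum (centered (power_weight a) th x) (m i) (l i) g|
     <= beta i * w i ^+ 2].
Proof.
have [i1 hreg] := reg; have B8 := window_degree.
exists (i1 + 4 * (1 + 8 * B))%N.
have w0 i : (i1 + 4 * (1 + 8 * B) <= i)%N -> 0 < w i.
  move=> hi; have i0 : (0 < i)%N by lia.
  by apply: lt_le_trans (window_mass_ge i0); rewrite exprn_gt0// ltr0n.
have count i : (i1 + 4 * (1 + 8 * B) <= i)%N ->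
    w i / 4 <= win_count R x (m i) (l i) <= 2 * w i.
  move=> hi; have [h _] := hreg i ltac:(lia).
  apply: (window_count_bounds _ h (@window_count_error i _) (ltW (w0 i hi))); last by lia.
  by apply: window_weight_sum; lia.
split => // [i /count/andP[]//|i /count/andP[]//|i hi|i hi].
  by have /andP[] := @window_weight_sum i ltac:(lia).
apply: window_lag_sum; [lia|apply: hreg; lia|by case/andP: (count i hi)].
Qed.

Lemma window_succs i : (succs x (m i.+1))%:R = (succs x (m i))%:R + win_count R x (m i) (l i) :> R.
Proof. by rewrite !succs_sum windows_consecutive (big_cat_nat (n := (m i).+1))//= ltnS leq_addr. Qed.

Lemma succs_windows i0 i : (0 < i0)%N ->
  (forall i, (i0 <= i)%N -> w i / 4 <= win_count R x (m i) (l i)) ->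
  (i0 <= i)%N -> s i / 4 * ((m i)%:R - (m i0)%:R) <= (succs x (m i))%:R.
Proof.
move=> i00 count4; elim: i => [|i IH].
  by rewrite leqn0 => /eqP ->; rewrite subrr mulr0.
rewrite leq_eqVlt => /predU1P[<-|]; first by rewrite subrr mulr0.
rewrite ltnS => ii; have {}IH := IH ii; have B8 := window_degree.
have sS : s i.+1 <= s i.
  by apply: power_weight_le; rewrite ?expn_gt0 ?leq_exp2r//; lia.
have mm : (m i0)%:R <= (m i.+1)%:R :> R by rewrite ler_nat leq_exp2r; lia.
rewrite window_succs; apply: le_trans (lerD IH (count4 i ii)).
apply: (@le_trans _ _ (s i / 4 * ((m i.+1)%:R - (m i0)%:R))).
  by apply: ler_wpM2r; rewrite ?subr_ge0// ler_pM2r ?invr_gt0.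
by rewrite windows_consecutive natrD /w le_eqVlt; apply/orP; left; apply/eqP; field.
Qed.

Lemma succs_le M M' : (M <= M')%N -> (succs x M)%:R <= (succs x M')%:R :> R.
Proof.
by move=> MM; rewrite !succs_sum [leRHS](big_cat_nat (n := M.+1))//= lerDl sumr_ge0.
Qed.

(** The weights before the window are at least [s i], so the quotient of [w i] by the earlier
    successes is at most of order [l i / m i], that is [1 / i]. *)
Lemma window_mass_small i0 : (0 < i0)%N ->
  (forall i, (i0 <= i)%N -> w i / 4 <= win_count R x (m i) (l i)) ->
  forall eta : R, 0 < eta -> exists i1, forall i, (i1 <= i)%N -> w i <= eta * (succs x (m i))%:R.
Proof.
move=> i00 count4 eta eta0; have B8 := window_degree.
exists (i0 + 2 * m i0 + 2 * B + Num.truncn (16 * B%:R / eta))%N => i hi.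
have ii : (i0 <= i)%N by lia.
have [_ h1] := @window_length_le i ltac:(lia).
have h2 := succs_windows i00 count4 ii.
have i_gt0 : (0 < i)%N by lia.
have mi : 2 * (m i0)%:R <= (m i)%:R :> R.
  rewrite -natrM ler_nat; apply: (@leq_trans i); first by lia.
  by rewrite /m -{1}(expn1 i) leq_pexp2l//; lia.
have /andP[s0 _] := window_weight01 i.
have h3 : s i * (m i)%:R <= 8 * (succs x (m i))%:R.
  have : s i / 4 * ((m i)%:R / 2) <= (succs x (m i))%:R.
    apply: le_trans h2; apply: ler_wpM2l; first by rewrite divr_ge0.
    by move: mi; move: (m i)%:R (m i0)%:R => u v; lra.
  move: (succs _ _)%:R => S h; apply: le_trans (ler_wpM2l (ler0n R 8) h).
  by rewrite le_eqVlt; apply/orP; left; apply/eqP; field.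
have h4 : 16 * B%:R / eta <= i.+1%:R.
  by apply: le_trans (ltW (truncnS_gt _)) _; rewrite ler_nat ltnS (leq_trans (leq_addl _ _) hi).
have y0 : 0 < i.+1%:R :> R by rewrite ltr0n.
rewrite -(ler_pM2l y0) /w mulrA.
apply: (@le_trans _ _ (2 * B%:R * (m i)%:R * s i)); first exact: ler_wpM2r.
apply: (@le_trans _ _ (16 * B%:R * (succs x (m i))%:R)).
  have -> : 2 * B%:R * (m i)%:R * s i = 2 * B%:R * (s i * (m i)%:R) by ring.
  have -> : 16 * B%:R * (succs x (m i))%:R = 2 * B%:R * (8 * (succs x (m i))%:R) :> R by ring.
  by apply: ler_wpM2l => //; exact: mulr_ge0.
by rewrite mulrA; apply: ler_wpM2r => //; rewrite -ler_pdivrMr.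
Qed.

Lemma succs_unbounded i0 :
  (forall i, (i0 <= i)%N -> w i / 4 <= win_count R x (m i) (l i)) ->
  forall A : R, exists M0, forall M, (M0 <= M)%N -> A <= (succs x M)%:R.
Proof.
move=> count4 A; pose i := (i0 + (Num.truncn (4 * `|A|)).+1)%N.
exists (m i.+1) => M /succs_le; apply: le_trans => //; rewrite window_succs.
have i_gt0 : (0 < i)%N by rewrite /i addnS.
have h1 := window_mass_ge i_gt0; have h2 := count4 i (leq_addr _ _).
have h3 : 4 * `|A| <= i%:R.
  by apply: le_trans (ltW (truncnS_gt _)) _; rewrite ler_nat leq_addl.
have h4 : i%:R <= i%:R ^+ 4 :> R by rewrite -natrX ler_nat -{1}(expn1 i) leq_pexp2l.
apply: le_trans (ler_norm _) _; apply: (@le_trans _ _ (win_count R x (m i) (l i))).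
  apply: le_trans h2; rewrite ler_pdivlMr// mulrC; apply: le_trans h3 _.
  exact: le_trans h4 h1.
by rewrite lerDr.
Qed.

End RegularSequence.
End PolynomialWindows.

(** * Pointwise convergence for a fixed regular sequence of trials *)

Section DeterministicTheorem.
Variables (R : realType) (a : R).
Hypothesis ha : 0 < a < 1 / 2.
Variables (x : nat -> bool) (th : nat -> R) (B : nat).
Hypothesis th1 : forall n, `|th n| <= 1.
Hypothesis th_mean : mean0 th.
Hypothesis hB : 4 <= B%:R * (1 / 2 - a).
Hypothesis dyadic_reg : exists j1, forall j, (j1 <= j)%N ->
  regular_window (power_weight a) (fun=> 1) x (2 ^ j) (2 ^ j) (power_weight a 2 ^+ j).
Hypothesis poly_reg : exists i1, forall i, (i1 <= i)%N ->
  regular_window (power_weight a) th x (i ^ B) (i.+1 ^ B - i ^ B) (power_weight a (i ^ B)).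

Lemma mean0_from1 (e : R) : 0 < e -> exists N0, forall N, (N0 <= N)%N ->
  `|\sum_(1 <= n < N.+1) th n| <= e * N%:R.
Proof.
move=> e0; have e2 : 0 < e / 2 by rewrite divr_gt0.
have [N0 hN] := th_mean e2; exists (N0 + (Num.truncn ((e / 2 + 1) / (e / 2))).+1)%N => N hN0.
have h1 := hN N.+1 (leq_trans (leq_addr _ _) (leqW hN0)).
have h2 : (e / 2 + 1) / (e / 2) <= N%:R.
  by apply: le_trans (ltW (truncnS_gt _)) _; rewrite ler_nat (leq_trans (leq_addl _ _) hN0).
rewrite ler_pdivrMr// in h2; rewrite big_nat_recl//= in h1.
rewrite big_add1 /=; have := th1 0%N; move: h1 h2; rewrite -[N.+1%:R]natr1.
set S := \sum_(0 <= i < N) _ => h1 h2 h3.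
have -> : S = (th 0%N + S) - th 0%N by ring.
by apply: le_trans (ler_normB _ _) _; move: h1 h2 h3; move: (N%:R) `|_| `|_| => u v t; lra.
Qed.

Lemma succs_to_infty (A : R) : exists M0, forall M, (M0 <= M)%N -> A <= (succs x M)%:R.
Proof.
have [i0 [_ _ count4 _ _]] := polynomial_regular ha hB poly_reg.
exact: (succs_unbounded ha hB count4).
Qed.

Lemma twisted_pointwise (d : measure_display) (Y : measurableType d) (mu : probability Y R)
    (T : Y -> Y) (f : Y -> R) : measure_preserving mu T -> mu.-integrable setT (EFin \o f) ->
  {ae mu, forall y, negligible_sum x (twisted_sum x th (fun k => f (iter k T y)))}.
Proof.
move=> mpT intf; have [hv hv1] := power_weight2 ha.
have [rho [Krho [j0 [rho0 rho_sum cle cge lag]]]] := dyadic_regular ha dyadic_reg.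
have v0 := @power_weight_gt0 R a 2 isT.
set v := power_weight a 2 in hv hv1 v0 cle cge lag; pose q := 2 * v.
have q1 : 1 < q.
  have s2 : Num.sqrt 2 <= 2 :> R.
    rewrite -ler_sqr ?nnegrE ?sqrtr_ge0// sqr_sqrtr// -natrX ler_nat//.
  by apply: lt_le_trans hv _; rewrite /q mulrC ler_pM2r.
have qE j : q ^+ j / (2 ^ j)%:R = v ^+ j.
  by rewrite natrX /q exprMn mulrAC mulfV ?mul1r// expf_neq0.
have [i0' [w0 c2 c4 sw bl]] := polynomial_regular ha hB poly_reg.
(* Shifted by one to start at a positive index: [power_weight a 0] is 0, so the weights decrease
   only from 1 on. *)
pose i0 := i0'.+1; have up (Q : nat -> Prop) : (forall i, (i0' <= i)%N -> Q i) ->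
    forall i, (i0 <= i)%N -> Q i by move=> h i /ltnW; exact: h.
have sinf := succs_to_infty.
have s01 := power_weight01 ha.
apply: (@ae_negligible_integrable R x th th1 sinf _ d Y mu T
  (7 * (q / (q - 1)) + 2 * Krho + 3) (8 * q ^+ 2 / (q - 1)) mpT) => //.
- by move=> c; apply: invariant_negligible => // e e0; exact: mean0_from1.
- have K0 : 0 <= Krho by have := rho_sum 0%N; rewrite big_geq.
  have : 0 <= q / (q - 1) by apply: divr_ge0; rewrite ?subr_ge0 ltW// (lt_trans ltr01).
  by move: (q / _) => u; lra.
- move=> h t inth h0 t0.
  have sle j k : (2 ^ j < k <= 2 ^ j + 2 ^ j)%N -> 0 <= power_weight a k <= q ^+ j / (2 ^ j)%:R.
    move=> /(dyadic_weights ha)/andP[_ h2]; rewrite qE h2 andbT.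
    by case/andP: (s01 k).
  have s1 j : q ^+ j / (2 ^ j)%:R <= 1 by rewrite qE exprn_ile1// ltW.
  have [U [mU hU UP]] := weak_type_average mpT q1 sle s1 rho0 rho_sum cle cge lag inth h0 t0.
  exists U; split => // y /UP[A hA]; exists A, (2 ^ j0.+1)%N; exact: hA.
- move=> g bg; apply: (ae_coboundary_negligible th1 s01 _ _ sinf mpT _ _ (up _ w0) (up _ c2) (up _ c4)
    (up _ sw) (up _ bl) _ _ _ bg).
  + by move=> k k0; exact: (power_weight_le ha).
  + exact: (power_weight_cvg0 ha).
  + exact: (windows_consecutive ha hB).
  + exact: (window_length_gt0 ha hB).
  + exact: beta_ge0.
  + exact: sum_beta.
  + exact: (window_mass_small ha hB (isT : (0 < i0)%N) (up _ c4)).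
Qed.

End DeterministicTheorem.

(** * From sums over trials to averages along hitting times *)

Section HittingTimes.
Variables (R : realType) (d : measure_display) (Omega : measurableType d).
Variables (P : probability Omega R) (X : nat -> {RV P >-> R}).
Hypothesis X01 : forall n, (1 <= n)%N -> forall w, X n w = 0 \/ X n w = 1.
Variable w : Omega.
Let x := trials X w.

Lemma succsS k : succs x k.+1 = (x k.+1 + succs x k)%N.
Proof. by rewrite /succs /=. Qed.

Lemma succs_leq k : (succs x k <= k)%N.
Proof. by elim: k => // k IH; rewrite succsS; case: (x k.+1) => /=; lia. Qed.

Lemma succs_mono k k' : (k <= k')%N -> (succs x k <= succs x k')%N.
Proof.
move=> h; rewrite -(subnKC h); elim: (k' - k)%N => [|n IH]; first by rewrite addn0.
by rewrite addnS succsS; lia.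
Qed.

Lemma sum_trials k : \sum_(1 <= i < k.+1) X i w = (succs x k)%:R.
Proof.
elim: k => [|k IH]; first by rewrite big_geq.
rewrite big_nat_recr//= IH succsS natrD addrC; congr (_ + _).
rewrite /x /trials; case: (X01 (n := k.+1) isT w) => ->; last by rewrite eqxx.
by rewrite eq_sym oner_eq0.
Qed.

Lemma hitting_indexE n k : succs x k = n -> (forall k', (k' < k)%N -> (succs x k' < n)%N) ->
  hitting_index X n w = k.
Proof.
move=> hk hmin; apply: xget_unique.
  split; first by rewrite sum_trials hk.
  move=> k'; rewrite sum_trials => /eqP; rewrite eqr_nat => /eqP E.
  by rewrite leqNgt; apply/negP => /hmin; rewrite E ltnn.
move=> k' [/eqP h1 h2]; apply/eqP; rewrite eqn_leq h2 ?sum_trials ?hk//= leqNgt.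
apply/negP => /hmin; move: h1; rewrite sum_trials eqr_nat => /eqP ->.
by rewrite ltnn.
Qed.

Lemma hitting_time n : (exists k, n <= succs x k)%N -> exists k, succs x k = n /\ hitting_index X n w = k.
Proof.
move=> ex; have [k hk kmin] := ex_minnP ex; exists k.
have hmin k' : (k' < k)%N -> (succs x k' < n)%N by move=> kk; rewrite ltnNge; apply/negP => /kmin; lia.
(* The count rises by at most 1 at a time, so the first [k] with at least [n] successes has exactly
   [n]. *)
have E : succs x k = n.
  apply/eqP; rewrite eqn_leq hk andbT; case: k {kmin hk} hmin => [|k] hmin //.
  by have := hmin k (ltnSn _); rewrite succsS; case: (x k.+1) => /=; lia.
by split => //; exact: hitting_indexE.
Qed.

Lemma twisted_sum_hitting (th f : nat -> R) k :
  twisted_sum x th f k = \sum_(1 <= n < (succs x k).+1) th n * f (hitting_index X n w).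
Proof.
elim: k => [|k IH]; first by rewrite /twisted_sum !big_geq.
rewrite /twisted_sum big_nat_recr//= -/(twisted_sum x th f k) IH !succsS.
case xk: (x k.+1) => /=; last by rewrite mul0r mul0r addr0.
rewrite add1n [RHS]big_nat_recr//= mul1r; congr (_ + _ * f _); apply/esym/hitting_indexE.
  by rewrite succsS xk.
by move=> k' kk; rewrite ltnS; exact: succs_mono.
Qed.

(** Evaluate at the hitting time [k] of [N]: the count there is [N], and [k >= N] passes any
    threshold that [N] passes. *)
Lemma hitting_average (th f : nat -> R) :
  (forall A : R, exists M0, forall M, (M0 <= M)%N -> A <= (succs x M)%:R) ->
  negligible_sum x (twisted_sum x th f) -> forall e : R, 0 < e -> exists N0, forall N, (N0 <= N)%N ->
  `|\sum_(1 <= n < N.+1) th n * f (hitting_index X n w)| <= e * N%:R.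
Proof.
move=> sinf neg e /neg[M0 hM0]; exists M0 => N hN.
have [|k [Ek _]] := @hitting_time N.
  by have [M hM] := sinf N%:R; exists M; rewrite -(ler_nat R); exact: hM.
have := hM0 k; rewrite twisted_sum_hitting Ek; apply.
by apply: leq_trans hN _; rewrite -Ek succs_leq.
Qed.

End HittingTimes.

(** * Real and imaginary parts *)

Section ComplexAverages.
Variable R : realType.

Lemma sum_complex (I : Type) (r : seq I) (u v : I -> R) :
  \sum_(i <- r) (u i +i* v i)%C = ((\sum_(i <- r) u i) +i* (\sum_(i <- r) v i))%C.
Proof. by elim: r => [|i r IH]; rewrite ?big_nil// !big_cons IH. Qed.

Lemma normc_le (u v : R) : `|(u +i* v)%C| <= (`|u| + `|v|)%:C%C.
Proof.
rewrite normc_def lecR /= -[leRHS]ger0_norm ?addr_ge0// -sqrtr_sqr ler_wsqrtr//.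
by rewrite sqrrD !real_normK ?num_real// addrAC lerDl mulrn_wge0// mulr_ge0.
Qed.

Lemma average_cvg0 (z : nat -> R[i]) (u v : nat -> R) :
  (forall N, z N = N%:R^-1 * (u N +i* v N)%C) ->
  (forall e, 0 < e -> exists N0, forall N, (N0 <= N)%N -> `|u N| <= e * N%:R) ->
  (forall e, 0 < e -> exists N0, forall N, (N0 <= N)%N -> `|v N| <= e * N%:R) ->
  (z N : R[i]^o) @[N --> \oo] --> (0 : R[i]^o).
Proof.
move=> zE hu hv; apply/cvgrPdist_lt => eps eps0.
(* In the order of [R[i]] comparable numbers have equal imaginary parts, so a positive [eps] is a
   positive real. *)
have [re [re0 reE]] : exists re : R, 0 < re /\ eps = re%:C%C.
  move: eps0; case: eps => s t; rewrite ltcE /= => /andP[/eqP -> s0].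
  by exists s.
have e4 : 0 < re / 4 by rewrite divr_gt0.
have [N1 h1] := hu _ e4; have [N2 h2] := hv _ e4.
exists (N1 + N2).+1 => // N /= hN; rewrite sub0r normrN zE normrM.
have N0 : 0 < N%:R :> R by rewrite ltr0n (leq_ltn_trans _ hN).
have -> : `|N%:R^-1 : R[i]| = (N%:R^-1)%:C%C.
  by rewrite -(rmorph_nat (real_complex R)) -fmorphV normc_def /= expr0n addr0 sqrtr_sqr ger0_norm// invr_ge0 ltW.
apply: le_lt_trans (_ : _ <= (N%:R^-1 * (re / 4 * N%:R + re / 4 * N%:R))%:C%C) _.
  rewrite rmorphM; apply: ler_wpM2l; first by rewrite lecR invr_ge0 ltW.
  apply: le_trans (normc_le _ _) _; rewrite lecR; apply: lerD; [apply: h1|apply: h2]; lia.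
rewrite reE ltcR.
have -> : N%:R^-1 * (re / 4 * N%:R + re / 4 * N%:R) = re / 2 by field; rewrite gt_eqF.
lra.
Qed.

End ComplexAverages.

Lemma random_average_reim (R : realType) (Y : Type) (p : R -> R) (b : nat -> nat) (T : Y -> Y)
    (f : Y -> R[i]) N y :
  let c n := cos (2 * pi * p n%:R) in let s n := sin (2 * pi * p n%:R) in
  let re k := complex.Re (f (iter k T y)) in let im k := complex.Im (f (iter k T y)) in
  random_average p b T f N y = N%:R^-1 *
  ((\sum_(1 <= n < N.+1) c n * re (b n) - \sum_(1 <= n < N.+1) s n * im (b n)) +i*
   (\sum_(1 <= n < N.+1) c n * im (b n) + \sum_(1 <= n < N.+1) s n * re (b n)))%C.
Proof.
move=> c s re im; rewrite /random_average -sumrB -big_split /= -sum_complex; congr (_ * _).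
by apply: eq_bigr => n _; rewrite /re /im /e; case: (f _).
Qed.

Theorem theorem1p4 (R : realType) (a : R) (ha : 0 < a < 1 / 2)
  (d : measure_display) (Omega : measurableType d) (P : probability Omega R)
  (X : nat -> {RV P >-> R})
  (X01 : forall n, (1 <= n)%N -> forall w, X n w = 0 \/ X n w = 1)
  (Xind : independent_RVs [set n | (1 <= n)%N] X)
  (EX : forall n, (1 <= n)%N -> ('E_P[X n] = (n%:R `^ (- a))%:E)%E)
  (eps : R) (heps : 0 < eps < 1)
  (p : R -> R) (pLE : logarithmico_exponential p)
  (p1 : exists C : R, forall x y z : R, 0 < x -> 0 < y -> 0 < z ->
    `|p (x + y + z) - p (x + y) - p (x + z) + p x|
      <= C * (x `^ (eps - 1) * y * z))
  (p2 : forall (c : R) (q : {poly rat}),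
    `|(c *: map_poly ratr q).[x] - p x| / ln x @[x --> +oo] --> +oo) :
  {ae P, forall w : Omega,
    forall (d' : measure_display) (Y : measurableType d')
           (mu : probability Y R) (T : Y -> Y) (f : Y -> R[i]),
      measure_preserving mu T -> complex_L1 mu f ->
      {ae mu, forall y : Y,
        (random_average p (fun n => hitting_index X n w) T f N y : R[i]^o)
          @[N --> \oo] --> (0 : R[i]^o)}}.
Proof.
(* The degree of the polynomial windows; it grows as [a] approaches 1/2. *)
have [B hB] : exists B : nat, 4 <= B%:R * (1 / 2 - a).
  have d0 : 0 < 1 / 2 - a by rewrite subr_gt0; case/andP: ha.
  exists (Num.truncn (4 / (1 / 2 - a))).+1; rewrite -ler_pdivrMr//.
  exact: ltW (truncnS_gt _).
pose c n := cos (2 * pi * p n%:R); pose s n := sin (2 * pi * p n%:R).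
have c_mean : mean0 c.
  have := weyl_mean0 0 heps pLE p1 p2; congr mean0.
  by apply/funext => n; rewrite addr0.
(* The sine is the cosine delayed by [pi / 2], a shift of the phase by 1/4. *)
have s_mean : mean0 s.
  have := weyl_mean0 (- (1 / 4)) heps pLE p1 p2; congr mean0.
  apply/funext => n; rewrite /s -cosBpihalf; congr cos.
  by field.
have c1 n : `|c n| <= 1 by rewrite ler_norml cos_geN1 cos_le1.
have s1 n : `|s n| <= 1 by rewrite ler_norml sin_geN1 sin_le1.
have sg01 := power_weight01 ha.
(* Untwisted dyadic windows serve the maximal inequality for absolute values; the twisted polynomial
   windows are needed for the cosine and for the sine. *)
have reg1 := @regular_windows R d Omega P X (power_weight a) (fun=> 1) X01 Xind EX sg01
  (fun=> ltac:(by rewrite normr1)) (fun j => 2 ^ j)%N (fun j => 2 ^ j)%N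
  (fun j => power_weight a 2 ^+ j) 0%N.
have reg2 th (th1 : forall n, `|th n| <= 1) := @regular_windows R d Omega P X (power_weight a) th
  X01 Xind EX sg01 th1 (fun i => i ^ B)%N (fun i => i.+1 ^ B - i ^ B)%N
  (fun i => power_weight a (i ^ B)) 2 (polynomial_window_regular ha hB).
have reg0 : forall j, (0 <= j)%N -> [/\ (j < 2 ^ j)%N, 0 <= power_weight a 2 ^+ j <= 1,
    1 <= power_weight a 2 ^+ j * Num.sqrt (2 ^ j)%:R &
    forall k, (2 ^ j < k <= 2 ^ j + 2 ^ j)%N -> power_weight a k <= power_weight a 2 ^+ j].
  move=> j _; have [u1 u2 u3] := dyadic_window_regular ha j; split => // k.
  by move=> /(dyadic_weights ha)/andP[].
(* The three random events involve only [a], [p] and the trials; the system and [f] are introduced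
   after [w] has been fixed. *)
move: (reg1 reg0) (reg2 c c1) (reg2 s s1); apply: filterS3 => w h1 h2 h3 d' Y mu T f mpT [intRe intIm].
have sinf := succs_to_infty ha hB h2.
have H (g : Y -> R) : mu.-integrable setT (EFin \o g) -> {ae mu, forall y, forall e, 0 < e ->
    exists N0, forall N, (N0 <= N)%N ->
    `|\sum_(1 <= n < N.+1) c n * g (iter (hitting_index X n w) T y)| <= e * N%:R /\
    `|\sum_(1 <= n < N.+1) s n * g (iter (hitting_index X n w) T y)| <= e * N%:R}.
  move=> intg; have := twisted_pointwise ha c1 c_mean hB h1 h2 mpT intg.
  have := twisted_pointwise ha s1 s_mean hB h1 h3 mpT intg.
  apply: filterS2 => y /(hitting_average X01 sinf) hs /(hitting_average X01 sinf) hc e e0.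
  have [N1 b1] := hc e e0; have [N2 b2] := hs e e0.
  exists (N1 + N2)%N => N hN; split; [apply: b1|apply: b2]; apply: leq_trans hN.
    exact: leq_addr.
  exact: leq_addl.
move: (H _ intRe) (H _ intIm); apply: filterS2 => y hr hi.
apply: average_cvg0 => [N|e e0|e e0]; first exact: random_average_reim.
- have e2 : 0 < e / 2 by rewrite divr_gt0.
  have [N1 b1] := hr _ e2; have [N2 b2] := hi _ e2.
  exists (N1 + N2)%N => N hN; have [u _] := b1 N (leq_trans (leq_addr _ _) hN).
  have [_ v] := b2 N (leq_trans (leq_addl _ _) hN).
  by apply: le_trans (ler_normB _ _) _; apply: le_trans (lerD u v) _; rewrite -mulrDl -splitr.
- have e2 : 0 < e / 2 by rewrite divr_gt0.
  have [N1 b1] := hr _ e2; have [N2 b2] := hi _ e2.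
  exists (N1 + N2)%N => N hN; have [_ u] := b1 N (leq_trans (leq_addr _ _) hN).
  have [v _] := b2 N (leq_trans (leq_addl _ _) hN).
  by apply: le_trans (ler_normD _ _) _; apply: le_trans (lerD v u) _; rewrite -mulrDl -splitr.
Qed.
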